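(* Let $0\le k\le n$, $n\ge1$. For Young diagrams $\lambda,\mu$ in the $k\times(n-k)$ rectangle, let $c_{\lambda,\mu}^{\,\,\nu}(\vec y)$ be the coefficients defined by the identity in $K_T(Gr(k,n))$ $$G_\lambda(\bar x;\vec y)\,G_\mu(\bar x;\vec y)=\sum_\nu c_{\lambda,\mu}^{\,\,\nu}(\vec y)\,G_\nu(\bar x;\vec y),$$ where $\nu$ runs over Young diagrams in the $k\times(n-k)$ rectangle. Then for all such $\lambda,\mu,\nu$, $c_{\lambda,\mu}^{\,\,\nu}(\vec y)$ equals the sum of the weights of all equivariant puzzles in a down-pointing equilateral triangle of side $n$ whose boundary is as follows: the left side, read from the top-left corner to the bottom corner, encodes $\lambda$; the right side, read from the bottom corner to the top-right corner, encodes $\mu$; the top horizontal side, read from left to right, encodes $\nu$. Here the parameter of an elementary lozenge is $w=y_i/y_j$, where, numbering the unit edges of the top side $1,\dots,n$ from left to right, $i$ is the number of the top edge reached from the centre of the lozenge by going straight up-left (direction $120^\circ$), and $j$ is the number of the top edge reached from the centre by going straight up-right (direction $60^\circ$); thus $1\le i<j\le n$.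
   Context: **Young diagrams.** Fix $0\le k\le n$. A Young diagram $\lambda$ (English convention) in the $k\times(n-k)$ rectangle ($k$ rows, $n-k$ columns) is encoded by its frame, a $k$-subset of $\{1,\dots,n\}$: follow the border of $\lambda$ from the bottom-left to the top-right corner of the rectangle in $n$ unit steps (up or right), and record $i$ if the $i$-th step is up. So $\varnothing$ has frame $\{1,\dots,k\}$ and the full rectangle has frame $\{n-k+1,\dots,n\}$. Write $i\in\lambda$ if $i$ is in the frame of $\lambda$; $\lambda^\ast$ is the diagram with frame $\{n+1-i: i\in\lambda\}$. **Polynomials.** Let $\bar x=(x_1,\dots,x_k)$, $\vec y=(y_1,\dots,y_n)$, $\overleftarrow{y}=(y_n,\dots,y_1)$. The double Grothendieck polynomials $G^\lambda(\bar x;\vec y)$ are defined inductively by $G^{\{n-k+1,\dots,n\}}(\bar x;\vec y)=\prod_{i=1}^k\prod_{j=1}^{n-k}(1-x_i/y_j)$ and $G^\mu=D_iG^\lambda$ whenever the frame of $\mu$ is obtained from that of $\lambda$ by replacing $i+1$ with $i$, where $D_if=\dfrac{y_if(\ldots,y_i,y_{i+1},\ldots)-y_{i+1}f(\ldots,y_{i+1},y_i,\ldots)}{y_i-y_{i+1}}$ acts on the $y$ variables. The dual polynomials are $G_\lambda(\bar x;\vec y)=\prod_{i=1}^kx_i\prod_{i\in\lambda}y_i^{-1}\,G^{\lambda^\ast}(\bar x;\overleftarrow{y})$. **Ring.** $K_T(Gr(k,n))$ is the quotient of $\mathbb Z[x_1^{\pm1},\dots,x_k^{\pm1},y_1^{\pm1},\dots,y_n^{\pm1}]^{\mathcal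 S_k}$ ($\mathcal S_k$ permuting the $x_i$) by the ideal of elements that vanish whenever $(x_1,\dots,x_k)$ is specialized to $(y_{i_1},\dots,y_{i_k})$ for any $i_1<\dots<i_k$. It is known that the classes of the $G_\lambda(\bar x;\vec y)$ form a $\mathbb Z[y_1^{\pm1},\dots,y_n^{\pm1}]$-basis. **Equivariant puzzles.** Consider the triangular lattice of unit equilateral triangles with horizontal edges. Each unit triangle has a horizontal edge $h$, an edge $a$ in direction $60^\circ/240^\circ$ and an edge $b$ in direction $120^\circ/300^\circ$; for an up-pointing triangle $a$ is the left and $b$ the right edge; for a down-pointing triangle $a$ is the right and $b$ the left edge. Each edge has a state, a subset of $\{R,G\}$ (red, green), written $\emptyset,R,G,RG$. The allowed tiles, given by the states $(h,a,b)$, are $E=(\emptyset,\emptyset,\emptyset)$, $G_1=(G,G,\emptyset)$, $G_2=(G,RG,R)$, $R_1=(R,\emptyset,R)$, $R_2=(R,G,RG)$, $Q=(RG,G,R)$ (equivariant tile), for both up- and down-pointing triangles, and the $K$-tile $K=(\emptyset,RG,RG)$ for up-pointing triangles only. An equivariant puzzle in a domain is an assignment of an allowed tile to every unit triangle of the domain such that triangles sharing an edge assign it the same state. **Boundary conditions.** Horizontal boundary edges must be in state $R$ or $G$; boundary edges in direction $60^\circ/240^\circ$ in state $G$ or $\emptyset$; boundary edges in direction $120^\circ/300^\circ$ in state $R$ or $\emptyset$. A side of length $n$, read in a given direction, encodes the Young diagram whose frame is the set of positions (numbered $1,\dots,n$ along the reading direction) of the $G$ edges for horizontal and $60^\circ/240^\circ$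 sides, and of the $\emptyset$ edges for $120^\circ/300^\circ$ sides. **Weights.** An elementary lozenge is the union of an up-pointing unit triangle and the down-pointing unit triangle just below it, sharing a horizontal edge, both in the domain. Its weight depends on a parameter $w$ (depending on its location) and on its (upper tile, lower tile): $(G_2,G_1)$ has weight $w$; $(R_2,R_1)$ has weight $w$; $(Q,Q)$ has weight $1-w$; $(K,E)$ has weight $-w$; all the others, $(G_1,G_1),(G_1,G_2),(G_2,G_2),(R_1,R_1),(R_1,R_2),(R_2,R_2),(E,E)$, have weight $1$. The weight of an equivariant puzzle is the product of the weights of all its elementary lozenges (unit triangles not belonging to an elementary lozenge contribute no factor). *)

(* Defs.v *)
From HB Require Import structures.
From mathcomp Require Import all_boot all_order all_fingroup all_algebra.
From mathcomp Require Import ring_quotient generic_quotient fraction.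
From mathcomp Require Import boolp mpoly ring zify.

Set Implicit Arguments.
Unset Strict Implicit.
Unset Printing Implicit Defensive.

Import GRing.Theory.
Local Open Scope ring_scope.

Local Notation "p %:F" := (tofrac p).

(* Laurent polynomials over Z in m variables: the fractions p / X^a in the
   field of fractions of Z[X_0, ..., X_(m-1)]. *)
Definition laurent_frac (m : nat) : {pred {fraction {mpoly int[m]}}} :=
  fun f => `[< exists p : {mpoly int[m]}, exists a : 'X_{1..m},
                 f = p%:F / 'X_[a]%:F >].
Arguments laurent_frac : clear implicits.

Section LaurentClosed.
Variable m : nat.
Implicit Types (p q : {mpoly int[m]}) (a b : 'X_{1..m}).

Lemma mpolyX_frac_neq0 a : ('X_[a] : {mpoly int[m]})%:F != 0.
Proof.
rewrite tofrac_eq0; apply/eqP=> /mpolyP /(_ a).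
by rewrite mcoeffX eqxx mcoeff0 => /eqP; rewrite oner_eq0.
Qed.

Lemma laurent_frac_closed : subring_closed (laurent_frac m).
Proof.
split.
- apply/asboolP; exists 1, 0%MM.
  by rewrite mpolyX0 divr1 rmorph1.
- move=> f g /asboolP [p [a ->]] /asboolP [q [b ->]]; apply/asboolP.
  exists (p * 'X_[b] - q * 'X_[a]), (a + b)%MM.
  rewrite -mulNr addf_div ?mpolyX_frac_neq0 // mulNr.
  by rewrite mpolyXD rmorphB !rmorphM.
- move=> f g /asboolP [p [a ->]] /asboolP [q [b ->]]; apply/asboolP.
  exists (p * q), (a + b)%MM.
  by rewrite mulf_div mpolyXD !rmorphM.
Qed.

HB.instance Definition _ :=
  GRing.isSubringClosed.Build {fraction {mpoly int[m]}} (laurent_frac m)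
    laurent_frac_closed.

End LaurentClosed.

Record laurent (m : nat) :=
  Laurent { laurent_val :> {fraction {mpoly int[m]}};
            _ : laurent_val \in laurent_frac m }.
Arguments Laurent {m}.

HB.instance Definition _ m := [isSub for @laurent_val m].
HB.instance Definition _ m := [Choice of laurent m by <:].
HB.instance Definition _ m :=
  [SubChoice_isSubComNzRing of laurent m by <:].

Section LaurentUnit.
Variable m : nat.

Definition laurent_unit : {pred laurent m} :=
  fun f => `[< exists g : laurent m, g * f = 1 >].

Definition laurent_inv (f : laurent m) : laurent m :=
  if pselect (exists g : laurent m, g * f = 1) is left e
  then projT1 (cid e) else f.

Lemma laurent_mulVr : {in laurent_unit, left_inverse 1 laurent_inv *%R}.
Proof.
move=> f /asboolP uf; rewrite /laurent_inv; case: pselect => // e.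
by case: (cid e).
Qed.

Lemma laurent_unitP f g : g * f = 1 -> f \in laurent_unit.
Proof. by move=> gf; apply/asboolP; exists g. Qed.

Lemma laurent_inv_out : {in [predC laurent_unit], laurent_inv =1 id}.
Proof.
move=> f nuf; rewrite /laurent_inv; case: pselect => // e.
by case/negP: nuf; apply/asboolP.
Qed.

HB.instance Definition _ :=
  GRing.ComNzRing_hasMulInverse.Build (laurent m)
    laurent_mulVr laurent_unitP laurent_inv_out.

Lemma laurent_idomain : GRing.integral_domain_axiom (laurent m).
Proof.
move=> f g /(congr1 val) /eqP; rewrite rmorphM rmorph0 mulf_eq0.
by rewrite -!(inj_eq val_inj) rmorph0.
Qed.

HB.instance Definition _ :=
  GRing.ComUnitRing_isIntegral.Build (laurent m) laurent_idomain.

End LaurentUnit.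

Section LaurentPoly.
Variable m : nat.
Implicit Types (p q : {mpoly int[m]}) (a b : 'X_{1..m}).

Lemma laurent_poly_subproof p : p%:F \in laurent_frac m.
Proof. by apply/asboolP; exists p, 0%MM; rewrite mpolyX0 divr1. Qed.

Definition laurent_poly p : laurent m := Laurent p%:F (laurent_poly_subproof p).

Lemma laurent_poly_is_zmod_morphism : zmod_morphism laurent_poly.
Proof. by move=> p q; apply: val_inj; rewrite /= !rmorphB. Qed.

Lemma laurent_poly_is_monoid_morphism : monoid_morphism laurent_poly.
Proof. by split=> [|p q]; apply: val_inj; rewrite /= ?rmorph1 ?rmorphM. Qed.

HB.instance Definition _ :=
  GRing.isZmodMorphism.Build {mpoly int[m]} (laurent m) laurent_poly
    laurent_poly_is_zmod_morphism.
HB.instance Definition _ :=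
  GRing.isMonoidMorphism.Build {mpoly int[m]} (laurent m) laurent_poly
    laurent_poly_is_monoid_morphism.

Lemma laurent_poly_inj : injective laurent_poly.
Proof. by move=> p q /(congr1 val) /= /eqP; rewrite tofrac_eq => /eqP. Qed.

Lemma laurent_polyX_unit a : laurent_poly 'X_[a] \is a GRing.unit.
Proof.
have h : (1 / ('X_[a] : {mpoly int[m]})%:F) \in laurent_frac m.
  by apply/asboolP; exists 1, a; rewrite rmorph1.
apply/unitrPr; exists (Laurent _ h); apply: val_inj => /=.
by rewrite mul1r mulfV ?mpolyX_frac_neq0 ?rmorph1.
Qed.

Lemma laurent_fracP (f : laurent m) :
  exists pa : {mpoly int[m]} * 'X_{1..m},
    f * laurent_poly 'X_[pa.2] == laurent_poly pa.1.
Proof.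
case: f => f hf; move/asboolP: (hf) => [p [a fE]]; exists (p, a).
by apply/eqP/val_inj; rewrite /= fE divfK ?mpolyX_frac_neq0.
Qed.

Definition lvar (i : 'I_m) : laurent m := laurent_poly 'X_i.

Lemma lvar_unit i : lvar i \is a GRing.unit.
Proof. exact: laurent_polyX_unit. Qed.

Lemma laurent_ind (P : laurent m -> Prop) :
  P 1 -> (forall i, P (lvar i)) ->
  (forall f g, P f -> P g -> P (f - g)) ->
  (forall f g, P f -> P g -> P (f * g)) ->
  (forall f u, u \is a GRing.unit -> P u -> P (f * u) -> P f) ->
  forall f, P f.
Proof.
move=> P1 Pv PB PM PV.
have P0 : P 0 by rewrite -(subrr 1); apply: PB.
have PN f : P f -> P (- f) by move=> Pf; rewrite -sub0r; apply: PB.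
have PD f g : P f -> P g -> P (f + g).
  by move=> Pf Pg; rewrite -[g]opprK; apply: PB => //; apply: PN.
have Pn n : P n%:R.
  by elim: n => [|n IH]; rewrite ?mulr0n // mulrS; apply: PD.
have Pz (c : int) : P c%:~R.
  by case: c => n; rewrite ?NegzE ?mulrNz -?pmulrn //; apply: PN.
have PX (r : seq 'I_m) a : P (\prod_(i <- r) lvar i ^+ a i).
  apply: (big_ind P) => // i _.
  by elim: (a i) => [|d IH]; rewrite ?expr0 // exprS; apply: PM.
have PXa a : P (laurent_poly 'X_[a]).
  rewrite mpolyXE_id rmorph_prod.
  under eq_bigr do rewrite rmorphXn.
  exact: PX.
have Pp p : P (laurent_poly p).
  rewrite [p]mpolyE rmorph_sum; apply: (big_ind P) => // a _.
  rewrite -[p@_a]intz scaler_int rmorphMz -mulrzl.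
  exact: PM.
move=> f; case: (laurent_fracP f) => pa /eqP fE.
by apply: (PV _ _ (laurent_polyX_unit pa.2)) => //; rewrite fE.
Qed.

End LaurentPoly.

Lemma laurent_rmorph_ext m (R : unitRingType)
    (phi psi : {rmorphism laurent m -> R}) :
  (forall i, phi (lvar i) = psi (lvar i)) -> phi =1 psi.
Proof.
move=> e; apply: laurent_ind => [|//|f g|f g|f u uu].
- by rewrite !rmorph1.
- by rewrite !rmorphB => -> ->.
- by rewrite !rmorphM => -> ->.
- rewrite !rmorphM => -> /mulIr; apply; exact: rmorph_unit.
Qed.

Fact frac_subr (R : comNzRingType) (u v w c d : R) :
  w * (c * d) = u * c * d - v * d * c -> w * c * d = (u - v) * c * d.
Proof. by rewrite mulrA => ->; ring. Qed.

Fact frac_mulr (R : comNzRingType) (u v w c d : R) :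
  w * (c * d) = u * c * (v * d) -> w * c * d = u * v * c * d.
Proof. by rewrite mulrA => ->; ring. Qed.

Section RenamePoly.
Variables (m m' : nat) (s : 'I_m -> 'I_m').

Definition rename_poly (p : {mpoly int[m]}) : {mpoly int[m']} :=
  p \mPo [tuple 'X_(s i) | i < m].

Lemma rename_poly_is_zmod_morphism : zmod_morphism rename_poly.
Proof. by move=> p q; rewrite /rename_poly rmorphB. Qed.

Lemma rename_poly_is_monoid_morphism : monoid_morphism rename_poly.
Proof. by split=> [|p q]; rewrite /rename_poly ?rmorph1 ?rmorphM. Qed.

HB.instance Definition _ :=
  GRing.isZmodMorphism.Build {mpoly int[m]} {mpoly int[m']} rename_poly
    rename_poly_is_zmod_morphism.
HB.instance Definition _ :=
  GRing.isMonoidMorphism.Build {mpoly int[m]} {mpoly int[m']} rename_poly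
    rename_poly_is_monoid_morphism.

End RenamePoly.

(* The substitution X_i := X_(s i); s need not be injective. *)
HB.lock Definition rename (m m' : nat) (s : 'I_m -> 'I_m') (f : laurent m) :
    laurent m' :=
  let pa := xchoose (laurent_fracP f) in
  laurent_poly (rename_poly s pa.1) / laurent_poly (rename_poly s 'X_[pa.2]).

Section Rename.
Variables (m m' : nat) (s : 'I_m -> 'I_m').
Local Notation rename_poly := (rename_poly s).
Local Notation rename := (rename s).

Lemma rename_polyX_unit a :
  laurent_poly (rename_poly 'X_[a]) \is a GRing.unit.
Proof.
rewrite /rename_poly comp_mpolyX rmorph_prod; apply: rpred_prod => i _.
by rewrite tnth_mktuple rmorphXn; apply/unitrX/lvar_unit.
Qed.

Lemma renameE f p a : f * laurent_poly 'X_[a] = laurent_poly p ->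
  rename f * laurent_poly (rename_poly 'X_[a]) = laurent_poly (rename_poly p).
Proof.
move=> fE; rewrite rename.unlock /=.
case: (xchoose _) (xchooseP (laurent_fracP f)) => q b /= /eqP gE.
apply: (mulIr (rename_polyX_unit b)).
rewrite mulrAC divrK ?rename_polyX_unit // -!rmorphM.
have -> // : q * 'X_[a] = p * 'X_[b].
by apply: laurent_poly_inj; rewrite !rmorphM /= -fE -gE mulrAC.
Qed.

Lemma rename_lpoly p : rename (laurent_poly p) = laurent_poly (rename_poly p).
Proof.
have /renameE : laurent_poly p * laurent_poly 'X_[0] = laurent_poly p.
  by rewrite mpolyX0 rmorph1 mulr1.
by rewrite mpolyX0 !rmorph1 mulr1.
Qed.

Lemma rename_is_zmod_morphism : zmod_morphism rename.
Proof.
move=> f g.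
have [[p a] /= /eqP fE] := laurent_fracP f.
have [[q b] /= /eqP gE] := laurent_fracP g.
have /renameE : (f - g) * laurent_poly 'X_[a + b] =
    laurent_poly (p * 'X_[b] - q * 'X_[a]).
  rewrite mpolyXD rmorphB !rmorphM /= -fE -gE mulrBl mulrA.
  by congr (_ - _); rewrite mulrAC mulrA.
have := renameE fE; have := renameE gE; rewrite mpolyXD => rg rf.
rewrite !rmorphB !rmorphM /= -rg -rf => h.
apply: (mulIr (rename_polyX_unit a)); apply: (mulIr (rename_polyX_unit b)).
exact: frac_subr h.
Qed.

Lemma rename_is_monoid_morphism : monoid_morphism rename.
Proof.
split=> [|f g].
  by rewrite -(rmorph1 (@laurent_poly m)) rename_lpoly !rmorph1.
have [[p a] /= /eqP fE] := laurent_fracP f.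
have [[q b] /= /eqP gE] := laurent_fracP g.
have /renameE : (f * g) * laurent_poly 'X_[a + b] = laurent_poly (p * q).
  by rewrite mpolyXD !rmorphM /= -fE -gE mulrACA.
have := renameE fE; have := renameE gE; rewrite mpolyXD => rg rf.
rewrite !rmorphM /= -rg -rf => h.
apply: (mulIr (rename_polyX_unit a)); apply: (mulIr (rename_polyX_unit b)).
exact: frac_mulr h.
Qed.

HB.instance Definition _ :=
  GRing.isZmodMorphism.Build (laurent m) (laurent m') rename
    rename_is_zmod_morphism.
HB.instance Definition _ :=
  GRing.isMonoidMorphism.Build (laurent m) (laurent m') rename
    rename_is_monoid_morphism.

Lemma rename_lvar i : rename (lvar i) = lvar (s i).
Proof.
by rewrite rename_lpoly /rename_poly comp_mpolyXU -tnth_nth tnth_mktuple.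
Qed.

End Rename.

Lemma rename_comp m m' m'' (s : 'I_m -> 'I_m') (t : 'I_m' -> 'I_m'') f :
  rename t (rename s f) = rename (t \o s) f.
Proof.
apply: (laurent_rmorph_ext (phi := rename t \o rename s)) => i /=.
by rewrite !rename_lvar.
Qed.

Lemma eq_rename m m' (s t : 'I_m -> 'I_m') : s =1 t -> rename s =1 rename t.
Proof.
by move=> e; apply: laurent_rmorph_ext => i; rewrite /= !rename_lvar e.
Qed.

(* Young diagrams in the k x (n-k) rectangle are identified with their frames,
   the k-subsets of {1, ..., n}; as everywhere below, 1, ..., n are numbered
   0, ..., n-1. *)
Definition diagram (k n : nat) := {A : {set 'I_n} | #|A| == k}.

HB.instance Definition _ k n := Finite.on (diagram k n).

Fact dd_main (R : comNzRingType) (a b f g h : R) :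
  f - g = (a - b) * h -> (a - b) * (f + b * h) = a * f - b * g.
Proof. by rewrite mulrDr mulrCA => <-; ring. Qed.

Fact dd_sub (R : comNzRingType) (f g f' g' : R) :
  f - g - (f' - g') = f - f' - (g - g').
Proof. by ring. Qed.

Fact dd_mul (R : comNzRingType) (f g f' g' h k d : R) :
  f - f' = d * h -> g - g' = d * k -> f * g - f' * g' = d * (h * g + f' * k).
Proof. by rewrite mulrDr mulrA mulrCA => <- <-; ring. Qed.

Fact dd_div (R : comNzRingType) (f u f' u' p k d : R) :
  u - u' = d * k -> f * u - f' * u' = d * p ->
  (f - f') * u = d * (p - f' * k).
Proof. by move=> uE pE; rewrite mulrBr -pE mulrCA -uE; ring. Qed.

Fact dd_comm (R : comNzRingType) (a b c d f f1 f2 f3 x y z u v : R) :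
  (c - d) * x = c * y - d * z ->
  (a - b) * y = a * f - b * f1 -> (a - b) * z = a * f2 - b * f3 ->
  (c - d) * u = c * f - d * f2 -> (c - d) * v = c * f1 - d * f3 ->
  (c - d) * ((a - b) * x) = (c - d) * (a * u - b * v).
Proof.
move=> xE yE zE uE vE.
rewrite mulrCA xE mulrBr mulrCA yE [_ * (d * z)]mulrCA zE.
by rewrite [RHS]mulrBr [_ * (a * u)]mulrCA uE [_ * (b * v)]mulrCA vE; ring.
Qed.

Fact widen_ord_inj m n (mn : (m <= n)%N) : injective (widen_ord mn).
Proof. by move=> i j /(congr1 val) /= /val_inj. Qed.

Section GrothVars.
Variables k n : nat.
Implicit Types (f g : laurent (k + n)) (i j : 'I_n) (A : {set 'I_n}).

Definition xvar (a : 'I_k) : laurent (k + n) := lvar (lshift n a).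
Definition yvar (j : 'I_n) : laurent (k + n) := lvar (rshift k j).

Definition xy_index (s : 'I_k -> 'I_k) (t : 'I_n -> 'I_n) (i : 'I_(k + n)) :
    'I_(k + n) :=
  match split i with
  | inl a => lshift n (s a)
  | inr j => rshift k (t j)
  end.

Definition xsubst (s : 'I_k -> 'I_k) : laurent (k + n) -> laurent (k + n) :=
  rename (xy_index s id).
Definition ysubst (t : 'I_n -> 'I_n) : laurent (k + n) -> laurent (k + n) :=
  rename (xy_index id t).

HB.instance Definition _ s := GRing.RMorphism.copy (xsubst s)
  (rename (xy_index s id)).
HB.instance Definition _ t := GRing.RMorphism.copy (ysubst t)
  (rename (xy_index id t)).

Lemma xy_index_l s t a : xy_index s t (lshift n a) = lshift n (s a).
Proof. by rewrite /xy_index -[lshift n a]/(unsplit (inl a)) unsplitK. Qed.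

Lemma xy_index_r s t j : xy_index s t (rshift k j) = rshift k (t j).
Proof. by rewrite /xy_index -[rshift k j]/(unsplit (inr j)) unsplitK. Qed.

Lemma xsubst_x s a : xsubst s (xvar a) = xvar (s a).
Proof. by rewrite /xsubst rename_lvar xy_index_l. Qed.

Lemma xsubst_y s j : xsubst s (yvar j) = yvar j.
Proof. by rewrite /xsubst rename_lvar xy_index_r. Qed.

Lemma ysubst_x t a : ysubst t (xvar a) = xvar a.
Proof. by rewrite /ysubst rename_lvar xy_index_l. Qed.

Lemma ysubst_y t j : ysubst t (yvar j) = yvar (t j).
Proof. by rewrite /ysubst rename_lvar xy_index_r. Qed.

Lemma xy_ext (phi psi : {rmorphism laurent (k + n) -> laurent (k + n)}) :
  (forall a, phi (xvar a) = psi (xvar a)) ->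
  (forall j, phi (yvar j) = psi (yvar j)) -> phi =1 psi.
Proof.
move=> ex ey; apply: laurent_rmorph_ext => i.
by rewrite -[i]splitK; case: (split i) => [a|j] /=; [exact: ex | exact: ey].
Qed.

Lemma xsubst_ysubst s t f : xsubst s (ysubst t f) = ysubst t (xsubst s f).
Proof.
apply: (xy_ext (phi := xsubst s \o ysubst t) (psi := ysubst t \o xsubst s)).
  by move=> a /=; rewrite !(ysubst_x, xsubst_x).
by move=> j /=; rewrite !(ysubst_y, xsubst_y).
Qed.

Lemma yvar_inj : injective yvar.
Proof.
move=> i j /laurent_poly_inj /(congr1 (fun p => p@_U_(rshift k i)))/=.
rewrite !mcoeffXU eqxx (inj_eq (@rshift_inj _ _)).
by case: eqP => // -> .
Qed.

Lemma yvarB_neq0 i j : i != j -> yvar i - yvar j != 0.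
Proof. by rewrite subr_eq0 (inj_eq yvar_inj). Qed.

Lemma Dop_subproof i j f :
  exists g, (yvar i - yvar j) * g ==
            yvar i * f - yvar j * ysubst (tperm i j) f.
Proof.
suff [g gE] : exists g, f - ysubst (tperm i j) f = (yvar i - yvar j) * g.
  by exists (f + yvar j * g); apply/eqP/dd_main.
elim/laurent_ind: f => [|a|f g [f1 fE] [g1 gE]|f g [f1 fE] [g1 gE]|].
- by exists 0; rewrite rmorph1 subrr mulr0.
- rewrite -[a]splitK; case: (split a) => [b|b] /=.
    by exists 0; rewrite -/(xvar b) ysubst_x subrr mulr0.
  rewrite -/(yvar b) ysubst_y; case: tpermP => [->|->|_ _].
  + by exists 1; rewrite mulr1.
  + by exists (-1); rewrite mulrN1 opprB.
  + by exists 0; rewrite subrr mulr0.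
- by exists (f1 - g1); rewrite rmorphB mulrBr -fE -gE dd_sub.
- exists (f1 * g + ysubst (tperm i j) f * g1).
  by rewrite rmorphM; apply: dd_mul.
- move=> f u uu [u1 uE] [p pE].
  exists ((p - ysubst (tperm i j) f * u1) / u).
  apply: (mulIr uu); rewrite -[RHS]mulrA divrK //.
  by rewrite rmorphM in pE; apply: dd_div pE.
Qed.

End GrothVars.

(* (y_i f - y_j f(y_i <-> y_j)) / (y_i - y_j), to be used for j = i + 1; for
   i != j it is characterized by DopE and Dop_uniq. *)
HB.lock Definition Dop (k n : nat) (i j : 'I_n) (f : laurent (k + n)) :
    laurent (k + n) := xchoose (Dop_subproof i j f).

Section Groth.
Variables k n : nat.
Implicit Types (f g : laurent (k + n)) (i j : 'I_n) (A : {set 'I_n}).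
Local Notation xvar := (@xvar k n).
Local Notation yvar := (@yvar k n).

Lemma DopE i j f :
  (yvar i - yvar j) * Dop i j f = yvar i * f - yvar j * ysubst (tperm i j) f.
Proof. by rewrite Dop.unlock; apply/eqP/(xchooseP (Dop_subproof i j f)). Qed.

Lemma Dop_uniq i j f g : i != j ->
  (yvar i - yvar j) * g = yvar i * f - yvar j * ysubst (tperm i j) f ->
  g = Dop i j f.
Proof. by move=> nij; rewrite -DopE => /(mulfI (yvarB_neq0 k nij)). Qed.

Definition top_frame : {set 'I_n} := [set i : 'I_n | (n - k <= i)%N].

Definition groth_top : laurent (k + n) :=
  \prod_(a < k) \prod_(j < n | (j < n - k)%N) (1 - xvar a / yvar j).

Inductive groth_spec : {set 'I_n} -> laurent (k + n) -> Prop :=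
| GrothTop : groth_spec top_frame groth_top
| GrothStep A f i j : j = i.+1 :> nat -> j \in A -> i \notin A ->
    groth_spec A f -> groth_spec (i |: (A :\ j)) (Dop i j f).

Lemma groth_spec_inv A f : groth_spec A f ->
  A = top_frame /\ f = groth_top \/
  exists i j f', [/\ j = i.+1 :> nat, i \in A, j \notin A,
    groth_spec (j |: (A :\ i)) f' & f = Dop i j f'].
Proof.
case=> [|B g i j ji jB iB Bg]; [by left | right].
have nij : j != i by rewrite -val_eqE /= ji -[X in _ == X]addn0 -addn1 eqn_add2l.
exists i, j, g; split=> //.
- by rewrite setU11.
- by rewrite !inE eqxx /= orbF.
- rewrite setU1K ?setD1K // !inE negb_and iB orbT //.
Qed.

Lemma card_move A i j : i \in A -> j \notin A -> #|j |: (A :\ i)| = #|A|.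
Proof.
move=> iA jA; rewrite cardsU1 [in RHS](cardsD1 i) iA !inE negb_and jA orbT.
by [].
Qed.

Lemma card_top_frame : (k <= n)%N -> #|top_frame| = k.
Proof.
move=> kn.
have card_ltn m : (m <= n)%N -> #|[set i : 'I_n | (i < m)%N]| = m.
  move=> mn; rewrite -[RHS]card_ord -(card_imset _ (@widen_ord_inj _ _ mn)).
  apply: eq_card => i; rewrite inE; apply/idP/imsetP => [im|[a _ ->]] //=.
  by exists (Ordinal im) => //; apply: val_inj.
have -> : top_frame = ~: [set i : 'I_n | (i < n - k)%N].
  by apply/setP=> i; rewrite !inE -leqNgt.
by rewrite cardsCs setCK card_ltn ?leq_subr // card_ord subKn.
Qed.

Lemma groth_spec_card A f : (k <= n)%N -> groth_spec A f -> #|A| = k.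
Proof.
move=> kn; elim=> [|B g i j _ jB iB _ IH]; first exact: card_top_frame.
by rewrite card_move.
Qed.

Lemma raisable A : (k <= n)%N -> #|A| = k -> A != top_frame ->
  exists i j, [/\ j = i.+1 :> nat, i \in A & j \notin A].
Proof.
move=> kn cA nA.
have [i iA iT] : exists2 i, i \in A & i \notin top_frame.
  apply/subsetPn; apply: contraNN nA => sub.
  by rewrite eqEcard sub cA card_top_frame //= leqnn.
have [j jT jA] : exists2 j, j \in top_frame & j \notin A.
  apply/subsetPn; apply: contraNN nA => sub.
  by rewrite eq_sym eqEcard sub cA card_top_frame //= leqnn.
move: iT jT; rewrite !inE -ltnNge => iT jT.
have ij : (i < j)%N := leq_trans iT jT.
have /subnKC ld := ij; move: {jT nA cA ij} (j - i.+1)%N ld jA => d.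
elim: d i iA {iT} j => [|d IH] i iA j ji jA.
  by exists i, j; split; rewrite // -ji addn0.
have i1 : (i.+1 < n)%N.
  by apply: leq_ltn_trans (ltn_ord j); rewrite -ji leq_addr.
case: (boolP (Ordinal i1 \in A)) => h; last by exists i, (Ordinal i1).
by apply: (IH _ h j) => //; rewrite -ji /= addSnnS.
Qed.

Let height A := (\sum_(i in A) (n - i))%N.

Lemma height_raise A i j : j = i.+1 :> nat -> i \in A -> j \notin A ->
  (height (j |: (A :\ i)) < height A)%N.
Proof.
move=> ji iA jA; rewrite /height (big_setD1 i iA) /= big_setU1 ?ltn_add2r.
  by rewrite ji ltn_sub2l.
by rewrite !inE negb_and jA orbT.
Qed.

Lemma groth_spec_ex A : (k <= n)%N -> #|A| = k -> exists f, groth_spec A f.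
Proof.
move=> kn; have [N] := ubnP (height A); elim: N A => // N IH A hA cA.
have [->|nA] := eqVneq A top_frame; first by exists groth_top; constructor.
have [i [j [ji iA jA]]] := raisable kn cA nA.
have [||f Bf] := IH (j |: (A :\ i)).
- exact: leq_trans (height_raise ji iA jA) hA.
- by rewrite card_move.
exists (Dop i j f).
have -> : A = i |: ((j |: (A :\ i)) :\ j).
  by rewrite setU1K ?setD1K // !inE negb_and jA orbT.
apply: GrothStep => //; first by rewrite setU11.
rewrite !inE eqxx /= orbF -val_eqE /= ji.
by rewrite neq_ltn ltnSn.
Qed.

Lemma ysubst_Dop t i j f : injective t -> i != j ->
  ysubst t (Dop i j f) = Dop (t i) (t j) (ysubst t f).
Proof.
move=> tI nij; apply: Dop_uniq; first by rewrite (inj_eq tI).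
have := congr1 (ysubst t) (DopE i j f).
rewrite !(rmorphM, rmorphB) /= !ysubst_y => ->.
congr (_ - _ * _).
apply: (xy_ext (phi := ysubst t \o ysubst (tperm i j))
               (psi := ysubst (tperm (t i) (t j)) \o ysubst t)) => [a|l] /=.
  by rewrite !ysubst_x.
rewrite !ysubst_y; case: (tpermP i j l) => [->|->|li lj].
- by rewrite tpermL.
- by rewrite tpermR.
- by rewrite tpermD // (inj_eq tI) eq_sym; apply/eqP.
Qed.

Lemma xsubst_Dop s i j f : i != j ->
  xsubst s (Dop i j f) = Dop i j (xsubst s f).
Proof.
move=> nij; apply: Dop_uniq => //.
have := congr1 (xsubst s) (DopE i j f).
by rewrite !(rmorphM, rmorphB) /= !xsubst_y xsubst_ysubst.
Qed.

Lemma DopC i j i' j' f :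
  i != j -> i' != j' -> [disjoint [:: i; j] & [:: i'; j']] ->
  Dop i j (Dop i' j' f) = Dop i' j' (Dop i j f).
Proof.
move=> nij nij' dis.
have [ii' ij' ji' jj'] : [/\ i != i', i != j', j != i' & j != j'].
  move: dis; rewrite disjoint_has /= !inE orbF !negb_or.
  by case/andP=> /andP [? ?] /andP [? ?].
have t1 : ysubst (tperm i' j') (Dop i j f) =
    Dop i j (ysubst (tperm i' j') f).
  rewrite ysubst_Dop //; last exact: perm_inj.
  by rewrite !tpermD // eq_sym.
have t2 : ysubst (tperm i j) (Dop i' j' f) =
    Dop i' j' (ysubst (tperm i j) f).
  by rewrite ysubst_Dop //; [rewrite !tpermD // eq_sym | exact: perm_inj].
have t3 : ysubst (tperm i' j') (ysubst (tperm i j) f) =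
          ysubst (tperm i j) (ysubst (tperm i' j') f).
  apply: (xy_ext (phi := ysubst (tperm i' j') \o ysubst (tperm i j))
              (psi := ysubst (tperm i j) \o ysubst (tperm i' j'))) => [a|l] /=.
    by rewrite !ysubst_x.
  rewrite !ysubst_y; congr yvar; rewrite -!permM; congr (fun_of_perm _ l).
  rewrite [LHS]conjgC tpermJ !tpermD // eq_sym //.
symmetry; apply: Dop_uniq => //; apply: (mulfI (yvarB_neq0 k nij')).
apply: (@dd_comm _ _ _ _ _ f (ysubst (tperm i j) f)
  (ysubst (tperm i' j') f) (ysubst (tperm i j) (ysubst (tperm i' j') f))
  _ (Dop i j f) (Dop i j (ysubst (tperm i' j') f)));
  by rewrite ?t2 DopE ?t1 ?t3.
Qed.

Lemma groth_spec_uniq A f g : (k <= n)%N ->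
  groth_spec A f -> groth_spec A g -> f = g.
Proof.
move=> kn; have [N] := ubnP (height A); elim: N A f g => // N IH A f g hA Af Ag.
have cA := groth_spec_card kn Af.
have step_top i j : j = i.+1 :> nat -> i \in A -> j \notin A ->
    A != top_frame.
  move=> ji iA jA; apply: contraNneq jA => Atop; move: iA.
  by rewrite Atop !inE ji => /leqW.
have [[Atop fE]|[i [j [f' [ji iA jA Af' fE]]]]] := groth_spec_inv Af.
  have [[_ gE]|[i [j [g' [ji iA jA _ _]]]]] := groth_spec_inv Ag.
    by rewrite fE gE.
  by have := step_top i j ji iA jA; rewrite Atop eqxx.
have [[Atop _]|[i' [j' [g' [ji' iA' jA' Ag' gE]]]]] := groth_spec_inv Ag.
  by have := step_top i j ji iA jA; rewrite Atop eqxx.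
have lt_height i0 j0 : j0 = i0.+1 :> nat -> i0 \in A -> j0 \notin A ->
    (height (j0 |: (A :\ i0)) < N)%N.
  by move=> *; apply: leq_trans (height_raise _ _ _) hA.
rewrite fE gE; have [ii'|ii'] := eqVneq i i'.
  have jj' : j = j' by apply: val_inj; rewrite /= ji ji' ii'.
  by subst i' j'; congr Dop; apply: IH Af' Ag'; apply: lt_height.
have jj' : j != j'.
  by apply: contraNneq ii' => jj'; apply/eqP/val_inj/succn_inj; rewrite -ji -ji' jj'.
have ij' : i != j' by apply: contraNneq jA' => <-.
have ji'n : j != i' by apply: contraNneq jA => ->.
have nij : i != j by apply: contraNneq jA => <-.
have nij' : i' != j' by apply: contraNneq jA' => <-.
pose B := j' |: ((j |: (A :\ i)) :\ i').
have BE : B = j |: ((j' |: (A :\ i')) :\ i).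
  apply/setP=> l; rewrite !inE.
  have [->|lj] /= := eqVneq l j; first by rewrite ji'n orbT.
  have [->|lj'] /= := eqVneq l j'; first by rewrite eq_sym ij'.
  by rewrite andbCA.
have [h Bh] : exists h, groth_spec B h.
  apply: groth_spec_ex => //; rewrite !card_move //.
  - by rewrite !inE [i' == j]eq_sym (negPf ji'n) eq_sym ii'.
  - by rewrite !inE eq_sym (negPf jj') (negPf jA') andbF.
have raise (C : {set 'I_n}) (l m : 'I_n) : m = l.+1 :> nat -> l \in C -> m \notin C ->
    groth_spec (m |: (C :\ l)) h -> groth_spec C (Dop l m h).
  move=> ml lC mC Ch.
  have -> : C = l |: ((m |: (C :\ l)) :\ m).
    by rewrite setU1K ?setD1K // !inE negb_and mC orbT.
  apply: GrothStep => //; first by rewrite setU11.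
  by rewrite !inE eqxx /= orbF -val_eqE /= ml neq_ltn ltnSn.
have -> : f' = Dop i' j' h.
  apply: IH Af' _; first exact: lt_height.
  apply: raise => //.
  - by rewrite !inE [i' == j]eq_sym (negPf ji'n) eq_sym ii'.
  - by rewrite !inE eq_sym (negPf jj') (negPf jA') andbF.
have -> : g' = Dop i j h.
  apply: IH Ag' _; first exact: lt_height.
  apply: raise => //; last by rewrite -BE.
  - by rewrite !inE (negPf ij') ii'.
  - by rewrite !inE (negPf jj') (negPf jA) andbF.
apply: DopC => //; rewrite disjoint_has /= !inE !negb_or.
by rewrite ii' ij' ji'n jj'.
Qed.

End Groth.

(* G^A, for #|A| = k <= n: grothP and groth_spec_uniq show that groth_spec is
   then a total functional relation; the junk value is 0. *)
HB.lock Definition groth (k n : nat) (A : {set 'I_n}) : laurent (k + n) :=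
  if pselect (exists f : laurent (k + n), groth_spec A f) is left e
  then projT1 (cid e) else 0.

Section GrothTheory.
Variables k n : nat.
Hypothesis kn : (k <= n)%N.
Implicit Types (A : {set 'I_n}) (i j : 'I_n).
Local Notation groth := (@groth k n).
Local Notation xvar := (@xvar k n).
Local Notation yvar := (@yvar k n).

Lemma grothP A : #|A| = k -> groth_spec A (groth A).
Proof.
move=> cA; rewrite groth.unlock; case: pselect => [e|]; first by case: (cid e).
by case; apply: groth_spec_ex.
Qed.

Lemma groth_topE : groth (top_frame k n) = groth_top k n.
Proof.
apply: groth_spec_uniq kn (grothP _) _; first exact: card_top_frame.
exact: GrothTop.
Qed.

Lemma groth_step A i j : #|A| = k -> j = i.+1 :> nat ->
  j \in A -> i \notin A -> groth (i |: (A :\ j)) = Dop i j (groth A).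
Proof.
move=> cA ji jA iA; apply: groth_spec_uniq kn (grothP _) _.
  by rewrite card_move.
by apply: GrothStep => //; apply: grothP.
Qed.

Lemma groth_spec_sym (s : 'S_k) A f : groth_spec A f -> xsubst s f = f.
Proof.
elim=> [|B g i j ji _ _ _ IH].
  rewrite /groth_top rmorph_prod [RHS](reindex_inj (@perm_inj _ s)) /=.
  apply: eq_bigr => a _; rewrite rmorph_prod; apply: eq_bigr => j _ /=.
  rewrite rmorphB rmorph1 rmorph_div ?lvar_unit //=.
  by rewrite xsubst_x xsubst_y.
rewrite xsubst_Dop ?IH // -val_eqE /= ji neq_ltn ltnSn //.
Qed.

End GrothTheory.

(* G_A *)
Definition dual_groth k n (A : {set 'I_n}) : laurent (k + n) :=
  \prod_(a < k) xvar n a * \prod_(i in A) (yvar k i)^-1 *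
  ysubst (@rev_ord n) (groth k [set rev_ord i | i in A]).

Definition xsymmetric (k n : nat) : {pred laurent (k + n)} :=
  fun f => [forall s : 'S_k, xsubst s f == f].
Arguments xsymmetric : clear implicits.

Lemma xsymmetricP k n (f : laurent (k + n)) :
  reflect (forall s : 'S_k, xsubst s f = f) (f \in xsymmetric k n).
Proof. by apply: (iffP forallP) => h s; apply/eqP. Qed.

Lemma xsymmetric_closed k n : subring_closed (xsymmetric k n).
Proof.
split; first by apply/xsymmetricP=> s; rewrite rmorph1.
- move=> f g /xsymmetricP fs /xsymmetricP gs; apply/xsymmetricP=> s.
  by rewrite rmorphB /= fs gs.
- move=> f g /xsymmetricP fs /xsymmetricP gs; apply/xsymmetricP=> s.
  by rewrite rmorphM /= fs gs.
Qed.

HB.instance Definition _ k n :=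
  GRing.isSubringClosed.Build (laurent (k + n)) (xsymmetric k n)
    (@xsymmetric_closed k n).

Record symlaurent (k n : nat) :=
  SymLaurent { symlaurent_val :> laurent (k + n);
               _ : symlaurent_val \in xsymmetric k n }.
Arguments SymLaurent {k n}.

HB.instance Definition _ k n := [isSub for @symlaurent_val k n].
HB.instance Definition _ k n := [Choice of symlaurent k n by <:].
HB.instance Definition _ k n :=
  [SubChoice_isSubComNzRing of symlaurent k n by <:].

(* The specialization x_a := y_(t a), with values in Z[y^{+-1}]. *)
Definition specialize (k n : nat) (t : 'I_k -> 'I_n) :
    laurent (k + n) -> laurent n :=
  rename (fun i => match split i with inl a => t a | inr j => j end).

HB.instance Definition _ k n t := GRing.RMorphism.copy (@specialize k n t)
  (rename (fun i => match split i with inl a => t a | inr j => j end)).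

Definition strictly_increasing (k n : nat) (t : {ffun 'I_k -> 'I_n}) : bool :=
  [forall a : 'I_k, forall b : 'I_k, (a < b)%N ==> (t a < t b)%N].

(* The hypothesis k <= n only serves to make this ideal proper. *)
Definition vanishing (k n : nat) (kn : (k <= n)%N) : {pred symlaurent k n} :=
  fun f => [forall t : {ffun 'I_k -> 'I_n},
              strictly_increasing t ==> (specialize t (val f) == 0)].

Lemma vanishingP k n (kn : (k <= n)%N) (f : symlaurent k n) :
  reflect (forall t : {ffun 'I_k -> 'I_n}, strictly_increasing t ->
             specialize t (val f) = 0)
          (f \in vanishing kn).
Proof.
apply: (iffP forallP) => h t; last by apply/implyP=> /h ->.
by move/implyP: (h t) => ht /ht /eqP.
Qed.

Lemma vanishing_idealr k n (kn : (k <= n)%N) : idealr_closed (vanishing kn).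
Proof.
split.
- by apply/vanishingP=> t _; rewrite !rmorph0.
- apply/vanishingP=> h; have := h [ffun a => widen_ord kn a].
  rewrite !rmorph1 => h1; suff /h1 /eqP : strictly_increasing
      [ffun a : 'I_k => widen_ord kn a] by rewrite oner_eq0.
  by apply/forallP=> a; apply/forallP=> b; rewrite !ffunE; apply/implyP.
- move=> c f g /vanishingP fv /vanishingP gv; apply/vanishingP=> t ti.
  by rewrite !(rmorphD, rmorphM) /= fv // gv // mulr0 addr0.
Qed.

HB.instance Definition _ k n (kn : (k <= n)%N) :=
  isIdealr.Build (symlaurent k n) (vanishing kn) (vanishing_idealr kn).

Definition KT (k n : nat) (kn : (k <= n)%N) := {ideal_quot (vanishing kn)}.

HB.instance Definition _ k n kn := GRing.ComNzRing.on (@KT k n kn).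

Lemma yconst_subproof k n (c : laurent n) :
  rename (@rshift k n) c \in xsymmetric k n.
Proof.
apply/xsymmetricP=> s; rewrite /xsubst rename_comp.
by apply: eq_rename => j /=; rewrite xy_index_r.
Qed.

Definition yconst k n (c : laurent n) : symlaurent k n :=
  SymLaurent _ (yconst_subproof k c).

Lemma dual_groth_subproof k n (kn : (k <= n)%N) (A : diagram k n) :
  dual_groth k (val A) \in xsymmetric k n.
Proof.
apply/xsymmetricP=> s; rewrite /dual_groth !rmorphM !rmorph_prod /=.
congr (_ * _ * _).
- rewrite [RHS](reindex_inj (@perm_inj _ s)) /=.
  by apply: eq_bigr => a _; rewrite xsubst_x.
- apply: eq_bigr => i _.
  by rewrite rmorphV ?lvar_unit //= xsubst_y.
- rewrite xsubst_ysubst; congr (ysubst _ _).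
  apply: groth_spec_sym (grothP kn _).
  by rewrite card_imset; [apply/eqP/(valP A) | exact: rev_ord_inj].
Qed.

Definition dual_groth_sym k n (kn : (k <= n)%N) (A : diagram k n) :
    symlaurent k n := SymLaurent _ (dual_groth_subproof kn A).

Definition KT_groth k n (kn : (k <= n)%N) (A : diagram k n) : KT kn :=
  \pi_(KT kn)%qT (dual_groth_sym kn A).

Definition KT_const k n (kn : (k <= n)%N) (c : laurent n) : KT kn :=
  \pi_(KT kn)%qT (yconst k c).

(* States of edges: the subsets of {R, G}, as (red?, green?). *)
Definition state : Type := bool * bool.
Definition st0 : state := (false, false).
Definition stR : state := (true, false).
Definition stG : state := (false, true).
Definition stRG : state := (true, true).

Inductive tile := TE | TG1 | TG2 | TR1 | TR2 | TQ | TK.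

Definition tile_code (u : tile) : 'I_7 :=
  match u with
  | TE => inord 0 | TG1 => inord 1 | TG2 => inord 2 | TR1 => inord 3
  | TR2 => inord 4 | TQ => inord 5 | TK => inord 6
  end.

Definition tile_decode (i : 'I_7) : tile :=
  nth TE [:: TE; TG1; TG2; TR1; TR2; TQ; TK] i.

Lemma tile_codeK : cancel tile_code tile_decode.
Proof. by case; rewrite /tile_decode inordK. Qed.

HB.instance Definition _ := Equality.copy tile (can_type tile_codeK).
HB.instance Definition _ := Choice.copy tile (can_type tile_codeK).
HB.instance Definition _ := Countable.copy tile (can_type tile_codeK).
HB.instance Definition _ := Finite.copy tile (can_type tile_codeK).

Definition edges (u : tile) : state * state * state :=
  match u with
  | TE  => (st0, st0, st0)
  | TG1 => (stG, stG, st0)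
  | TG2 => (stG, stRG, stR)
  | TR1 => (stR, st0, stR)
  | TR2 => (stR, stG, stRG)
  | TQ  => (stRG, stG, stR)
  | TK  => (st0, stRG, stRG)
  end.

Definition edge_h (u : tile) : state := (edges u).1.1.
Definition edge_a (u : tile) : state := (edges u).1.2.
Definition edge_b (u : tile) : state := (edges u).2.

(* The unit triangles of the down-pointing triangle of side n. Rows are
   numbered 0, ..., n-1 from the top. Row r consists of the down-pointing
   triangles (r, 0), ..., (r, n-1-r), from left to right, and of the up-pointing
   triangles (r, 0), ..., (r, n-2-r), the up-pointing (r, c) lying between the
   down-pointing (r, c) and (r, c+1). *)
Definition down_tri (n : nat) := {p : 'I_n * 'I_n | (p.1 + p.2 < n)%N}.
Definition up_tri (n : nat) := {p : 'I_n * 'I_n | ((p.1 + p.2).+1 < n)%N}.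

HB.instance Definition _ n := Finite.on (down_tri n).
HB.instance Definition _ n := Finite.on (up_tri n).

Section Puzzles.
Variable n : nat.
Implicit Types (u : up_tri n) (d : down_tri n) (lam mu nu : {set 'I_n}).

Definition row_d d : 'I_n := (val d).1.
Definition col_d d : 'I_n := (val d).2.
Definition row_u u : 'I_n := (val u).1.
Definition col_u u : 'I_n := (val u).2.

(* d shares with u its left edge, its right edge, its bottom edge. *)
Definition left_of d u : bool := (row_d d == row_u u) && (col_d d == col_u u).
Definition right_of d u : bool :=
  (row_d d == row_u u) && (col_d d == (col_u u).+1 :> nat).
Definition below d u : bool :=
  (row_d d == (row_u u).+1 :> nat) && (col_d d == col_u u).

Definition tiling : Type := {ffun up_tri n -> tile} * {ffun down_tri n -> tile}.

Definition is_puzzle (P : tiling) : bool :=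
  [&& [forall d, P.2 d != TK],
      [forall u, forall d, left_of d u ==> (edge_a (P.1 u) == edge_a (P.2 d))],
      [forall u, forall d, right_of d u ==> (edge_b (P.1 u) == edge_b (P.2 d))]
    & [forall u, forall d, below d u ==> (edge_h (P.1 u) == edge_h (P.2 d))]].

(* The left edge of the down-pointing (r, 0) is in position r of the left side
   read downwards; the right edge of the down-pointing (n-1-c, c) is in position
   c of the right side read upwards. *)
Definition has_boundary lam mu nu (P : tiling) : bool :=
  [&& [forall d, (col_d d == 0%N :> nat) ==>
         (edge_b (P.2 d) == if row_d d \in lam then st0 else stR)],
      [forall d, ((row_d d + col_d d).+1 == n) ==>
         (edge_a (P.2 d) == if col_d d \in mu then stG else st0)]
    & [forall d, (row_d d == 0%N :> nat) ==>
         (edge_h (P.2 d) == if col_d d \in nu then stG else stR)]].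

Definition lozenge_weight (R : pzRingType) (w : R) (upper lower : tile) : R :=
  match upper, lower with
  | TG2, TG1 => w
  | TR2, TR1 => w
  | TQ, TQ => 1 - w
  | TK, TE => - w
  | _, _ => 1
  end.

(* The centre of the lozenge with upper triangle u = (r, c) is the midpoint of
   the bottom edge of u; the lines of direction 120 and 60 degrees through it
   reach the top side at the midpoints of the edges c and r + c + 1. *)
Definition nw_edge u : 'I_n := col_u u.
Definition ne_edge u : 'I_n := Ordinal (valP u).

Definition puzzle_weight (P : tiling) : laurent n :=
  \prod_(u : up_tri n) \prod_(d : down_tri n | below d u)
    lozenge_weight (lvar (nw_edge u) / lvar (ne_edge u)) (P.1 u) (P.2 d).

Definition puzzle_sum lam mu nu : laurent n :=
  \sum_(P : tiling | is_puzzle P && has_boundary lam mu nu P) puzzle_weight P.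

End Puzzles.

(* Main.v *)
(* A puzzle is a configuration of a vertex model: the line of y_l goes straight
   from position l of the left side to position l of the top side, and from there
   straight to position l of the right side; the lines of y_i and y_j, i < j,
   cross in an elementary lozenge of parameter y_i / y_j. Adding a crossing of
   the neighbouring lines i, i + 1 on the left and on the right side amounts, by
   the Yang-Baxter equation, to adding one on the top side and exchanging y_i and
   y_(i+1). On edges in the two boundary states, the three crossings act by one
   and the same matrix, by which the transposition of y_i and y_(i+1) also acts on
   the dual Grothendieck polynomials. Hence if the product rule with puzzle
   coefficients holds at the fixed point t, it holds at every s_i t.

   At the fixed point of the full rectangle only G_top survives, with the value 1,
   and the puzzles whose top side is the full rectangle are unique, so the rule
   reduces to 1 = 1. Restriction to fixed points being triangular with nonzero
   diagonal, the coefficients are unique. *)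

Require Import Defs.
From HB Require Import structures.
From mathcomp Require Import all_boot all_order all_fingroup all_algebra.
From mathcomp Require Import ring_quotient generic_quotient fraction.
From mathcomp Require Import boolp mpoly ring zify.

Set Implicit Arguments.
Unset Strict Implicit.
Unset Printing Implicit Defensive.

Import GRing.Theory.
Local Open Scope ring_scope.

(** The exchange of lines does not give the rule at s_i t directly. It shows that the matrix of the
    transposition, applied in both indices lambda and mu, kills the defects of the rule at s_i t.
    This matrix is triangular with diagonal entries 1 and y_(i+1)/y_i, so the defects vanish. Since
    s_i t need not be increasing when t is, the rule is carried along all injective t, although K_T
    only sees the increasing ones.

    Inside a puzzle a line takes all four states, although only two occur on each side. So the
    crossings on the left and on the right are four-state matrices, able to pass through vertices,
    and the common two-state matrix is their restriction to the boundary.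

    On the polynomial side, the recursive definition tells how a transposition acts when exactly one
    of i, i + 1 is in the frame. In the other cases G is symmetric in y_i, y_(i+1), but this has to
    be drawn from a different lowering step by a braid argument. *)

Definition sts : seq state := [:: st0; stR; stG; stRG].
Definition tiles : seq tile := [:: TE; TG1; TG2; TR1; TR2; TQ; TK].

(** The last condition, here and in [ends], keeps the [K]-tile out of down-pointing triangles. *)
Definition fits (u d : tile) (b a' : state) : bool :=
  [&& edge_h u == edge_h d, edge_b d == b, edge_a d == a' &
      if d is TK then false else true].

Definition ends (d : tile) (h b a : state) : bool :=
  [&& edge_h d == h, edge_b d == b, edge_a d == a &
      if d is TK then false else true].

(** * The vertex model *)

Section Weights.
Variable R : comPzRingType.
Implicit Types (w q : R) (a b c h : state).

(* The lozenge with upper left edge a, lower left edge b, lower right edge a' and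
   upper right edge b', summed over its two tiles. *)
Definition vertex w a b a' b' : R :=
  \sum_(u <- tiles) if (edge_a u == a) && (edge_b u == b') then
    \sum_(d <- tiles) (if fits u d b a' then lozenge_weight w u d else 0)
  else 0.

(** A down-pointing triangle on the top side, where a line turns: it arrives through the [b]-edge
    and leaves through the [a]-edge. The triangle lies in no lozenge, whence the weight 1. *)
Definition cap h b a : R :=
  \sum_(d <- tiles) (if ends d h b a then 1 else 0).

(* Crossing of two neighbouring lines: sw lists the pairs of states that can be
   exchanged, with weight 1 - q, and qs the pairs of diagonal weight q. Rb and
   Ra were found by solving the Yang-Baxter equations ybe_b and ybe_a for them. *)
Definition Rmx (sw qs : seq (state * state)) q (b1 b2 c1 c2 : state) : R :=
  if (b1 == c1) && (b2 == c2) then (if (b1, b2) \in qs then q else 1)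
  else if [&& b1 == c2, b2 == c1 & (b1, b2) \in sw] then 1 - q else 0.

Definition Rb := Rmx [:: (st0, stR); (st0, stRG); (stRG, stR)]
                     [:: (stR, st0); (stRG, st0); (stRG, stR)].
Definition Ra := Rmx [:: (stG, st0); (stG, stRG); (stRG, st0)]
                     [:: (st0, stG); (stG, stRG); (st0, stRG)].
Definition Rh := Rmx [:: (stG, stR)] [:: (stR, stG)].

End Weights.

(* The local relations are checked by computation on polynomials in two variables
   with integer coefficients, given by the lists of the exponents of their
   positive and of their negative monomials. *)
Definition bipoly : Type := seq (nat * nat) * seq (nat * nat).

Definition mul_mon (x y : nat * nat) := ((x.1 + y.1)%N, (x.2 + y.2)%N).
Definition bp0 : bipoly := ([::], [::]).
Definition bpX i j : bipoly := ([:: (i, j)], [::]).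
Definition bp_opp (p : bipoly) : bipoly := (p.2, p.1).
Definition bp_add (p r : bipoly) : bipoly := (p.1 ++ r.1, p.2 ++ r.2).
Definition bp_mul (p r : bipoly) : bipoly :=
  ([seq mul_mon x y | x <- p.1, y <- r.1] ++
     [seq mul_mon x y | x <- p.2, y <- r.2],
   [seq mul_mon x y | x <- p.1, y <- r.2] ++
     [seq mul_mon x y | x <- p.2, y <- r.1]).
(* Reduction modulo the product of the two variables being 1. *)
Definition bp_red (p : bipoly) : bipoly :=
  let red x := (x.1 - minn x.1 x.2, x.2 - minn x.1 x.2)%N in
  (map red p.1, map red p.2).

(* Skips the evaluation of the second factor when the first one is 0. *)
Definition bp_scale (p : bipoly) (F : unit -> bipoly) : bipoly :=
  if p is ([::], [::]) then bp0 else bp_mul p (F tt).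

Definition bp_eq (p r : bipoly) := perm_eq (p.1 ++ r.2) (r.1 ++ p.2).
Definition bp_sum (T : Type) (r : seq T) (F : T -> bipoly) : bipoly :=
  foldr (fun x => bp_add (F x)) bp0 r.

Definition bp_weight (w : bipoly) (u d : tile) : bipoly :=
  match u, d with
  | TG2, TG1 => w
  | TR2, TR1 => w
  | TQ, TQ => bp_add (bpX 0 0) (bp_opp w)
  | TK, TE => bp_opp w
  | _, _ => bpX 0 0
  end.

Definition bp_vertex w a b a' b' : bipoly :=
  bp_sum tiles (fun u => if (edge_a u == a) && (edge_b u == b') then
    bp_sum tiles (fun d => if fits u d b a' then bp_weight w u d else bp0)
  else bp0).

Definition bp_cap h b a : bipoly :=
  bp_sum tiles (fun d => if ends d h b a then bpX 0 0 else bp0).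

Definition bp_Rmx (sw qs : seq (state * state)) b1 b2 c1 c2 : bipoly :=
  if (b1 == c1) && (b2 == c2) then
    (if (b1, b2) \in qs then bpX 1 0 else bpX 0 0)
  else if [&& b1 == c2, b2 == c1 & (b1, b2) \in sw] then
    bp_add (bpX 0 0) (bp_opp (bpX 1 0)) else bp0.

Section Eval.
Variable R : comPzRingType.
Variables q w : R.

Definition bp_eval (p : bipoly) : R :=
  \sum_(x <- p.1) q ^+ x.1 * w ^+ x.2 - \sum_(x <- p.2) q ^+ x.1 * w ^+ x.2.

Lemma bp_eval0 : bp_eval bp0 = 0.
Proof. by rewrite /bp_eval !big_nil subrr. Qed.

Lemma bp_evalX i j : bp_eval (bpX i j) = q ^+ i * w ^+ j.
Proof. by rewrite /bp_eval big_seq1 big_nil subr0. Qed.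

Lemma bp_evalN p : bp_eval (bp_opp p) = - bp_eval p.
Proof. by rewrite /bp_eval opprB. Qed.

Lemma bp_evalD p r : bp_eval (bp_add p r) = bp_eval p + bp_eval r.
Proof. by rewrite /bp_eval !big_cat /=; ring. Qed.

Lemma bp_evalM p r : bp_eval (bp_mul p r) = bp_eval p * bp_eval r.
Proof.
have mulE (s t : seq (nat * nat)) :
    \sum_(x <- [seq mul_mon x y | x <- s, y <- t]) q ^+ x.1 * w ^+ x.2 =
    (\sum_(x <- s) q ^+ x.1 * w ^+ x.2) * (\sum_(x <- t) q ^+ x.1 * w ^+ x.2).
  rewrite big_allpairs_dep big_distrl; apply: eq_bigr => x _.
  rewrite big_distrr; apply: eq_bigr => y _ /=.
  by rewrite !exprD; ring.
by rewrite /bp_eval !big_cat /= !mulE; ring.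
Qed.

Lemma bp_eval_scale p F : bp_eval (bp_scale p F) = bp_eval p * bp_eval (F tt).
Proof.
case: p => [[|x s] [|y t]]; rewrite ?bp_evalM //.
by rewrite -/bp0 bp_eval0 mul0r.
Qed.

Lemma bp_eval_sum (T : Type) (r : seq T) F :
  bp_eval (bp_sum r F) = \sum_(x <- r) bp_eval (F x).
Proof.
elim: r => [|x r IH]; first by rewrite big_nil bp_eval0.
by rewrite big_cons -IH -bp_evalD.
Qed.

Lemma bp_eqP p r : bp_eq p r -> bp_eval p = bp_eval r.
Proof.
move=> e; apply/eqP; rewrite /bp_eval subr_eq addrAC eq_sym subr_eq eq_sym.
by rewrite -!big_cat (perm_big _ e).
Qed.

Lemma bp_eval_vertex v a b a' b' :
  bp_eval (bp_vertex v a b a' b') = vertex (bp_eval v) a b a' b'.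
Proof.
rewrite bp_eval_sum; apply: eq_bigr => u _.
case: ifP => _; last exact: bp_eval0.
rewrite bp_eval_sum.
apply: eq_bigr => d _; case: ifP => _; last exact: bp_eval0.
by case: u; case: d; rewrite //= ?bp_evalD ?bp_evalN ?bp_evalX ?mulr1.
Qed.

Lemma bp_eval_cap h b a : bp_eval (bp_cap h b a) = cap R h b a.
Proof.
rewrite bp_eval_sum; apply: eq_bigr => d _; case: ifP => _.
  by rewrite bp_evalX mulr1.
exact: bp_eval0.
Qed.

Lemma bp_eval_Rmx sw qs b1 b2 c1 c2 :
  bp_eval (bp_Rmx sw qs b1 b2 c1 c2) = Rmx sw qs q b1 b2 c1 c2.
Proof.
rewrite /bp_Rmx /Rmx; case: ifP => _; first by case: ifP => _;
  rewrite bp_evalX ?mulr1.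
by case: ifP => _; rewrite ?bp_eval0 // bp_evalD bp_evalN !bp_evalX !mulr1.
Qed.

End Eval.

(** * Yang-Baxter equations and the relation at the top side *)

Definition all6 (hs : seq state)
    (P : state -> state -> state -> state -> state -> state -> bool) : bool :=
  all (fun a => all (fun b => all (fun c => all (fun d => all (fun h1 =>
    all (P a b c d h1) hs) hs) sts) sts) sts) sts.

Lemma mem_sts (a : state) : a \in sts.
Proof. by case: a => [[] []]. Qed.

Lemma all6P hs P : all6 hs P ->
  forall a b c d h1 h2, h1 \in hs -> h2 \in hs -> P a b c d h1 h2.
Proof.
move=> H a b c d h1 h2 h1in h2in.
have /allP/(_ b (mem_sts b)) := allP H a (mem_sts a).
move=> /allP/(_ c (mem_sts c)) /allP/(_ d (mem_sts d)).
by move=> /allP/(_ h1 h1in) /allP/(_ h2 h2in).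
Qed.

Lemma eq_sum3 (V : nmodType) (T : Type) (r : seq T) (F G : T -> T -> T -> V) :
  (forall x y z, F x y z = G x y z) ->
  \sum_(x <- r) \sum_(y <- r) \sum_(z <- r) F x y z =
  \sum_(x <- r) \sum_(y <- r) \sum_(z <- r) G x y z.
Proof. by move=> e; do 3 (apply: eq_bigr => ? _). Qed.

Definition bp_sum3 (F : state -> state -> state -> bipoly) : bipoly :=
  bp_sum sts (fun x => bp_sum sts (fun y => bp_sum sts (F x y))).

Section LocalRelations.
Variable R : comPzRingType.
Implicit Types (w q : R).

Lemma bp_eval_sum3 q w F : bp_eval q w (bp_sum3 F) =
  \sum_(x <- sts) \sum_(y <- sts) \sum_(z <- sts) bp_eval q w (F x y z).
Proof.
rewrite bp_eval_sum; apply: eq_bigr => x _; rewrite bp_eval_sum.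
by apply: eq_bigr => y _; rewrite bp_eval_sum.
Qed.

Let sb := [:: (st0, stR); (st0, stRG); (stRG, stR)].
Let qb := [:: (stR, st0); (stRG, st0); (stRG, stR)].
Let sa := [:: (stG, st0); (stG, stRG); (stRG, st0)].
Let qa := [:: (st0, stG); (stG, stRG); (st0, stRG)].

Let bpE := (bp_eval_sum3, bp_eval_scale, bp_eval_Rmx, bp_eval_vertex,
  bp_eval_cap, bp_evalX).

(** Two lines going up, of parameters y1 and y2, meet a third one x going down, with [q] = y2/y1 and
    [w] = x/y2, so that [q * w] = x/y1. For each of the 4^6 boundary conditions the two sides agree
    as polynomials in [q] and [w], hence in every commutative ring. *)
Lemma ybe_b q w f b1 b2 c1 c2 a' :
  \sum_(d1 <- sts) \sum_(d2 <- sts) \sum_(e <- sts)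
     Rb q b1 b2 d1 d2 * (vertex (q * w) f d1 e c1 * vertex w e d2 a' c2) =
  \sum_(d1 <- sts) \sum_(d2 <- sts) \sum_(e <- sts)
     Rb q d1 d2 c1 c2 * (vertex w f b1 e d1 * vertex (q * w) e b2 a' d2).
Proof.
pose X f b1 b2 c1 c2 a' := bp_sum3 (fun d1 d2 e =>
  bp_scale (bp_Rmx sb qb b1 b2 d1 d2) (fun _ =>
    bp_scale (bp_vertex (bpX 1 1) f d1 e c1) (fun _ =>
      bp_vertex (bpX 0 1) e d2 a' c2))).
pose Y f b1 b2 c1 c2 a' := bp_sum3 (fun d1 d2 e =>
  bp_scale (bp_Rmx sb qb d1 d2 c1 c2) (fun _ =>
    bp_scale (bp_vertex (bpX 0 1) f b1 e d1) (fun _ =>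
      bp_vertex (bpX 1 1) e b2 a' d2))).
have e : all6 sts (fun f b1 b2 c1 c2 a' =>
    bp_eq (X f b1 b2 c1 c2 a') (Y f b1 b2 c1 c2 a')).
  by vm_cast_no_check (erefl true).
have := bp_eqP q w (all6P e f b1 b2 c1 (mem_sts c2) (mem_sts a')).
rewrite /X /Y !bp_eval_sum3 => {}e; symmetry in e.
apply: etrans (etrans (esym e) _); apply: eq_sum3 => d1 d2 e'.
all: by rewrite !bpE !expr1 !expr0 !mul1r.
Qed.

(** The mirror case: two lines y1, y2 going down meet a line y going up, with [q] = y2/y1, [w] =
    y1/y and [q * w] = y2/y. *)
Lemma ybe_a q w b a1 a2 c1 c2 b' :
  \sum_(d1 <- sts) \sum_(d2 <- sts) \sum_(e <- sts)
     Ra q a1 a2 d1 d2 * (vertex w c1 b d1 e * vertex (q * w) c2 e d2 b') =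
  \sum_(d1 <- sts) \sum_(d2 <- sts) \sum_(e <- sts)
     Ra q d1 d2 c1 c2 * (vertex (q * w) d1 b a1 e * vertex w d2 e a2 b').
Proof.
pose X b a1 a2 c1 c2 b' := bp_sum3 (fun d1 d2 e =>
  bp_scale (bp_Rmx sa qa a1 a2 d1 d2) (fun _ =>
    bp_scale (bp_vertex (bpX 0 1) c1 b d1 e) (fun _ =>
      bp_vertex (bpX 1 1) c2 e d2 b'))).
pose Y b a1 a2 c1 c2 b' := bp_sum3 (fun d1 d2 e =>
  bp_scale (bp_Rmx sa qa d1 d2 c1 c2) (fun _ =>
    bp_scale (bp_vertex (bpX 1 1) d1 b a1 e) (fun _ =>
      bp_vertex (bpX 0 1) d2 e a2 b'))).
have e : all6 sts (fun b a1 a2 c1 c2 b' =>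
    bp_eq (X b a1 a2 c1 c2 b') (Y b a1 a2 c1 c2 b')).
  by vm_cast_no_check (erefl true).
have := bp_eqP q w (all6P e b a1 a2 c1 (mem_sts c2) (mem_sts b')).
rewrite /X /Y !bp_eval_sum3 => {}e; symmetry in e.
apply: etrans (etrans (esym e) _); apply: eq_sum3 => d1 d2 e'.
all: by rewrite !bpE !expr1 !expr0 !mul1r.
Qed.

Lemma bp_eval_red q w p : q * w = 1 -> bp_eval q w (bp_red p) = bp_eval q w p.
Proof.
move=> qw; rewrite /bp_eval !big_map.
have red i j : q ^+ (i - minn i j) * w ^+ (j - minn i j) = q ^+ i * w ^+ j.
  set m := minn i j.
  transitivity (q ^+ (i - m + m) * w ^+ (j - m + m)).
    by rewrite !exprD mulrACA -exprMn qw expr1n mulr1.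
  by rewrite !subnK ?geq_minl ?geq_minr.
by congr (_ - _); apply: eq_bigr => x _ /=; apply: red.
Qed.

(** Two neighbouring lines with no other line left to cross: each turns in its cap, and they meet in
    the lozenge whose upper triangle lies between the two caps. *)
Definition two_caps w b1 b2 a1 a2 h1 h2 : R :=
  \sum_(e <- sts) cap R h1 b1 e *
    \sum_(c <- sts) cap R h2 c a2 * vertex w e b2 a1 c.

Let bp_two_caps v b1 b2 a1 a2 h1 h2 :=
  bp_sum sts (fun e => bp_scale (bp_cap h1 b1 e) (fun _ =>
    bp_sum sts (fun c => bp_scale (bp_cap h2 c a2) (fun _ =>
      bp_vertex v e b2 a1 c)))).

Let bp_eval_two_caps q w v b1 b2 a1 a2 h1 h2 :
  bp_eval q w (bp_two_caps v b1 b2 a1 a2 h1 h2) =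
  two_caps (bp_eval q w v) b1 b2 a1 a2 h1 h2.
Proof.
rewrite bp_eval_sum; apply: eq_bigr => e _; rewrite !bpE bp_eval_sum.
by congr (_ * _); apply: eq_bigr => c _; rewrite !bpE.
Qed.

(** This plays the part of a reflection equation: where the lines turn, the crossings on the left
    and on the right merge into one on top. The mutual lozenge of the two lines passes from [w] =
    y1/y2 to [q] = y2/y1, so the polynomials are compared modulo [q * w = 1]. *)
Lemma two_capsR q w b1 b2 a1 a2 h1 h2 : q * w = 1 ->
  h1 \in [:: stR; stG] -> h2 \in [:: stR; stG] ->
  \sum_(d1 <- sts) \sum_(d2 <- sts) Rb q b1 b2 d1 d2 *
    (\sum_(g1 <- sts) \sum_(g2 <- sts) Ra q a1 a2 g1 g2 *
       two_caps w d1 d2 g1 g2 h1 h2) =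
  \sum_(k1 <- sts) \sum_(k2 <- sts)
    Rh q k1 k2 h1 h2 * two_caps q b1 b2 a1 a2 k1 k2.
Proof.
move=> qw h1in h2in.
pose X b1 b2 a1 a2 h1 h2 := bp_sum sts (fun d1 => bp_sum sts (fun d2 =>
  bp_scale (bp_Rmx sb qb b1 b2 d1 d2) (fun _ =>
    bp_sum sts (fun g1 => bp_sum sts (fun g2 =>
      bp_scale (bp_Rmx sa qa a1 a2 g1 g2) (fun _ =>
        bp_two_caps (bpX 0 1) d1 d2 g1 g2 h1 h2)))))).
pose Y b1 b2 a1 a2 h1 h2 := bp_sum sts (fun k1 => bp_sum sts (fun k2 =>
  bp_scale (bp_Rmx [:: (stG, stR)] [:: (stR, stG)] k1 k2 h1 h2) (fun _ =>
    bp_two_caps (bpX 1 0) b1 b2 a1 a2 k1 k2))).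
have e : all6 [:: stR; stG] (fun b1 b2 a1 a2 h1 h2 =>
    bp_eq (bp_red (X b1 b2 a1 a2 h1 h2)) (bp_red (Y b1 b2 a1 a2 h1 h2))).
  by vm_cast_no_check (erefl true).
have := bp_eqP q w (all6P e b1 b2 a1 a2 h1in h2in).
rewrite (bp_eval_red _ qw) (bp_eval_red _ qw) => {}e; symmetry in e.
apply: etrans (etrans (esym e) _); rewrite bp_eval_sum; apply: eq_bigr => k1 _;
  rewrite bp_eval_sum; apply: eq_bigr => k2 _; rewrite bp_eval_scale.
- rewrite bp_eval_Rmx; congr (_ * _).
  rewrite bp_eval_sum; apply: eq_bigr => g1 _; rewrite bp_eval_sum.
  apply: eq_bigr => g2 _.
  by rewrite bp_eval_scale bp_eval_Rmx bp_eval_two_caps bp_evalX mul1r.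
- by rewrite bp_eval_Rmx bp_eval_two_caps bp_evalX mulr1.
Qed.

End LocalRelations.

(** * Transfer matrices of lines and the exchange of two neighbouring lines *)

Section Lines.
Variable R : comUnitRingType.
Implicit Types (F G : seq state -> R) (ys : seq R) (q y w : R).
Implicit Types (a b c d e h : state) (s t : seq state).

(* The transfer matrix of one line, of parameter y, entering with state b,
   crossing the lines of parameters ys and reaching the top in state h, applied to
   the vector F of the states of these lines before the crossings; s lists the
   states after them, the last one being that of the new line. *)
Fixpoint line ys y h b F s : R :=
  match ys, s with
  | [::], [:: a] => cap R h b a * F [::]
  | x :: ys', a :: s' =>
      \sum_(e <- sts) \sum_(c <- sts)
        vertex (x / y) e b a c * line ys' y h c (fun t => F (e :: t)) s'
  | _, _ => 0
  end.

(* Each line is given by its parameter and its states on the left and on the top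
   side; D starts with the last line. *)
Fixpoint partition_fun (D : seq (R * state * state)) s : R :=
  match D with
  | [::] => (s == [::])%:R
  | (y, b, h) :: D' =>
      line (rev [seq x.1.1 | x <- D']) y h b (partition_fun D') s
  end.

(** The crossing [Ra] on the positions [i] and [i + 1] of the right side; 0 is the default on lists
    that are too short. *)
Fixpoint swapR q i F s : R :=
  match i, s with
  | 0%N, a1 :: a2 :: s' =>
      \sum_(g1 <- sts) \sum_(g2 <- sts) Ra q a1 a2 g1 g2 * F (g1 :: g2 :: s')
  | i'.+1, a :: s' => swapR q i' (fun t => F (a :: t)) s'
  | _, _ => 0
  end.

Lemma eq_line ys y h b F G s :
  (forall t, size t = size ys -> F t = G t) ->
  line ys y h b F s = line ys y h b G s.
Proof.
elim: ys b F G s => [|x ys IH] b F G s e; first by case: s => [|a []] //=; rewrite e.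
case: s => //= a s; do 2 (apply: eq_bigr => ? _); congr (_ * _).
by apply: IH => t st; apply: e; rewrite /= st.
Qed.

Lemma line_sum (T : Type) (r : seq T) ys y h b (F : T -> seq state -> R) s :
  line ys y h b (fun t => \sum_(k <- r) F k t) s =
  \sum_(k <- r) line ys y h b (F k) s.
Proof.
elim: ys b F s => [|x ys IH] b F s /=.
  case: s => [|a []]; rewrite ?big_distrr //= big1_eq //.
case: s => [|a s]; first by rewrite big1_eq.
rewrite [RHS]exchange_big; apply: eq_bigr => e _ /=.
rewrite [RHS]exchange_big; apply: eq_bigr => c _ /=.
by rewrite IH big_distrr.
Qed.

Lemma lineZ ys y h b k F s :
  line ys y h b (fun t => k * F t) s = k * line ys y h b F s.
Proof.
elim: ys b F s => [|x ys IH] b F s /=.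
  by case: s => [|a []]; rewrite ?mulr0 //= mulrCA.
case: s => [|a s]; first by rewrite mulr0.
rewrite big_distrr; apply: eq_bigr => e _ /=.
rewrite big_distrr; apply: eq_bigr => c _ /=.
by rewrite IH mulrCA.
Qed.

Lemma eq_swapR q i F G s : F =1 G -> swapR q i F s = swapR q i G s.
Proof.
elim: i F G s => [|i IH] F G [|a s] //= e; last by apply: IH => t; apply: e.
by case: s => // a2 s; do 2 (apply: eq_bigr => ? _); rewrite e.
Qed.

Lemma swapR_sum (T : Type) (r : seq T) q i (F : T -> seq state -> R) s :
  swapR q i (fun t => \sum_(k <- r) F k t) s = \sum_(k <- r) swapR q i (F k) s.
Proof.
elim: i F s => [|i IH] F s; last first.
  by case: s => [|a s] /=; [rewrite big1_eq | exact: IH].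
case: s => [|a1 [|a2 s]] /=; rewrite ?big1_eq //.
rewrite [RHS]exchange_big; apply: eq_bigr => e _ /=.
rewrite [RHS]exchange_big; apply: eq_bigr => c _ /=.
by rewrite big_distrr.
Qed.

Lemma swapRZ q i k F s : swapR q i (fun t => k * F t) s = k * swapR q i F s.
Proof.
elim: i F s => [|i IH] F s; last first.
  by case: s => [|a s] /=; [rewrite mulr0 | exact: IH].
case: s => [|a1 [|a2 s]] /=; rewrite ?mulr0 //.
rewrite big_distrr; apply: eq_bigr => e _ /=.
rewrite big_distrr; apply: eq_bigr => c _ /=.
by rewrite mulrCA.
Qed.

Lemma mulr0_eq (x z : R) : z = 0 -> x * z = 0.
Proof. by move=> ->; rewrite mulr0. Qed.

(* Exchanges the sums number n and n + 1, counted from 0, of a nested sum. *)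
Local Tactic Notation "exch" integer(n) :=
  apply: etrans; first (do n (apply: eq_bigr => ? _); exact: exchange_big).
Local Ltac distr :=
  repeat (rewrite ?big_distrr ?big_distrl /=; apply: eq_bigr => ? _).

Local Ltac zeros :=
  repeat first [done | apply: big1 => ? _ | apply: mulr0_eq].

Local Notation "\S x , E" := (\sum_(x <- sts) E)
  (at level 41, x name, E at level 41, right associativity).

(** A crossing of two earlier lines slides through a later line: [ybe_a] at the two vertices
    concerned, while the other vertices are not affected. *)
Lemma line_swap ys1 y1 y2 ys2 y h b F s : y1 \is a GRing.unit ->
  swapR (y2 / y1) (size ys1) (line (ys1 ++ [:: y1, y2 & ys2]) y h b F) s =
  line (ys1 ++ [:: y2, y1 & ys2]) y h b (swapR (y2 / y1) (size ys1) F) s.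
Proof.
move=> u1; elim: ys1 b F s => [|x ys1 IH] b F s; last first.
  case: s => [|a s] //=; rewrite swapR_sum; apply: eq_bigr => e _.
  by rewrite swapR_sum; apply: eq_bigr => c _; rewrite swapRZ IH.
case: s => [|a1 [|a2 s]] //=.
  by symmetry; apply: big1_seq => e _; apply: big1_seq => c _; rewrite mulr0.
pose L e1 e2 c2 := line ys2 y h c2 (fun t => F (e1 :: e2 :: t)) s.
pose q := y2 / y1; pose v1 := vertex (y1 / y); pose v2 := vertex (y2 / y).
(* The outer states are the external edges that [ybe_a] keeps fixed; the inner [g1], [g2], [c1] are
   the edges of the triangle formed by the crossing and the two vertices. *)
transitivity (\S e1, \S e2, \S c2, (\S g1, \S g2, \S c1,
   Ra q a1 a2 g1 g2 * (v1 e1 b g1 c1 * v2 e2 c1 g2 c2)) * L e1 e2 c2).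
  transitivity (\S g1, \S g2, \S e1, \S c1, \S e2, \S c2,
   Ra q a1 a2 g1 g2 * (v1 e1 b g1 c1 * v2 e2 c1 g2 c2) * L e1 e2 c2).
    by distr; rewrite /= !mulrA.
  exch 1; exch 0; exch 3; exch 2; exch 1; exch 4; exch 3; exch 2.
  by distr.
have v2E : v2 = vertex (q * (y1 / y)) by rewrite /v2 /q mulrA divrK.
transitivity (\S e1, \S e2, \S c2, (\S d1, \S d2, \S c1,
   Ra q d1 d2 e1 e2 * (v2 d1 b a1 c1 * v1 d2 c1 a2 c2)) * L e1 e2 c2).
  rewrite v2E; do 3 (apply: eq_bigr => ? _); congr (_ * _); exact: ybe_a.
transitivity (\S d1, \S c1, \S d2, \S c2, \S e1, \S e2,
   v2 d1 b a1 c1 * (v1 d2 c1 a2 c2 * (Ra q d1 d2 e1 e2 * L e1 e2 c2))).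
  symmetry; exch 1; exch 3; exch 2; exch 1; exch 0; exch 4; exch 3; exch 2.
  exch 1; exch 4; exch 3; exch 2.
  by clear v2E; clearbody v1 v2 L q; distr; ring.
apply: eq_bigr => d1 _; apply: eq_bigr => c1 _.
rewrite big_distrr; apply: eq_bigr => d2 _.
rewrite big_distrr; apply: eq_bigr => c2 _ /=; rewrite line_sum.
rewrite -/v1 -/v2 -/q.
have e0 e1 : line ys2 y h c2 (fun t => \S g2, Ra q d1 d2 e1 g2 * F [:: e1, g2 & t]) s =
    \S e2, Ra q d1 d2 e1 e2 * L e1 e2 c2.
  by rewrite line_sum; apply: eq_bigr => e2 _; rewrite lineZ.
under [in RHS]eq_bigr do rewrite e0.
by clear v2E e0; clearbody v1 v2 L q; distr.
Qed.

(** The crossing on the left slides by [ybe_b] through the earlier lines, one for each step of the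
    induction, until the two lines reach the top side, where [two_capsR] absorbs it together with
    the crossing on the right. *)
Lemma two_lines ys y1 y2 h1 h2 b1 b2 F s :
  y1 \is a GRing.unit -> y2 \is a GRing.unit ->
  h1 \in [:: stR; stG] -> h2 \in [:: stR; stG] ->
  \S d1, \S d2, Rb (y2 / y1) b1 b2 d1 d2 *
    swapR (y2 / y1) (size ys)
      (line (rcons ys y1) y2 h2 d2 (line ys y1 h1 d1 F)) s =
  \S k1, \S k2, Rh (y2 / y1) k1 k2 h1 h2 *
    line (rcons ys y2) y1 k2 b2 (line ys y2 k1 b1 F) s.
Proof.
move=> u1 u2 h1P h2P; elim: ys b1 b2 F s => [|x ys IH] b1 b2 F s.
  case: s => [|a1 [|a2 [|a3 s]]] /=.
  (* Two lines leave exactly two states; for any other length both sides are 0. *)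
  1,2,4: by transitivity (0 : R); [|symmetry]; zeros.
  have T2 w k1 k2 c1 c2 g1 g2 :
      \S e, \S c, vertex w e c2 g1 c * (cap R k2 c g2 * (cap R k1 c1 e * F [::])) =
        two_caps w c1 c2 g1 g2 k1 k2 * F [::].
      by rewrite /two_caps; move: (vertex w) (cap R) => v p; distr; ring.
    have qw : y2 / y1 * (y1 / y2) = 1 by rewrite mulrA divrK // divrr.
    have := congr1 (fun z => z * F [::]) (two_capsR b1 b2 a1 a2 qw h1P h2P).
    move: (y2 / y1) (y1 / y2) {qw} => q w e2.
    apply: etrans (etrans _ e2) _.
      rewrite big_distrl; apply: eq_bigr => d1 _.
      rewrite big_distrl; apply: eq_bigr => d2 _.
      rewrite -[RHS]mulrA; congr (_ * _).
      rewrite big_distrl; apply: eq_bigr => g1 _.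
      rewrite big_distrl; apply: eq_bigr => g2 _.
      by rewrite -[RHS]mulrA -T2.
    rewrite big_distrl; apply: eq_bigr => k1 _.
    rewrite big_distrl; apply: eq_bigr => k2 _.
    by rewrite -[LHS]mulrA -T2.
case: s => [|a s]; first by transitivity (0 : R); [|symmetry]; zeros.
pose q := y2 / y1; pose v1 := vertex (x / y1); pose v2 := vertex (x / y2).
pose Ff f t := F (f :: t).
pose W f c1 c2 := swapR q (size ys)
  (line (rcons ys y1) y2 h2 c2 (line ys y1 h1 c1 (Ff f))) s.
have unfoldl d1 d2 : swapR q (size (x :: ys))
    (line (rcons (x :: ys) y1) y2 h2 d2 (line (x :: ys) y1 h1 d1 F)) (a :: s) =
    \S e, \S c2, v2 e d2 a c2 * \S f, \S c1, v1 f d1 e c1 * W f c1 c2.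
  rewrite /= swapR_sum; apply: eq_bigr => e _.
  rewrite swapR_sum; apply: eq_bigr => c2 _; rewrite swapRZ; congr (_ * _).
  have -> : \S f, \S c1, v1 f d1 e c1 * W f c1 c2 = swapR q (size ys)
      (fun t => \S f, \S c1, v1 f d1 e c1 *
         line (rcons ys y1) y2 h2 c2 (line ys y1 h1 c1 (Ff f)) t) s.
    rewrite swapR_sum; apply: eq_bigr => f _.
    by rewrite swapR_sum; apply: eq_bigr => c1 _; rewrite swapRZ.
  apply: eq_swapR => t; rewrite line_sum; apply: eq_bigr => f _.
  by rewrite line_sum; apply: eq_bigr => c1 _; rewrite lineZ.
pose V k1 k2 f d1 d2 :=
  line (rcons ys y2) y1 k2 d2 (line ys y2 k1 d1 (Ff f)) s.
have unfoldr k1 k2 :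
    line (rcons (x :: ys) y2) y1 k2 b2 (line (x :: ys) y2 k1 b1 F) (a :: s) =
    \S e, \S d2, v1 e b2 a d2 * \S f, \S d1, v2 f b1 e d1 * V k1 k2 f d1 d2.
  rewrite /=; apply: eq_bigr => e _; apply: eq_bigr => d2 _; congr (_ * _).
  rewrite line_sum; apply: eq_bigr => f _.
  by rewrite line_sum; apply: eq_bigr => d1 _; rewrite lineZ.
transitivity (\S f, \S c1, \S c2, (\S d1, \S d2, \S e,
   Rb q b1 b2 d1 d2 * (v1 f d1 e c1 * v2 e d2 a c2)) * W f c1 c2).
  transitivity (\S d1, \S d2, \S e, \S c2, \S f, \S c1,
      Rb q b1 b2 d1 d2 * (v2 e d2 a c2 * (v1 f d1 e c1 * W f c1 c2))).
    apply: eq_bigr => d1 _; apply: eq_bigr => d2 _; rewrite -/q unfoldl.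
    by clear; clearbody v1 v2 W q; distr.
  clear; clearbody v1 v2 W q.
  exch 3; exch 2; exch 1; exch 0; exch 4; exch 3; exch 2; exch 1; exch 4.
  exch 3; exch 2.
  by distr; ring.
have v1E : v1 = vertex (q * (x / y2)).
  by congr (vertex _); rewrite [RHS]mulrC mulrA divrK.
transitivity (\S f, \S c1, \S c2, (\S d1, \S d2, \S e,
   Rb q d1 d2 c1 c2 * (v2 f b1 e d1 * v1 e b2 a d2)) * W f c1 c2).
  rewrite v1E; do 3 (apply: eq_bigr => ? _); congr (_ * _); exact: ybe_b.
transitivity (\S e, \S d2, v1 e b2 a d2 * \S f, \S d1, v2 f b1 e d1 *
   \S c1, \S c2, Rb q d1 d2 c1 c2 * W f c1 c2).
  transitivity (\S f, \S c1, \S c2, \S d1, \S d2, \S e,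
   Rb q d1 d2 c1 c2 * (v2 f b1 e d1 * v1 e b2 a d2) * W f c1 c2).
    by clear; clearbody v1 v2 W q; distr.
  clear; clearbody v1 v2 W q.
  exch 4; exch 3; exch 2; exch 1; exch 0; exch 4; exch 3; exch 2; exch 1.
  exch 4; exch 3.
  by distr; ring.
(* The crossing has passed the line of [x]; the induction hypothesis takes it to the top. *)
transitivity (\S e, \S d2, \S f, \S d1, \S k1, \S k2,
   v1 e b2 a d2 * (v2 f b1 e d1 * (Rh q k1 k2 h1 h2 * V k1 k2 f d1 d2))).
  apply: eq_bigr => e _; apply: eq_bigr => d2 _.
  rewrite big_distrr; apply: eq_bigr => f _.
  rewrite big_distrr; apply: eq_bigr => d1 _; rewrite /= IH -/q.
  rewrite mulrA big_distrr; apply: eq_bigr => k1 _.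
  by rewrite big_distrr; apply: eq_bigr => k2 _; rewrite /= -!mulrA.
transitivity (\S k1, \S k2, Rh q k1 k2 h1 h2 *
  (\S e, \S d2, v1 e b2 a d2 * \S f, \S d1, v2 f b1 e d1 * V k1 k2 f d1 d2)).
  clear; clearbody v1 v2 V q.
  exch 3; exch 2; exch 1; exch 0; exch 4; exch 3; exch 2; exch 1.
  by distr; ring.
by apply: eq_bigr => k1 _; apply: eq_bigr => k2 _; rewrite unfoldr.
Qed.

(** [D1] holds the earlier lines, which [two_lines] deals with, and [D2] the later ones, through
    which [line_swap] moves the crossing on the right side. *)
Lemma partition_fun_exchange (D1 D2 : seq (R * state * state))
    y1 y2 h1 h2 b1 b2 s :
  y1 \is a GRing.unit -> y2 \is a GRing.unit ->
  h1 \in [:: stR; stG] -> h2 \in [:: stR; stG] ->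
  \S d1, \S d2, Rb (y2 / y1) b1 b2 d1 d2 *
    swapR (y2 / y1) (size D1)
      (partition_fun (D2 ++ [:: (y2, d2, h2), (y1, d1, h1) & D1])) s =
  \S k1, \S k2, Rh (y2 / y1) k1 k2 h1 h2 *
    partition_fun (D2 ++ [:: (y1, b2, k2), (y2, b1, k1) & D1]) s.
Proof.
move=> u1 u2 h1P h2P; elim: D2 s => [|[[y b] h] D2 IH] s.
  rewrite /= rev_cons rev_cons.
  have := two_lines (rev [seq x.1.1 | x <- D1]) b1 b2 (partition_fun D1) s
    u1 u2 h1P h2P.
  by rewrite size_rev size_map.
pose L1 := rev [seq x.1.1 | x <- D1]; pose L2 := rev [seq x.1.1 | x <- D2].
have unfold x z d e k m : partition_fun
    (((y, b, h) :: D2) ++ [:: (z, d, k), (x, e, m) & D1]) =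
    line (L1 ++ [:: x, z & L2]) y h b
      (partition_fun (D2 ++ [:: (z, d, k), (x, e, m) & D1])).
  by rewrite /= !map_cat /= !rev_cat /= !rev_cons -!cats1 -!catA.
have szD : size D1 = size L1 by rewrite size_rev size_map.
transitivity (line (L1 ++ [:: y2, y1 & L2]) y h b (fun t =>
  \S d1, \S d2, Rb (y2 / y1) b1 b2 d1 d2 * swapR (y2 / y1) (size D1)
   (partition_fun (D2 ++ [:: (y2, d2, h2), (y1, d1, h1) & D1])) t) s).
  rewrite line_sum; apply: eq_bigr => d1 _; rewrite line_sum.
  by apply: eq_bigr => d2 _; rewrite lineZ szD -line_swap // unfold.
rewrite (eq_line _ _ _ _ (fun t _ => IH t)).
rewrite line_sum; apply: eq_bigr => d1 _; rewrite line_sum.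
by apply: eq_bigr => d2 _; rewrite lineZ unfold.
Qed.

End Lines.

(** * The exchange relation on boundary states *)

Definition stb (x : bool) : state := if x then st0 else stR.
Definition sta (x : bool) : state := if x then stG else st0.
Definition sth (x : bool) : state := if x then stG else stR.

Section TwoStates.
Variable R : comUnitRingType.
Implicit Types (q : R) (x y : bool).

(* The action of the transposition of two adjacent parameters of ratio q on
   the classes: diagonal and off-diagonal coefficients, where x and y tell
   whether the frame contains the two positions. *)
Definition swap_diag q x y : R := if ~~ x && y then q else 1.
Definition swap_off q x y : R := if x && ~~ y then 1 - q else 0.

(** A crossing either keeps or exchanges a pair of states, so starting from boundary states the sum
    over all four states stays among boundary states. *)
Lemma Rb_bool q x y (X : state -> state -> R) :
  \sum_(d1 <- sts) \sum_(d2 <- sts) Rb q (stb x) (stb y) d1 d2 * X d1 d2 =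
  swap_diag q x y * X (stb x) (stb y) + swap_off q x y * X (stb y) (stb x).
Proof.
rewrite !big_cons !big_nil /Rb /Rmx.
by case: x; case: y; rewrite /swap_diag /swap_off /=; ring.
Qed.

Lemma Ra_bool q x y (X : state -> state -> R) :
  \sum_(d1 <- sts) \sum_(d2 <- sts) Ra q (sta x) (sta y) d1 d2 * X d1 d2 =
  swap_diag q x y * X (sta x) (sta y) + swap_off q x y * X (sta y) (sta x).
Proof.
rewrite !big_cons !big_nil /Ra /Rmx.
by case: x; case: y; rewrite /swap_diag /swap_off /=; ring.
Qed.

(** The sum runs over the first pair of arguments of [Rh], that is, along a column of the matrix;
    hence [swap_off q y x] instead of [swap_off q x y]. *)
Lemma Rh_bool q x y (X : state -> state -> R) :
  \sum_(d1 <- sts) \sum_(d2 <- sts) Rh q d1 d2 (sth x) (sth y) * X d1 d2 =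
  swap_diag q x y * X (sth x) (sth y) + swap_off q y x * X (sth y) (sth x).
Proof.
rewrite !big_cons !big_nil /Rh /Rmx.
by case: x; case: y; rewrite /swap_diag /swap_off /=; ring.
Qed.

Lemma swapR_bool q s1 x y s2 F :
  swapR q (size s1) F (s1 ++ [:: sta x, sta y & s2]) =
  swap_diag q x y * F (s1 ++ [:: sta x, sta y & s2]) +
  swap_off q x y * F (s1 ++ [:: sta y, sta x & s2]).
Proof.
elim: s1 F => [|a s1 IH] F /=; last by rewrite IH.
exact: (Ra_bool q x y (fun g1 g2 => F [:: g1, g2 & s2])).
Qed.

End TwoStates.

Section SetExchange.
Variables (R : comUnitRingType) (n : nat).
Implicit Types (v : 'I_n -> R) (A B C : {set 'I_n}) (i j : 'I_n).

Definition frame_fun v A B C : R :=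
  partition_fun
    (rev [seq (v i, stb (i \in A), sth (i \in C)) | i <- enum 'I_n])
    [seq sta (i \in B) | i <- enum 'I_n].

Definition swap_set i j A : {set 'I_n} := [set x | tperm i j x \in A].

Lemma swap_setl i j A : (i \in swap_set i j A) = (j \in A).
Proof. by rewrite inE tpermL. Qed.

Lemma swap_setr i j A : (j \in swap_set i j A) = (i \in A).
Proof. by rewrite inE tpermR. Qed.

Lemma swap_setK i j : involutive (swap_set i j).
Proof. by move=> A; apply/setP=> x; rewrite !inE tpermK. Qed.

Lemma card_swap_set i j A : #|swap_set i j A| = #|A|.
Proof.
rewrite -[RHS](card_imset _ (@perm_inj _ (tperm i j))); apply: eq_card => x.
rewrite inE; apply/idP/imsetP=> [xA|[z zA ->]]; last by rewrite tpermK.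
by exists (tperm i j x); rewrite ?tpermK.
Qed.

Lemma enum_split i j : j = i.+1 :> nat -> exists p r,
  enum 'I_n = p ++ [:: i, j & r] /\ {in p ++ r, forall x, x != i /\ x != j}.
Proof.
move=> ji; exists (take i (enum 'I_n)), (drop j.+1 (enum 'I_n)).
have e : enum 'I_n = take i (enum 'I_n) ++ [:: i, j & drop j.+1 (enum 'I_n)].
  rewrite -[LHS](cat_take_drop i) (drop_nth i) ?size_enum_ord // nth_ord_enum.
  by rewrite -ji (drop_nth i) ?size_enum_ord // nth_ord_enum.
split=> // x xin; have := enum_uniq 'I_n; rewrite e => u.
have : uniq ([:: i; j] ++ (take i (enum 'I_n) ++ drop j.+1 (enum 'I_n))).
  by rewrite uniq_catCA.
rewrite cat_uniq => /and3P [_ /hasPn /(_ x xin)] /=.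
by rewrite !inE negb_or => /andP.
Qed.

(** On the top side the matrix is transposed: the off-diagonal coefficient is [f (s C)] and not
    [f C]. This is what makes it match the action on the G_C after a reindexing of the sum over
    [C]. *)
Lemma frame_fun_exchange v A B C i j : j = i.+1 :> nat ->
    (forall x, v x \is a GRing.unit) ->
  let q := v j / v i in
  let e (D : {set 'I_n}) := swap_diag q (i \in D) (j \in D) in
  let f (D : {set 'I_n}) := swap_off q (i \in D) (j \in D) in
  let s := swap_set i j in
  e C * frame_fun (v \o tperm i j) A B C +
  f (s C) * frame_fun (v \o tperm i j) A B (s C) =
  e A * (e B * frame_fun v A B C + f B * frame_fun v A (s B) C) +
  f A * (e B * frame_fun v (s A) B C + f B * frame_fun v (s A) (s B) C).
Proof.
move=> ji uv q e f s.
have [p [r [enumE pr]]] := enum_split ji.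
have tp x : x \in p ++ r -> tperm i j x = x.
  by move=> /pr [xi xj]; rewrite tpermD // eq_sym.
have xp x : x \in p -> x \in p ++ r by rewrite mem_cat => ->.
have xr x : x \in r -> x \in p ++ r by rewrite mem_cat orbC => ->.
pose dat (w : 'I_n -> R) (X Z : {set 'I_n}) x :=
  (w x, stb (x \in X), sth (x \in Z)) : R * state * state.
have mapE (T : Type) (g h : 'I_n -> T) : (forall x, x \in p ++ r -> g x = h x) ->
    map g (enum 'I_n) = map h p ++ [:: g i, g j & map h r].
  move=> gh; rewrite enumE map_cat /=; congr (_ ++ [:: _, _ & _]).
    by apply/eq_in_map => x /xp; apply: gh.
  by apply/eq_in_map => x /xr; apply: gh.
have sE (X : {set 'I_n}) x : x \in p ++ r -> (x \in s X) = (x \in X).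
  by move=> /tp; rewrite inE => ->.
pose D1 := rev (map (dat v A C) p); pose D2 := rev (map (dat v A C) r).
have szD1 : size D1 = size [seq sta (x \in B) | x <- p].
  by rewrite size_rev !size_map.
have frameE (w : 'I_n -> R) (X Y Z : {set 'I_n}) :
    (forall x, x \in p ++ r ->
      [/\ w x = v x, (x \in X) = (x \in A), (x \in Y) = (x \in B) &
          (x \in Z) = (x \in C)]) ->
    frame_fun w X Y Z = partition_fun
      (D2 ++ [:: (w j, stb (j \in X), sth (j \in Z)),
                 (w i, stb (i \in X), sth (i \in Z)) & D1])
      ([seq sta (x \in B) | x <- p] ++
         [:: sta (i \in Y), sta (j \in Y) & [seq sta (x \in B) | x <- r]]).
  move=> h; rewrite /frame_fun.
  rewrite (mapE _ _ (dat v A C)); last first.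
    by move=> x /h [wx xX _ xZ]; rewrite /dat wx xX xZ.
  rewrite (mapE _ _ (fun x => sta (x \in B))); last by move=> x /h [_ _ -> _].
  by rewrite rev_cat /= !rev_cons -!cats1 -!catA.
have sthP x : sth x \in [:: stR; stG] by case: x.
have := partition_fun_exchange D1 D2 (stb (i \in A)) (stb (j \in A))
  ([seq sta (x \in B) | x <- p] ++
     [:: sta (i \in B), sta (j \in B) & [seq sta (x \in B) | x <- r]])
  (uv i) (uv j) (sthP (i \in C)) (sthP (j \in C)).
rewrite -/q (Rb_bool q _ _ (fun d1 d2 => swapR q (size D1) (partition_fun
  (D2 ++ [:: (v j, d2, sth (j \in C)), (v i, d1, sth (i \in C)) & D1])) _)).
rewrite (Rh_bool q _ _ (fun k1 k2 => partition_fun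
  (D2 ++ [:: (v i, stb (j \in A), k2), (v j, stb (i \in A), k1) & D1]) _)).
rewrite szD1 !swapR_bool => E2; symmetry.
rewrite !frameE; first 1 last.
all: try by move=> x xpr; rewrite ?sE //= ?tp.
rewrite /= tpermL tpermR !swap_setl !swap_setr /e /f /s !swap_setl !swap_setr.
exact: E2.
Qed.

End SetExchange.

(** * Puzzles as configurations of the vertex model *)

Lemma big_tuple_recl (V : nmodType) (T : finType) n (G : n.+1.-tuple T -> V) :
  \sum_(t : n.+1.-tuple T) G t =
  \sum_(x : T) \sum_(t : n.-tuple T) G [tuple of x :: t].
Proof.
rewrite pair_big /= (reindex (fun p : T * n.-tuple T => [tuple of p.1 :: p.2])) //=.
exists (fun t => (thead t, [tuple of behead t])) => [[x t]|t] _ /=.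
  by congr (_, _); apply: val_inj.
by rewrite [RHS]tuple_eta; apply: val_inj.
Qed.

Lemma big_tuple0 (V : nmodType) (T : finType) (G : 0.-tuple T -> V) :
  \sum_(t : 0.-tuple T) G t = G [tuple].
Proof. by rewrite (big_pred1 [tuple]) // => t; apply/esym/eqP/tuple0. Qed.

Lemma sum_stsE (V : nmodType) (F : state -> V) :
  \sum_(x <- sts) F x = \sum_(x : state) F x.
Proof.
apply: perm_big; apply: uniq_perm; rewrite ?index_enum_uniq // => x.
by rewrite mem_index_enum mem_sts.
Qed.

Lemma sum_tilesE (V : nmodType) (F : tile -> V) :
  \sum_(u <- tiles) F u = \sum_(u : tile) F u.
Proof.
apply: perm_big; apply: uniq_perm; rewrite ?index_enum_uniq //; last first.
  by move=> x; rewrite mem_index_enum !inE; case: x; rewrite eqxx ?orbT.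
rewrite /= !inE !negb_or -!(inj_eq (can_inj tile_codeK)) -!val_eqE /=.
by rewrite !inordK.
Qed.

Fixpoint okline b h (us ds : seq tile) (s : seq state) : bool :=
  match us, ds, s with
  | [::], [:: d], [:: a] => ends d h b a
  | u :: us', d :: ds', a :: s' =>
      fits u d b a && okline (edge_b u) h us' ds' s'
  | _, _, _ => false
  end.

Section LineSum.
Variable R : comUnitRingType.
Implicit Types (y : R) (ys : seq R) (F : seq state -> R).

Fixpoint wline ys y (us ds : seq tile) : R :=
  match ys, us, ds with
  | x :: ys', u :: us', d :: ds' =>
      lozenge_weight (x / y) u d * wline ys' y us' ds'
  | _, _, _ => 1
  end.

Lemma lineE ys y h b F s :
  line ys y h b F s =
  \sum_(us : (size ys).-tuple tile) \sum_(ds : (size ys).+1.-tuple tile)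
    if okline b h us ds s then wline ys y us ds * F (map edge_a us) else 0.
Proof.
elim: ys b F s => [|x ys IH] b F s.
  rewrite big_tuple0 big_tuple_recl /=; under eq_bigr do rewrite big_tuple0 /=.
  case: s => [|a [|a' s]] /=; rewrite ?big1_eq // /cap sum_tilesE big_distrl /=.
  by apply: eq_bigr => d _; case: ifP; rewrite ?mul0r.
rewrite big_tuple_recl; under eq_bigr do under eq_bigr do rewrite big_tuple_recl.
case: s => [|a s] /=.
  by symmetry; apply: big1 => u _; apply: big1 => us _; apply: big1 => d _;
    apply: big1.
transitivity (\sum_(u <- tiles) \sum_(d <- tiles) \sum_(e <- sts) \sum_(c <- sts)
  (if (edge_a u == e) && (edge_b u == c) then
    (if fits u d b a then lozenge_weight (x / y) u d else 0) *
     line ys y h c (fun t => F (e :: t)) s else 0)).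
  under [RHS]eq_bigr do rewrite exchange_big.
  rewrite [RHS]exchange_big; apply: eq_bigr => e _.
  under [RHS]eq_bigr do rewrite exchange_big.
  rewrite [RHS]exchange_big; apply: eq_bigr => c _.
  rewrite /vertex big_distrl; apply: eq_bigr => u _ /=.
  case: ifP => _; first by rewrite big_distrl.
  by rewrite mul0r big1_eq.
rewrite sum_tilesE; apply: eq_bigr => u _.
rewrite [RHS]exchange_big sum_tilesE; apply: eq_bigr => d _.
(* The states [e] and [c] are edges of the tile [u], so each sum over states has a single term. *)
rewrite sum_stsE (bigD1 (edge_a u)) //= [X in _ + X]big1 ?addr0; last first.
  move=> e /negPf; rewrite eq_sym => ->.
  by apply: big1.
rewrite sum_stsE (bigD1 (edge_b u)) //= [X in _ + X]big1 ?addr0; last first.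
  by move=> e /negPf; rewrite eq_sym => ->; rewrite andbF.
rewrite !eqxx /= IH big_distrr; apply: eq_bigr => us _.
rewrite big_distrr; apply: eq_bigr => ds _ /=.
case: (fits _ _ _ _); rewrite ?mul0r //=.
by case: ifP; rewrite ?mulr0 // mulrA.
Qed.

End LineSum.

(** Line l crosses the l lines before it: it carries l up-pointing tiles and l + 1 down-pointing
    ones, the last of these on the top side. *)
Fixpoint lines n : finType :=
  match n with
  | 0 => unit
  | n'.+1 => (lines n' * (n'.-tuple tile * n'.+1.-tuple tile))%type
  end.

Section Lines.
Variables (R : comUnitRingType) (v : nat -> R) (lam nu : nat -> state).

Definition nat_lines n : seq (R * state * state) :=
  rev [seq (v i, lam i, nu i) | i <- iota 0 n].

Fixpoint oklines n : lines n -> seq state -> bool :=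
  match n with
  | 0 => fun _ s => s == [::]
  | n'.+1 => fun Q s => okline (lam n') (nu n') Q.2.1 Q.2.2 s &&
                          oklines Q.1 (map edge_a Q.2.1)
  end.

Fixpoint wlines n : lines n -> R :=
  match n with
  | 0 => fun _ => 1
  | n'.+1 => fun Q => wline (map v (iota 0 n')) (v n') Q.2.1 Q.2.2 *
                        wlines Q.1
  end.

Lemma nat_linesS n : nat_lines n.+1 = (v n, lam n, nu n) :: nat_lines n.
Proof. by rewrite /nat_lines -addn1 iotaD map_cat rev_cat. Qed.

Lemma partition_funE n s : partition_fun (nat_lines n) s =
  \sum_(Q : lines n) if oklines Q s then wlines Q else 0.
Proof.
elim: n s => [|n IH] s.
  rewrite (big_pred1 tt) => [|[]] //=.
  by case: (s == [::]).
rewrite nat_linesS /= /nat_lines map_rev revK -map_comp /=.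
set ys := map _ _; have szy : size ys = n by rewrite size_map size_iota.
rewrite lineE; move: (wline ys (v n)) => w; rewrite {ys} szy.
rewrite -(pair_big xpredT xpredT
  (fun (Q : lines n) (L : n.-tuple tile * n.+1.-tuple tile) =>
    if okline (lam n) (nu n) L.1 L.2 s && oklines Q (map edge_a L.1)
    then w L.1 L.2 * wlines Q else 0)) /=.
rewrite [RHS]exchange_big pair_big /=; apply: eq_bigr => L _.
rewrite -/(nat_lines n) IH.
case: okline => /=; last by rewrite big1_eq.
rewrite big_distrr; apply: eq_bigr => Q _ /=.
by case: ifP; rewrite ?mulr0.
Qed.

End Lines.

(* Along the line l there are the down-pointing tiles (l - c, c) and the
   up-pointing tiles (l - c - 1, c); tilings are read off and built from functions
   of c and l. *)
Section TilingLines.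
Variable n : nat.
Implicit Types (P : tiling n) (U D : nat -> nat -> tile).

Definition line_u (u : up_tri n) : nat := (row_u u + col_u u).+1.
Definition line_d (d : down_tri n) : nat := (row_d d + col_d d)%N.

Definition read_u P (c l : nat) : tile :=
  if [pick u : up_tri n | (col_u u == c :> nat) && (line_u u == l)] is Some u
  then P.1 u else TE.
Definition read_d P (c l : nat) : tile :=
  if [pick d : down_tri n | (col_d d == c :> nat) && (line_d d == l)] is Some d
  then P.2 d else TE.

Definition mk_tiling U D : tiling n :=
  ([ffun u : up_tri n => U (col_u u) (line_u u)],
   [ffun d : down_tri n => D (col_d d) (line_d d)]).

Lemma up_tri_inj (u u' : up_tri n) :
  col_u u = col_u u' :> nat -> line_u u = line_u u' -> u = u'.
Proof.
rewrite /line_u => cE [] /eqP; rewrite cE eqn_add2r => /eqP rE.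
apply: val_inj; apply: injective_projections; exact: val_inj.
Qed.

Lemma down_tri_inj (d d' : down_tri n) :
  col_d d = col_d d' :> nat -> line_d d = line_d d' -> d = d'.
Proof.
rewrite /line_d => cE /eqP; rewrite cE eqn_add2r => /eqP rE.
apply: val_inj; apply: injective_projections; exact: val_inj.
Qed.

Lemma up_triP c l : (c < l < n)%N ->
  exists u : up_tri n, col_u u = c :> nat /\ line_u u = l.
Proof.
case/andP=> cl ln.
have rn : (l - c.+1 < n)%N by lia.
have cn : (c < n)%N by lia.
have H : (((Ordinal rn, Ordinal cn).1 + (Ordinal rn, Ordinal cn).2).+1 < n)%N.
  by rewrite /=; lia.
by exists (Sub (Ordinal rn, Ordinal cn) H); rewrite /line_u /row_u /col_u SubK /=; lia.
Qed.

Lemma down_triP c l : (c <= l < n)%N ->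
  exists d : down_tri n, col_d d = c :> nat /\ line_d d = l.
Proof.
case/andP=> cl ln.
have rn : (l - c < n)%N by lia.
have cn : (c < n)%N by lia.
have H : ((Ordinal rn, Ordinal cn).1 + (Ordinal rn, Ordinal cn).2 < n)%N.
  by rewrite /=; lia.
by exists (Sub (Ordinal rn, Ordinal cn) H); rewrite /line_d /row_d /col_d SubK /=; lia.
Qed.

Lemma read_uE P u : read_u P (col_u u) (line_u u) = P.1 u.
Proof.
rewrite /read_u; case: pickP => [u' /andP [/eqP cE /eqP lE]|/(_ u)].
  by congr (P.1 _); apply: up_tri_inj.
by rewrite !eqxx.
Qed.

Lemma read_dE P d : read_d P (col_d d) (line_d d) = P.2 d.
Proof.
rewrite /read_d; case: pickP => [d' /andP [/eqP cE /eqP lE]|/(_ d)].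
  by congr (P.2 _); apply: down_tri_inj.
by rewrite !eqxx.
Qed.

Lemma mk_read P : mk_tiling (read_u P) (read_d P) = P.
Proof.
apply: injective_projections; apply/ffunP => x; rewrite ffunE.
  exact: read_uE.
exact: read_dE.
Qed.

Lemma read_mk_u U D c l : (c < l < n)%N -> read_u (mk_tiling U D) c l = U c l.
Proof. by move=> /up_triP [u [<- <-]]; rewrite read_uE ffunE. Qed.

Lemma read_mk_d U D c l : (c <= l < n)%N -> read_d (mk_tiling U D) c l = D c l.
Proof. by move=> /down_triP [d [<- <-]]; rewrite read_dE ffunE. Qed.

Lemma eq_mk_tiling U D U' D' :
  (forall c l, (c < l < n)%N -> U c l = U' c l) ->
  (forall c l, (c <= l < n)%N -> D c l = D' c l) ->
  mk_tiling U D = mk_tiling U' D'.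
Proof.
move=> eU eD; apply: injective_projections; apply/ffunP => x; rewrite !ffunE.
  by apply: eU; rewrite /line_u ltnS leq_addl; apply: (valP x).
by apply: eD; rewrite /line_d leq_addl; apply: (valP x).
Qed.

End TilingLines.

Fixpoint lines_u n : lines n -> nat -> nat -> tile :=
  match n with
  | 0 => fun _ _ _ => TE
  | n'.+1 => fun Q c l =>
      if l == n' then nth TE Q.2.1 c else lines_u Q.1 c l
  end.

Fixpoint lines_d n : lines n -> nat -> nat -> tile :=
  match n with
  | 0 => fun _ _ _ => TE
  | n'.+1 => fun Q c l =>
      if l == n' then nth TE Q.2.2 c else lines_d Q.1 c l
  end.

Fixpoint mk_lines n (U D : nat -> nat -> tile) : lines n :=
  match n with
  | 0 => tt
  | n'.+1 => (mk_lines n' U D,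
              (mktuple (fun c : 'I_n' => U c n'),
               mktuple (fun c : 'I_n'.+1 => D c n')))
  end.

Lemma eq_mk_lines n (U D U' D' : nat -> nat -> tile) :
  (forall c l, (c < l < n)%N -> U c l = U' c l) ->
  (forall c l, (c <= l < n)%N -> D c l = D' c l) ->
  mk_lines n U D = mk_lines n U' D'.
Proof.
elim: n => //= n IH eU eD; congr (_, (_, _)).
- by apply: IH => c l h; [apply: eU | apply: eD]; lia.
- by apply: eq_mktuple => c; apply: eU; rewrite ltn_ord /=.
- by apply: eq_mktuple => c; apply: eD; rewrite -ltnS ltn_ord /=.
Qed.

Lemma mk_linesK n (Q : lines n) : mk_lines n (lines_u Q) (lines_d Q) = Q.
Proof.
elim: n Q => [|n IH] /= => [[] //|[Q [us ds]]] /=; congr (_, (_, _)).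
- rewrite -[RHS]IH; apply: eq_mk_lines => c l h; rewrite /= ifN //; lia.
- by apply: eq_from_tnth => c; rewrite tnth_mktuple eqxx -tnth_nth.
- by apply: eq_from_tnth => c; rewrite tnth_mktuple eqxx -tnth_nth.
Qed.

Lemma lines_mk_u n U D c l : (c < l < n)%N -> lines_u (mk_lines n U D) c l = U c l.
Proof.
elim: n => [|n IH] h; first by lia.
rewrite /=; case: eqP => [ln|/eqP ln]; last by apply: IH; lia.
have cn : (c < n)%N by lia.
have := nth_mktuple (fun c : 'I_n => U c n) TE (Ordinal cn).
by rewrite /= ln.
Qed.

Lemma lines_mk_d n U D c l : (c <= l < n)%N -> lines_d (mk_lines n U D) c l = D c l.
Proof.
elim: n => [|n IH] h; first by lia.
rewrite /=; case: eqP => [ln|/eqP ln]; last by apply: IH; lia.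
have cn : (c < n.+1)%N by lia.
have := nth_mktuple (fun c : 'I_n.+1 => D c n) TE (Ordinal cn).
by rewrite /= ln.
Qed.

Lemma big_tiling (V : nmodType) n (G : tiling n -> V) :
  \sum_(P : tiling n) G P =
  \sum_(Q : lines n) G (mk_tiling n (lines_u Q) (lines_d Q)).
Proof.
rewrite (reindex (fun Q : lines n => mk_tiling n (lines_u Q) (lines_d Q))) //.
exists (fun P => mk_lines n (read_u P) (read_d P)) => [Q|P] _.
  rewrite -[RHS]mk_linesK; apply: eq_mk_lines => c l h.
    exact: read_mk_u.
  exact: read_mk_d.
rewrite -[RHS]mk_read; apply: eq_mk_tiling => c l h.
  exact: lines_mk_u.
exact: lines_mk_d.
Qed.

(** The line is read from an arbitrary column [m], so that the induction can drop its first
    lozenge. *)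
Lemma oklineP b h l m (U D : nat -> tile) (S : nat -> state) :
  okline b h [seq U c | c <- iota m l] [seq D c | c <- iota m l.+1]
    [seq S c | c <- iota m l.+1] <->
  [/\ edge_b (D m) = b, edge_h (D (m + l)%N) = h,
     forall c, (m <= c <= m + l)%N -> D c <> TK /\ edge_a (D c) = S c &
     forall c, (m <= c < m + l)%N ->
        edge_h (U c) = edge_h (D c) /\ edge_b (U c) = edge_b (D c.+1)].
Proof.
have nK d : reflect (d <> TK) (if d is TK then false else true).
  by case: d; constructor.
elim: l m b => [|l IH] m b.
  rewrite /= /ends addn0; split.
    move=> /and4P [/eqP eh /eqP eb /eqP ea /nK nd]; split=> // c h'.
      by have -> : c = m by lia.
    by exfalso; lia.
  case=> eb eh /(_ m) [] //; first by lia.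
  move=> /nK nd ea _; apply/and4P; split=> //; exact/eqP.
have -> : okline b h [seq U c | c <- iota m l.+1] [seq D c | c <- iota m l.+2]
    [seq S c | c <- iota m l.+2] = fits (U m) (D m) b (S m) &&
  okline (edge_b (U m)) h [seq U c | c <- iota m.+1 l]
    [seq D c | c <- iota m.+1 l.+1] [seq S c | c <- iota m.+1 l.+1] by [].
rewrite /fits; split.
  move=> /andP [/and4P [/eqP eh /eqP eb /eqP ea /nK nd]].
  move=> /IH [eb' eh' H1 H2]; rewrite addSnnS in eh'; split=> // c cl.
    by have [->//|cm] := eqVneq c m; apply: H1; lia.
  by have [->//|cm] := eqVneq c m; apply: H2; lia.
case=> eb eh H1 H2.
have [|hm bm] := H2 m; first by lia.
have [|/nK nd am] := H1 m; first by lia.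
apply/andP; split; first by apply/and4P; split=> //; exact/eqP.
apply/IH; rewrite addSnnS; split=> // c cl; [apply: H1 | apply: H2]; lia.
Qed.

Lemma val_mktupleE (T : Type) n (f : nat -> T) :
  mktuple (fun c : 'I_n => f c) = [seq f c | c <- iota 0 n] :> seq T.
Proof. by rewrite /= -val_enum_ord -map_comp. Qed.

(** The conditions on a puzzle sorted by lines: a shared [h]- or [b]-edge joins two triangles of one
    line, a shared [a]-edge two consecutive lines, and the right side of the puzzle consists of the
    [a]-edges of the last line. *)
Definition puzzle_conds (lam nu : nat -> state) (U D : nat -> nat -> tile) n
    (S : nat -> state) : Prop :=
  [/\ forall l, (l < n)%N -> edge_b (D 0 l) = lam l /\ edge_h (D l l) = nu l,
      forall c l, (c <= l < n)%N -> D c l <> TK,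
      forall c l, (c < l < n)%N ->
        edge_h (U c l) = edge_h (D c l) /\ edge_b (U c l) = edge_b (D c.+1 l),
      forall c l, (c <= l)%N -> (l.+1 < n)%N ->
        edge_a (U c l.+1) = edge_a (D c l) &
      forall c, (c < n)%N -> edge_a (D c n.-1) = S c].

Lemma oklinesP lam nu n U D (S : nat -> state) :
  oklines lam nu (mk_lines n U D) [seq S c | c <- iota 0 n] <->
  puzzle_conds lam nu U D n S.
Proof.
elim: n S => [|n IH] S; first by split=> // _; split=> *; lia.
have -> : oklines lam nu (mk_lines n.+1 U D) [seq S c | c <- iota 0 n.+1] =
  okline (lam n) (nu n) [seq U c n | c <- iota 0 n]
    [seq D c n | c <- iota 0 n.+1] [seq S c | c <- iota 0 n.+1] &&
  oklines lam nu (mk_lines n U D) [seq edge_a (U c n) | c <- iota 0 n].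
  rewrite [in RHS](map_comp edge_a (fun c => U c n)).
  by rewrite -(val_mktupleE _ (fun c => U c n)) -(val_mktupleE _ (fun c => D c n)).
split.
  move=> /andP [/oklineP [eb eh H1 H2] /IH [K1 K2 K3 K4 K5]].
  split.
  - by move=> l; rewrite ltnS leq_eqVlt => /orP [/eqP -> | /K1].
  - move=> c l cl; have [->|ln] := eqVneq l n; last by apply: K2; lia.
    by have [|] := H1 c; first lia.
  - move=> c l cl; have [ln|ln] := eqVneq l n; last by apply: K3; lia.
    by subst l; apply: H2; lia.
  - move=> c l cl ln; have [ln'|ln'] := eqVneq l.+1 n; last by apply: K4; lia.
    by rewrite ln' -K5 -?ln' //; lia.
  - by move=> c cn; have [|] := H1 c; first lia.
case=> K1 K2 K3 K4 K5; apply/andP; split.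
  apply/oklineP; have [eb eh] := K1 n (ltnSn n); split=> // c cn.
    by split; [apply: K2; lia | apply: K5; lia].
  by apply: K3; lia.
apply/IH; split.
- by move=> l ln; apply: K1; lia.
- by move=> c l ln; apply: K2; lia.
- by move=> c l ln; apply: K3; lia.
- by move=> c l cl ln; apply: K4; lia.
- move=> c cn; case: n cn K4 {IH K1 K2 K3 K5} => // n cn K4.
  by rewrite K4 //; lia.
Qed.

Definition nat_mem n (A : {set 'I_n}) (l : nat) : bool :=
  oapp (fun i : 'I_n => i \in A) false (insub l).

Lemma nat_memE n (A : {set 'I_n}) (i : 'I_n) : nat_mem A i = (i \in A).
Proof. by rewrite /nat_mem valK. Qed.

Lemma is_puzzleP n (A B C : {set 'I_n}) U D : (0 < n)%N ->
  is_puzzle (mk_tiling n U D) && has_boundary A B C (mk_tiling n U D) <->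
  puzzle_conds (fun l => stb (nat_mem A l)) (fun l => sth (nat_mem C l)) U D n
    (fun l => sta (nat_mem B l)).
Proof.
move=> n0; have dE d : (mk_tiling n U D).2 d = D (col_d d) (line_d d) by rewrite ffunE.
have uE u : (mk_tiling n U D).1 u = U (col_u u) (line_u u) by rewrite ffunE.
split.
  case/andP=> /and4P [/forallP nK /forallP lU /forallP rU /forallP bU].
  case/and3P=> /forallP bl /forallP br /forallP bt.
  split.
  - move=> l ln; have [|d [cd ld]] := @down_triP n 0 l; first lia.
    have [|d' [cd' ld']] := @down_triP n l l; first lia.
    split.
      have := bl d; rewrite cd eqxx dE cd ld /= => /eqP ->.
      rewrite /stb -nat_memE; congr (if nat_mem _ _ then _ else _).
      by move: ld; rewrite /line_d cd addn0.
    have := bt d'; move: (ld'); rewrite /line_d -[RHS]add0n cd' => /eqP.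
    rewrite eqn_add2r => -> /=; rewrite dE ld' cd' => /eqP ->.
    by rewrite -nat_memE cd'.
  - move=> c l cl; have [d [cd ld]] := @down_triP n c l cl.
    by have := nK d; rewrite dE cd ld => /eqP.
  - move=> c l cl; have [u [cu lu]] := @up_triP n c l cl.
    have [|d [cd ld]] := @down_triP n c l; first lia.
    have [|d' [cd' ld']] := @down_triP n c.+1 l; first lia.
    split.
      have /forallP/(_ d) := bU u.
      rewrite uE dE cd ld cu lu /below -!val_eqE /=
        cd cu eqxx andbT.
      move: lu ld; rewrite /line_u /line_d cu cd => lu ld.
      have -> : (row_d d == (row_u u).+1 :> nat) by lia.
    by move=> /eqP.
    have /forallP/(_ d') := rU u.
    rewrite uE dE cd' ld' cu lu /right_of -val_eqE /=
      cd' cu eqxx andbT.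
    move: lu ld'; rewrite /line_u /line_d cu cd' => lu ld'.
    have -> : (row_d d' == row_u u :> nat) by lia.
    by move=> /eqP.
  - move=> c l cl ln; have [|u [cu lu]] := @up_triP n c l.+1; first lia.
    have [|d [cd ld]] := @down_triP n c l; first lia.
    have /forallP/(_ d) := lU u.
    rewrite uE dE cd ld cu lu /left_of -!val_eqE /=
      cd cu eqxx andbT.
    move: lu ld; rewrite /line_u /line_d cu cd => lu ld.
    have -> : (row_d d == row_u u :> nat) by lia.
    by move=> /eqP.
  - move=> c cn; have [|d [cd ld]] := @down_triP n c n.-1; first lia.
    have := br d; rewrite -/(line_d d) dE ld cd prednK // eqxx /= => /eqP ->.
    by rewrite -nat_memE cd.
case=> K1 K2 K3 K4 K5.
have cu_lt (u : up_tri n) : (col_u u < line_u u < n)%N.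
  by rewrite /line_u ltnS leq_addl; apply: (valP u).
have cd_le (d : down_tri n) : (col_d d <= line_d d < n)%N.
  by rewrite /line_d leq_addl; apply: (valP d).
apply/andP; split; [apply/and4P; split | apply/and3P; split]; apply/forallP.
- by move=> d; rewrite dE; apply/eqP/K2.
- move=> u; apply/forallP => d; apply/implyP => /andP [/eqP rr /eqP cc].
  rewrite uE dE; have := cu_lt u; have lE : line_u u = (line_d d).+1.
    by rewrite /line_u /line_d rr cc.
  rewrite lE -cc => /andP [ul ln]; apply/eqP/K4 => //; lia.
- move=> u; apply/forallP => d; apply/implyP => /andP [/eqP rr /eqP cc].
  rewrite uE dE; have lE : line_u u = line_d d.
    by rewrite /line_u /line_d rr cc addnS.
  by rewrite cc -lE; apply/eqP; have [] := K3 _ _ (cu_lt u).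
- move=> u; apply/forallP => d; apply/implyP => /andP [/eqP rr /eqP cc].
  rewrite uE dE; have lE : line_u u = line_d d.
    by rewrite /line_u /line_d rr cc.
  by rewrite cc -lE; apply/eqP; have [] := K3 _ _ (cu_lt u).
- move=> d; apply/implyP => /eqP c0; have /andP [_ ln] := cd_le d.
  rewrite dE c0 (K1 _ ln).1 -nat_memE /stb.
  by have -> : line_d d = row_d d by rewrite /line_d c0 addn0.
- move=> d; apply/implyP => /eqP ld; have ln : line_d d = n.-1.
    by move: ld; rewrite -/(line_d d); lia.
  by have /andP [cl _] := cd_le d; rewrite dE ln K5 ?nat_memE ?ltn_ord.
- move=> d; apply/implyP => /eqP r0; have /andP [_ ln] := cd_le d.
  have lE : line_d d = col_d d by rewrite /line_d r0.
  by rewrite dE lE (K1 _ _).2 ?nat_memE.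
Qed.

(** A lozenge in column c of line l has [nw_edge] c and [ne_edge] l, so the lozenges correspond to
    the pairs c < l and their parameters to the ratios used by the lines. *)
Lemma puzzle_weightE n (v : nat -> laurent n) U D :
  (forall i : 'I_n, v i = lvar i) ->
  puzzle_weight (mk_tiling n U D) = wlines v (mk_lines n U D).
Proof.
move=> vE.
pose F c l : laurent n := lozenge_weight (v c / v l) (U c l) (D c l).
transitivity (\prod_(u : up_tri n) F (nw_edge u) (ne_edge u)).
  apply: eq_bigr => u _.
  have [|d [cd ld]] := @down_triP n (col_u u) (line_u u).
    have ln : (line_u u < n)%N by apply: (valP u).
    by rewrite /line_u; move: ln; rewrite /line_u; lia.
  have rd : row_d d = (row_u u).+1 :> nat.
    by move: ld; rewrite /line_d /line_u cd; lia.
  rewrite (big_pred1 d) => [|d' /=].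
    by rewrite !ffunE /F cd ld -!vE.
  apply/andP/eqP => [[/eqP r /eqP c]|->].
    apply: down_tri_inj; first by rewrite c cd.
    by rewrite /line_d r c rd cd.
  by rewrite rd eqxx; split=> //; apply/eqP/val_inj.
transitivity (\prod_(l < n) \prod_(c < n | (c < l)%N) F c l).
  rewrite pair_big_dep /=.
  pose h (u : up_tri n) := (ne_edge u, nw_edge u).
  have hI : injective h.
    move=> u u' e; apply: up_tri_inj.
      exact: (congr1 (fun p => val p.2) e).
    exact: (congr1 (fun p => val p.1) e).
  rewrite [RHS](reindex_omap h (fun p => [pick u | h u == p])) /=.
    apply: eq_big => // u; case: pickP => [u' /eqP /hI ->|/(_ u)].
      by rewrite eqxx andbT /nw_edge /ne_edge /= ltnS leq_addl.
    by rewrite eqxx.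
  move=> [l c] /= cl; case: pickP => [u /eqP //= ->//|].
  have [|u [cu lu]] := @up_triP n c l; first by rewrite cl ltn_ord.
  move=> /(_ u) /eqP [].
  by congr (_, _); apply: val_inj.
have -> : \prod_(l < n) \prod_(c < n | (c < l)%N) F c l =
    \prod_(0 <= l < n) \prod_(0 <= c < l) F c l.
  rewrite big_mkord; apply: eq_bigr => l _.
  rewrite -(big_mkord (fun c => (c < l)%N) (fun c => F c l)).
  rewrite [RHS](big_nat_widen 0 l n xpredT) 1?ltnW //.
(* Used with [j = 1]: the surplus down-pointing tile is the one on the top side, which belongs to no
   lozenge. *)
have wlineE (x : laurent n) m l j (f g : nat -> tile) :
    wline (map v (iota m l)) x [seq f c | c <- iota m l]
      [seq g c | c <- iota m (l + j)] =
    \prod_(m <= c < m + l) lozenge_weight (v c / x) (f c) (g c).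
  elim: l m => [|l IH] m; first by rewrite addn0 big_geq //=; case: j => [|[]].
  by rewrite big_ltn -?addSnnS ?leq_addr //= IH.
suff key m : \prod_(0 <= l < m) \prod_(0 <= c < l) F c l =
    wlines v (mk_lines m U D) by [].
elim: m => [|m IH]; first by rewrite big_geq.
rewrite big_nat_recr //= mulrC IH; congr (_ * _).
rewrite -[RHS]/(wline _ _ (mktuple (fun c : 'I_m => U c m))
  (mktuple (fun c : 'I_m.+1 => D c m))).
rewrite (val_mktupleE _ (fun c => U c m)) (val_mktupleE _ (fun c => D c m)).
by rewrite -[m.+1]addn1 wlineE.
Qed.

Lemma frame_funE (R : comUnitRingType) n (v : 'I_n -> R) (A B C : {set 'I_n})
    (w : nat -> R) (lam nu mu : nat -> state) :
  (forall i : 'I_n, w i = v i) -> (forall i : 'I_n, lam i = stb (i \in A)) ->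
  (forall i : 'I_n, nu i = sth (i \in C)) ->
  (forall i : 'I_n, mu i = sta (i \in B)) ->
  frame_fun v A B C =
  partition_fun (nat_lines w lam nu n) [seq mu l | l <- iota 0 n].
Proof.
move=> wE lamE nuE muE; rewrite /frame_fun /nat_lines -val_enum_ord -!map_comp.
by congr (partition_fun (rev _) _); apply: eq_map => i /=; rewrite ?wE ?lamE ?nuE ?muE.
Qed.

Definition nat_val (R : pzRingType) n (v : 'I_n -> R) (l : nat) : R :=
  oapp v 1 (insub l).

Lemma nat_valE (R : pzRingType) n (v : 'I_n -> R) (i : 'I_n) : nat_val v i = v i.
Proof. by rewrite /nat_val valK. Qed.

Lemma puzzle_sumE n (A B C : {set 'I_n}) : (0 < n)%N ->
  puzzle_sum A B C = frame_fun (@lvar n) A B C.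
Proof.
move=> n0; rewrite /puzzle_sum big_mkcond big_tiling.
rewrite (@frame_funE _ _ _ _ _ _ (nat_val (@lvar n)) (fun l => stb (nat_mem A l))
  (fun l => sth (nat_mem C l)) (fun l => sta (nat_mem B l))); first 1 last.
all: try by move=> i; rewrite ?nat_valE ?nat_memE.
rewrite partition_funE; apply: eq_bigr => Q _.
rewrite (puzzle_weightE _ _ (nat_valE (@lvar n))) mk_linesK.
congr (if _ then _ else _); apply/idP/idP.
  by move/(is_puzzleP _ _ _ _ _ n0)/oklinesP; rewrite mk_linesK.
rewrite -[Q in oklines _ _ Q]mk_linesK.
by move/oklinesP/(is_puzzleP _ _ _ _ _ n0).
Qed.

(** * Change of the coefficient ring *)

Section Morphism.
Variables (R S : comUnitRingType) (phi : {rmorphism R -> S}).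

Lemma rmorph_vertex w a b a' b' :
  phi (vertex w a b a' b') = vertex (phi w) a b a' b'.
Proof.
rewrite rmorph_sum; apply: eq_bigr => u _; case: ifP => _; last exact: rmorph0.
rewrite rmorph_sum; apply: eq_bigr => d _; case: ifP => _; last exact: rmorph0.
by case: u; case: d; rewrite /= ?rmorphB ?rmorphN ?rmorph1.
Qed.

Lemma rmorph_cap h b a : phi (cap R h b a) = cap S h b a.
Proof.
rewrite rmorph_sum; apply: eq_bigr => d _.
by case: ifP => _; rewrite ?rmorph0 ?rmorph1.
Qed.

Lemma rmorph_line ys y h b F s : y \is a GRing.unit ->
  phi (line ys y h b F s) = line (map phi ys) (phi y) h b (phi \o F) s.
Proof.
move=> uy; elim: ys b F s => [|x ys IH] b F [|a s] /=; rewrite ?rmorph0 //.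
  by case: s => [|? ?]; rewrite ?rmorph0 // rmorphM rmorph_cap.
rewrite rmorph_sum; apply: eq_bigr => e _; rewrite rmorph_sum.
by apply: eq_bigr => c _; rewrite rmorphM rmorph_vertex IH rmorph_div.
Qed.

Lemma rmorph_partition_fun (D : seq (R * state * state)) s :
  all (fun x => x.1.1 \is a GRing.unit) D ->
  phi (partition_fun D s) =
  partition_fun [seq (phi x.1.1, x.1.2, x.2) | x <- D] s.
Proof.
elim: D s => [|[[y b] h] D IH] s /=; first by rewrite rmorph_nat.
case/andP=> uy uD; rewrite rmorph_line // map_rev -!map_comp.
by apply: eq_line => t _; apply: IH.
Qed.

(** Meant for the exchange of y_i and y_(i+1): on a partition function it only permutes the
    parameters. *)
Lemma rmorph_frame_fun n (v : 'I_n -> R) A B C :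
  (forall i, v i \is a GRing.unit) ->
  phi (frame_fun v A B C) = frame_fun (phi \o v) A B C.
Proof.
move=> uv; rewrite rmorph_partition_fun; last first.
  by rewrite all_rev all_map; apply/allP => i _ /=.
by rewrite /frame_fun map_rev -map_comp.
Qed.

End Morphism.

(** * Puzzles with the full rectangle on top *)

Section TopFrame.
Variable R : comUnitRingType.
Implicit Types (F : seq state -> R) (ys : seq R) (y w : R).

Lemma vertex_G w e b a : a \in [:: st0; stG] ->
  vertex w e b a st0 = ((e == a) && (b == st0))%:R.
Proof.
rewrite !inE /vertex !big_cons !big_nil => /orP [] /eqP ->.
all: by case: e => [[] []]; case: b => [[] []]; rewrite /= ?addr0 ?add0r.
Qed.

Lemma vertex_R w b a c : b \in [:: st0; stR] ->
  vertex w st0 b a c = ((a == st0) && (c == b))%:R.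
Proof.
rewrite !inE /vertex !big_cons !big_nil => /orP [] /eqP ->.
all: by case: a => [[] []]; case: c => [[] []]; rewrite /= ?addr0 ?add0r.
Qed.

Lemma cap_G b a : a \in [:: st0; stG] ->
  cap R stG b a = ((b == st0) && (a == stG))%:R.
Proof.
rewrite !inE /cap !big_cons !big_nil => /orP [] /eqP ->.
all: by case: b => [[] []]; rewrite /= ?addr0 ?add0r.
Qed.

Lemma cap_R b a : b \in [:: st0; stR] ->
  cap R stR b a = ((b == stR) && (a == st0))%:R.
Proof.
rewrite !inE /cap !big_cons !big_nil => /orP [] /eqP ->.
all: by case: a => [[] []]; rewrite /= ?addr0 ?add0r.
Qed.

(** The line is frozen from its top end: the cap forces [st0] before it, and [vertex_G] propagates
    [st0] back to the left side without changing the lines that are crossed. *)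
Lemma line_G ys y b F t a : size t = size ys ->
  {subset rcons t a <= [:: st0; stG]} ->
  line ys y stG b F (rcons t a) = ((b == st0) && (a == stG))%:R * F t.
Proof.
elim: ys b F t => [|x ys IH] b F [|a' t] //= => [_|[szt]] sub.
  by rewrite cap_G // sub ?mem_head.
have sub' : {subset rcons t a <= [:: st0; stG]}.
  by move=> c ct; apply: sub; rewrite inE ct orbT.
under eq_bigr do under eq_bigr do rewrite IH //.
rewrite sum_stsE (bigD1 a') //= sum_stsE (bigD1 st0) //=.
rewrite vertex_G ?sub ?mem_head // eqxx /=.
rewrite big1 => [|c /negPf c0]; last by rewrite c0 mul0r mulr0.
rewrite big1 => [|e /negPf ea].
  by rewrite !addr0 mulrA -natrM mulnb.
rewrite sum_stsE (bigD1 st0) //= vertex_G ?sub ?mem_head // ea mul0r add0r.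
by rewrite big1 => // c /negPf c0; rewrite c0 mul0r mulr0.
Qed.

(** The line is frozen from its left end: the lines before it are all in state [st0], so by
    [vertex_R] the state [b] reaches the cap unchanged and has to be [stR] there. *)
Lemma line_R ys y b F s : b \in [:: st0; stR] ->
  (forall t, t != nseq (size ys) st0 -> F t = 0) ->
  line ys y stR b F s =
  ((b == stR) && (s == nseq (size ys).+1 st0))%:R * F (nseq (size ys) st0).
Proof.
move=> bP; elim: ys F s => [|x ys IH] F [|a s] //= F0; rewrite ?andbF ?mul0r //.
  by case: s => [|a' s]; rewrite ?eqseq_cons ?andbF ?mul0r // cap_R // andbT.
rewrite sum_stsE (bigD1 st0) //= [X in _ + X]big1 ?addr0; last first.
  move=> e e0; apply: big1 => c _.
  rewrite (eq_line _ _ _ _ (G := fun _ => 0 * 0)).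
    by rewrite lineZ !(mul0r, mulr0).
  move=> t _; rewrite mul0r; apply: F0.
  by rewrite eqseq_cons (negPf e0).
rewrite sum_stsE (bigD1 b) //= big1 ?addr0 => [|c /negPf cb].
  rewrite vertex_R // eqxx andbT IH => [|t t0]; last first.
    by apply: F0; rewrite eqseq_cons negb_and t0 orbT.
  rewrite mulrA -natrM mulnb eqseq_cons; congr ((_ : bool)%:R * _).
  by case: (a == st0); rewrite ?andbF.
by rewrite vertex_R // cb andbF mul0r.
Qed.

Variables (v : nat -> R) (lam nu : nat -> state) (m : nat).
Hypothesis lamP : forall l, lam l \in [:: st0; stR].
Hypothesis nuE : forall l, nu l = sth (m <= l)%N.

Lemma partition_fun_R l s : (l <= m)%N ->
  partition_fun (nat_lines v lam nu l) s =
  (all (fun i => lam i == stR) (iota 0 l) && (s == nseq l st0))%:R.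
Proof.
elim: l s => [|l IH] s lm //.
have szl : size (rev [seq x.1.1 | x <- nat_lines v lam nu l]) = l.
  by rewrite size_rev size_map size_rev size_map size_iota.
have iS : iota 0 l.+1 = iota 0 l ++ [:: l] by rewrite -addn1 iotaD.
rewrite iS all_cat nat_linesS /= nuE leqNgt lm /= line_R // szl => [|t t0].
  rewrite IH ?(ltnW lm) // eqxx andbT -natrM mulnb.
  by rewrite andbT andbAC [_ && all _ _]andbC.
by rewrite IH ?(ltnW lm) // (negPf t0) andbF.
Qed.

Lemma partition_fun_top l s : size s = l -> {subset s <= [:: st0; stG]} ->
  partition_fun (nat_lines v lam nu l) s =
  (all (fun i => lam i == stb (m <= i)%N) (iota 0 l) &&
   (s == [seq sta (m <= i)%N | i <- iota 0 l]))%:R.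
Proof.
elim: l s => [|l IH] s szs sub.
  by rewrite partition_fun_R.
case: (ltnP l m) => lm.
  rewrite partition_fun_R //; congr (((_ : bool) && (_ : bool))%:R).
    apply: eq_in_all => i; rewrite mem_iota => il.
    by rewrite leqNgt; have -> : (i < m)%N by lia.
  set r := map _ _; have -> : r = nseq (size r) st0; last first.
    by rewrite size_map size_iota.
  apply/all_pred1P; rewrite all_map; apply/allP => i; rewrite mem_iota => il /=.
  by rewrite leqNgt; have -> : (i < m)%N by lia.
case/lastP: s szs sub => [//|t a]; rewrite size_rcons => -[szt] sub.
have iS : iota 0 l.+1 = iota 0 l ++ [:: l] by rewrite -addn1 iotaD.
rewrite iS all_cat map_cat nat_linesS /= nuE lm line_G //; last first.
  by rewrite size_rev size_map size_rev size_map size_iota.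
rewrite IH // => [|c ct]; last by apply: sub; rewrite mem_rcons inE ct orbT.
rewrite -natrM mulnb andbT cats1 eqseq_rcons; congr ((_ : bool)%:R).
by rewrite andbACA [(_ == _) && all _ _]andbC [(a == _) && _]andbC.
Qed.

End TopFrame.

Lemma frame_fun_top (R : comUnitRingType) n k (v : 'I_n -> R) (A B : {set 'I_n}) :
  frame_fun v A B (top_frame k n) =
  ((A == top_frame k n) && (B == top_frame k n))%:R.
Proof.
rewrite (@frame_funE _ _ _ _ _ _ (nat_val v) (fun l => stb (nat_mem A l))
  (fun l => sth (n - k <= l)%N) (fun l => sta (nat_mem B l))); first last.
all: try by move=> i; rewrite ?nat_valE ?nat_memE ?inE.
rewrite (@partition_fun_top _ _ _ _ (n - k)%N) //; first last.
- by move=> c /mapP [l _ ->]; case: nat_mem.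
- by rewrite size_map size_iota.
- by move=> l; case: nat_mem.
have memE (X : {set 'I_n}) : (X == top_frame k n) =
    all (fun i => nat_mem X i == (n - k <= i)%N) (iota 0 n).
  apply/eqP/allP => [-> l|h].
    rewrite mem_iota add0n => /= ln.
    by rewrite -[l]/(val (Ordinal ln)) nat_memE inE.
  apply/setP => i; have := h i; rewrite mem_iota ltn_ord => /(_ isT) /eqP.
  by rewrite nat_memE inE.
rewrite !memE; congr (((_ : bool) && (_ : bool))%:R).
  by apply: eq_all => l; case: nat_mem; case: leq.
have staI : injective sta by case; case.
apply/eqP/allP => [/eq_in_map h l /h /staI -> //|h].
by apply/eq_in_map => l /h /eqP ->.
Qed.

(** * Dual Grothendieck polynomials *)

(** The claim of [Dop2_sym_l] with denominators cleared, for [a], [b], [c] = y_i, y_j, y_l; [f],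
    [f1], [f2] are the conjugates of f that occur. [dop2_eq_r] serves [Dop2_sym_r] in the same
    way. *)
Lemma dop2_eq_l (R : comNzRingType) (a b c f f1 f2 g h tg stg sh : R) :
  (a - b) * g = a * f - b * f1 -> (a - c) * tg = a * f - c * f2 ->
  (b - c) * h = b * g - c * tg -> (b - c) * stg = b * f1 - c * f2 ->
  (a - c) * sh = a * g - c * stg ->
  (a - b) * ((b - c) * ((a - c) * sh)) = (a - b) * ((b - c) * ((a - c) * h)).
Proof.
move=> gE tgE hE stgE ->.
have -> : (a - b) * ((b - c) * (a * g - c * stg)) =
  (b - c) * a * ((a - b) * g) - (a - b) * c * ((b - c) * stg) by ring.
have -> : (a - b) * ((b - c) * ((a - c) * h)) =
  (a - b) * ((a - c) * ((b - c) * h)) by ring.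
rewrite hE gE stgE.
have -> : (a - b) * ((a - c) * (b * g - c * tg)) =
  (a - c) * b * ((a - b) * g) - (a - b) * c * ((a - c) * tg) by ring.
by rewrite gE tgE; ring.
Qed.

Lemma dop2_eq_r (R : comNzRingType) (a b c f f1 f2 g h sg tsg th : R) :
  (b - c) * g = b * f - c * f1 -> (a - c) * sg = a * f - c * f2 ->
  (a - b) * h = a * g - b * sg -> (a - b) * tsg = a * f1 - b * f2 ->
  (a - c) * th = a * g - c * tsg ->
  (a - b) * ((b - c) * ((a - c) * th)) = (a - b) * ((b - c) * ((a - c) * h)).
Proof.
move=> gE sgE hE tsgE ->.
have -> : (a - b) * ((b - c) * (a * g - c * tsg)) =
  (a - b) * a * ((b - c) * g) - (b - c) * c * ((a - b) * tsg) by ring.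
have -> : (a - b) * ((b - c) * ((a - c) * h)) =
  (b - c) * ((a - c) * ((a - b) * h)) by ring.
rewrite hE gE tsgE.
have -> : (b - c) * ((a - c) * (a * g - b * sg)) =
  (a - c) * a * ((b - c) * g) - (b - c) * b * ((a - c) * sg) by ring.
by rewrite gE sgE; ring.
Qed.

(** * Divided differences and braiding *)

Section GrothExchange.
Variables k n : nat.
Hypothesis kn : (k <= n)%N.
Implicit Types (f g : laurent (k + n)) (i j : 'I_n) (A B : {set 'I_n}).
Local Notation yvar := (@yvar k n).
Local Notation xvar := (@xvar k n).

Lemma ysubst_comp (s t : 'I_n -> 'I_n) f :
  ysubst s (ysubst t f) = ysubst (s \o t) f.
Proof.
rewrite /ysubst rename_comp; apply: eq_rename => x /=.
by rewrite -[x]splitK; case: (split x) => a /=; rewrite ?xy_index_l ?xy_index_r.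
Qed.

Lemma eq_ysubst (s t : 'I_n -> 'I_n) f : s =1 t -> ysubst s f = ysubst t f.
Proof.
move=> st; apply: eq_rename => x.
by rewrite -[x]splitK; case: (split x) => a /=; rewrite ?xy_index_l ?xy_index_r ?st.
Qed.

Lemma ysubst_id f : ysubst id f = f.
Proof.
by apply: (xy_ext (phi := ysubst id) (psi := idfun)) => a;
  rewrite /= ?ysubst_x ?ysubst_y.
Qed.

Lemma ysubst_tpermK i j : involutive (ysubst (tperm i j) : laurent (k + n) -> _).
Proof.
move=> f; rewrite ysubst_comp -[RHS]ysubst_id; apply: eq_ysubst => x /=.
by rewrite tpermK.
Qed.

Lemma tperm_braid i j l : i != j -> j != l -> i != l ->
  tperm i j \o (tperm j l \o tperm i j) =1 tperm j l \o (tperm i j \o tperm j l).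
Proof.
move=> ij jl il x /=.
have -> : tperm i j (tperm j l (tperm i j x)) = (tperm j l ^ tperm i j)%g x.
  by rewrite conjgE tpermV !permM.
have -> : tperm j l (tperm i j (tperm j l x)) = (tperm i j ^ tperm j l)%g x.
  by rewrite conjgE tpermV !permM.
have e1 : tperm i j l = l by rewrite tpermD.
have e2 : tperm j l i = i by rewrite tpermD // eq_sym.
by rewrite !tpermJ tpermR tpermL e1 e2.
Qed.

Lemma Dop_sym i j f : i != j -> ysubst (tperm i j) (Dop i j f) = Dop i j f.
Proof.
move=> ij; apply: (mulfI (yvarB_neq0 k ij)); rewrite DopE.
have := congr1 (ysubst (tperm i j)) (DopE i j f).
rewrite !(rmorphM, rmorphB) /= ysubst_tpermK !ysubst_y tpermL tpermR => e.
by rewrite -opprB mulNr e opprB.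
Qed.


(** Since D_jl f = f, the braid relation would turn D_jl D_ij f into D_ij D_jl D_ij f, which is
    symmetric in y_i and y_j. This instance is verified directly. *)
Lemma Dop2_sym_l i j l f : i != j -> j != l -> i != l ->
  ysubst (tperm j l) f = f ->
  ysubst (tperm i j) (Dop j l (Dop i j f)) = Dop j l (Dop i j f).
Proof.
move=> ij jl il fs; pose s := ysubst (tperm i j) : laurent (k + n) -> laurent (k + n).
pose t := ysubst (tperm j l) : laurent (k + n) -> laurent (k + n).
pose f1 := s f; pose f2 := t f1.
(* s t s f = t s t f = t s f, because t f = f. *)
have sf2 : ysubst (tperm i j) f2 = f2.
  rewrite /f2 /f1 -{2}fs /s /t !ysubst_comp.
  exact: (eq_ysubst _ (tperm_braid ij jl il)).
set g := Dop i j f; set h := Dop j l g.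
have gE : (yvar i - yvar j) * g = yvar i * f - yvar j * f1 by apply: DopE.
have tgE : (yvar i - yvar l) * t g = yvar i * f - yvar l * f2.
  have := congr1 (ysubst (tperm j l)) gE.
  rewrite !(rmorphM, rmorphB) /= /t !ysubst_y fs tpermL.
  by rewrite tpermD // eq_sym.
have hE : (yvar j - yvar l) * h = yvar j * g - yvar l * t g by apply: DopE.
have sgE := Dop_sym f ij; rewrite -/g in sgE.
have stgE : (yvar j - yvar l) * s (t g) = yvar j * f1 - yvar l * f2.
  have := congr1 (ysubst (tperm i j)) tgE.
  rewrite !(rmorphM, rmorphB) /= sf2 /s !ysubst_y tpermL.
  by rewrite tpermD // eq_sym.
have shE : (yvar i - yvar l) * s h = yvar i * g - yvar l * s (t g).
  have := congr1 (ysubst (tperm i j)) hE.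
  rewrite !(rmorphM, rmorphB) /= sgE /s !ysubst_y tpermR.
  by rewrite tpermD // eq_sym.
apply: (mulfI (yvarB_neq0 k il)); apply: (mulfI (yvarB_neq0 k jl)).
by apply: (mulfI (yvarB_neq0 k ij)); apply: dop2_eq_l gE tgE hE stgE shE.
Qed.

Lemma Dop2_sym_r i j l f : i != j -> j != l -> i != l ->
  ysubst (tperm i j) f = f ->
  ysubst (tperm j l) (Dop i j (Dop j l f)) = Dop i j (Dop j l f).
Proof.
move=> ij jl il fs; pose s := ysubst (tperm i j) : laurent (k + n) -> laurent (k + n).
pose t := ysubst (tperm j l) : laurent (k + n) -> laurent (k + n).
pose f1 := t f; pose f2 := s f1.
have tf2 : ysubst (tperm j l) f2 = f2.
  rewrite /f2 /f1 -[in RHS]fs /s /t !ysubst_comp; symmetry.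
  exact: (eq_ysubst _ (tperm_braid ij jl il)).
set g := Dop j l f; set h := Dop i j g.
have gE : (yvar j - yvar l) * g = yvar j * f - yvar l * f1 by apply: DopE.
have sgE : (yvar i - yvar l) * s g = yvar i * f - yvar l * f2.
  have := congr1 (ysubst (tperm i j)) gE.
  rewrite !(rmorphM, rmorphB) /= /s !ysubst_y fs tpermR.
  by rewrite tpermD // eq_sym.
have hE : (yvar i - yvar j) * h = yvar i * g - yvar j * s g by apply: DopE.
have tgE := Dop_sym f jl; rewrite -/g in tgE.
have tsgE : (yvar i - yvar j) * t (s g) = yvar i * f1 - yvar j * f2.
  have := congr1 (ysubst (tperm j l)) sgE.
  rewrite !(rmorphM, rmorphB) /= tf2 /t !ysubst_y tpermR.
  by rewrite tpermD // eq_sym.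
have thE : (yvar i - yvar l) * t h = yvar i * g - yvar l * t (s g).
  have := congr1 (ysubst (tperm j l)) hE.
  rewrite !(rmorphM, rmorphB) /= tgE /t !ysubst_y tpermL.
  by rewrite tpermD // eq_sym.
apply: (mulfI (yvarB_neq0 k il)); apply: (mulfI (yvarB_neq0 k jl)).
by apply: (mulfI (yvarB_neq0 k ij)); apply: dop2_eq_r gE sgE hE tsgE thE.
Qed.

End GrothExchange.

Lemma swap_setE n (A : {set 'I_n}) (i j : 'I_n) : j \in A -> i \notin A ->
  swap_set i j A = i |: (A :\ j).
Proof.
move=> jA iA; apply/setP=> x; rewrite !inE.
have [->|xi] := eqVneq x i; first by rewrite tpermL jA.
have [->|xj] := eqVneq x j; first by rewrite tpermR (negPf iA).
by rewrite tpermD // eq_sym.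
Qed.

Lemma mem_swap_setD n (A : {set 'I_n}) (i j x : 'I_n) : x != i -> x != j ->
  (x \in swap_set i j A) = (x \in A).
Proof. by move=> xi xj; rewrite inE tpermD // eq_sym. Qed.

Lemma swap_set_id n (A : {set 'I_n}) (i j : 'I_n) :
  (i \in A) = (j \in A) -> swap_set i j A = A.
Proof.
move=> ijA; apply/setP => x; rewrite inE.
by case: tpermP => [->|->|].
Qed.

Lemma swap_setC n (A : {set 'I_n}) (i j : 'I_n) : swap_set j i A = swap_set i j A.
Proof. by apply/setP => x; rewrite !inE tpermC. Qed.

Lemma succ_neq n (i j : 'I_n) : j = i.+1 :> nat -> i != j.
Proof. by move=> ji; rewrite -val_eqE /= ji neq_ltn ltnSn. Qed.

(** The number of boxes of the diagram, up to an additive constant; it measures all the inductions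
    below. *)
Definition frame_sum n (A : {set 'I_n}) : nat := \sum_(x in A) x.

Lemma frame_sum_raise n (A : {set 'I_n}) (i j : 'I_n) : j = i.+1 :> nat ->
  i \in A -> j \notin A -> frame_sum (swap_set i j A) = (frame_sum A).+1.
Proof.
move=> ji iA jA; rewrite swap_setC swap_setE // /frame_sum (big_setD1 i iA) /=.
by rewrite big_setU1 ?ji //= !inE negb_and jA orbT.
Qed.

Lemma frame_sum_swap_le n (A : {set 'I_n}) (i j : 'I_n) : j = i.+1 :> nat ->
  (frame_sum A <= (frame_sum (swap_set i j A)).+1)%N.
Proof.
move=> ji; have [ijA|ijA] := eqVneq (i \in A) (j \in A).
  by rewrite swap_set_id.
case: (boolP (i \in A)) ijA => iA; case: (boolP (j \in A)) => jA // _.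
  by rewrite frame_sum_raise // leqW.
have := @frame_sum_raise n (swap_set i j A) i j ji.
by rewrite swap_setl swap_setr swap_setK => /(_ jA iA) ->.
Qed.

Lemma frame_sum_le n (A : {set 'I_n}) : (frame_sum A <= n * n)%N.
Proof.
apply: leq_trans (_ : \sum_(x in A) n <= _)%N.
  by apply: leq_sum => x _; apply: ltnW.
rewrite sum_nat_const leq_mul2r; apply/orP; right.
by rewrite -[X in (_ <= X)%N](card_ord n) max_card.
Qed.

Lemma swap_eq (R : comNzRingType) (b c f g h : R) :
  (c * b - b) * g = c * b * f - b * h -> b * h = b * (c * f + (1 - c) * g).
Proof.
move=> e; have -> : b * (c * f + (1 - c) * g) = c * b * f - (c * b - b) * g by ring.
by rewrite e; ring.
Qed.

(** * Action of a transposition on the Grothendieck polynomials *)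

Section Groth.
Variables k n : nat.
Hypothesis kn : (k <= n)%N.
Implicit Types (f g : laurent (k + n)) (i j : 'I_n) (A B : {set 'I_n}).
Local Notation yvar := (@yvar k n).
Local Notation xvar := (@xvar k n).
Local Notation groth := (@groth k n).

Lemma groth_lower A i j : #|A| = k -> j = i.+1 :> nat ->
  i \in A -> j \notin A -> groth A = Dop i j (groth (swap_set i j A)).
Proof.
move=> cA ji iA jA; rewrite -{1}(swap_setK i j A) swap_setE ?groth_step //.
all: by rewrite ?card_swap_set ?swap_setl ?swap_setr.
Qed.

(* When i, i + 1 are adjacent to the lowered position, braiding moves the symmetry
   in y_i, y_(i+1) to a symmetry of a polynomial two steps higher. *)
Lemma groth_sym A i j : #|A| = k -> j = i.+1 :> nat -> (i \in A) = (j \in A) ->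
  ysubst (tperm i j) (groth A) = groth A.
Proof.
have [N] := ubnP (n * n - frame_sum A)%N; elim: N A i j => // N IH A i j AN cA ji ijA.
have [At|nA] := eqVneq A (top_frame k n).
  move: ijA; rewrite At !inE groth_topE // => ijA.
  rewrite /groth_top rmorph_prod; apply: eq_bigr => a _; rewrite rmorph_prod /=.
  rewrite [RHS](reindex_inj (@perm_inj _ (tperm i j))) /=; apply: eq_big => [l|l _].
    by case: tpermP => [->|->|] //; rewrite !ltnNge ijA.
  by rewrite rmorphB rmorph1 rmorph_div ?lvar_unit //= ysubst_x ysubst_y.
have [l [m [ml lA mA]]] := raisable kn cA nA.
have raise (D : {set 'I_n}) (c d : 'I_n) : d = c.+1 :> nat -> c \in D -> d \notin D ->
    (n * n - frame_sum (swap_set c d D) < n * n - frame_sum D)%N.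
  move=> dc cD dD; have := frame_sum_raise dc cD dD.
  by have := frame_sum_le (swap_set c d D); lia.
have cB : #|swap_set l m A| = k by rewrite card_swap_set.
have rB := raise A l m ml lA mA.
have lm := succ_neq ml; have ij := succ_neq ji.
rewrite (groth_lower cA ml lA mA).
(* The pair [i], [j] meets the raisable pair [l], [m] in [i = m], in [j = l] or not at all: [i = l]
   would force [j = m], against [ijA]. In the disjoint case the transposition commutes with D_lm. *)
have [im|im] := eqVneq i m.
  subst i; have jl : l != j by rewrite -val_eqE /= ji ml; lia.
  have jB : j \notin swap_set l m A.
    by rewrite mem_swap_setD 1?eq_sym // -ijA (negPf mA).
  have mB : m \in swap_set l m A by rewrite swap_setr.
  rewrite (groth_lower cB ji mB jB); apply: Dop2_sym_r => //.
  apply: IH => //; last 1 first.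
  - by rewrite mem_swap_setD // swap_setl swap_setl (negPf mA) (negPf jB).
  - exact: leq_trans (ltn_trans (raise _ _ _ ji mB jB) rB) AN.
  - by rewrite card_swap_set.
have [jl|jl] := eqVneq j l.
  subst j; have im' : i != m by [].
  have iB : i \in swap_set l m A by rewrite mem_swap_setD // ijA.
  have lB : l \notin swap_set l m A by rewrite swap_setl.
  rewrite (groth_lower cB ji iB lB); apply: Dop2_sym_l => //.
  apply: IH => //; last 1 first.
  - rewrite swap_setr iB mem_swap_setD ?swap_setr ?lA //; first by rewrite eq_sym.
    by rewrite eq_sym.
  - exact: leq_trans (ltn_trans (raise _ _ _ ji iB lB) rB) AN.
  - by rewrite card_swap_set.
have il : i != l.
  apply: contraNneq mA => il; have -> : m = j by apply: val_inj; rewrite /= ml ji il.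
  by rewrite -ijA il.
have jm : j != m.
  by apply: contraNneq il => jm; apply/eqP/val_inj/succn_inj; rewrite -ji -ml jm.
rewrite ysubst_Dop //; last exact: perm_inj.
rewrite !tpermD //; congr Dop; apply: IH => //; first exact: leq_trans rB AN.
by rewrite !mem_swap_setD.
Qed.

(** If only [j] is in [A], the polynomial of the lowered frame is D_i G^A, and the defining equation
    of D_i is solved for the transposed polynomial. If only [i] is in [A], then G^A lies in the
    image of D_i, hence is symmetric. *)
Lemma groth_swap A i j : #|A| = k -> j = i.+1 :> nat ->
  ysubst (tperm i j) (groth A) =
  if (i \notin A) && (j \in A) then
    yvar i / yvar j * groth A + (1 - yvar i / yvar j) * groth (swap_set i j A)
  else groth A.
Proof.
move=> cA ji; case: ifP => [/andP [iA jA]|].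
  have cB : #|swap_set i j A| = k by rewrite card_swap_set.
  have iB : i \in swap_set i j A by rewrite swap_setl.
  have jB : j \notin swap_set i j A by rewrite swap_setr.
  have := DopE i j (groth A).
  rewrite -{1}(swap_setK i j A) -(groth_lower cB ji iB jB).
  have uj : yvar j \is a GRing.unit by apply: lvar_unit.
  rewrite -{1 2}(divrK uj (yvar i)) => e.
  by apply: (mulrI uj); apply: swap_eq e.
case: (boolP (i \in A)) => iA; case: (boolP (j \in A)) => jA // _.
- by apply: groth_sym; rewrite // iA jA.
- by rewrite (groth_lower cA ji iA jA) Dop_sym // succ_neq.
- by apply: groth_sym; rewrite // (negPf iA) (negPf jA).
Qed.

End Groth.

Lemma dual_swap_eq (R : comNzRingType) (x y q g h : R) :
  x * y * (q * g + (1 - q) * h) = x * (q * y) * g + (1 - q) * (x * y * h).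
Proof. by ring. Qed.

(** * Dual polynomials and their values at fixed points *)

Section DualGroth.
Variables k n : nat.
Hypothesis kn : (k <= n)%N.
Implicit Types (f g : laurent (k + n)) (i j : 'I_n) (A B : {set 'I_n}).
Local Notation yvar := (@yvar k n).
Local Notation xvar := (@xvar k n).

Definition rev_set A : {set 'I_n} := [set rev_ord i | i in A].

Lemma mem_rev_set A i : (i \in rev_set A) = (rev_ord i \in A).
Proof.
apply/imsetP/idP => [[l lA ->]|iA]; first by rewrite rev_ordK.
by exists (rev_ord i); rewrite ?rev_ordK.
Qed.

Lemma card_rev_set A : #|rev_set A| = #|A|.
Proof. by rewrite card_imset //; apply: rev_ord_inj. Qed.

Lemma tperm_rev i j l :
  tperm i j (rev_ord l) = rev_ord (tperm (rev_ord j) (rev_ord i) l).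
Proof.
case: (tpermP (rev_ord j) (rev_ord i) l) => [->|->|lj li].
- by rewrite rev_ordK tpermR rev_ordK.
- by rewrite rev_ordK tpermL rev_ordK.
- by rewrite tpermD //; apply/eqP => e; [apply: li | apply: lj];
    rewrite -[l]rev_ordK -e.
Qed.

Lemma rev_swap_set A i j :
  rev_set (swap_set i j A) = swap_set (rev_ord j) (rev_ord i) (rev_set A).
Proof. by apply/setP => l; rewrite mem_rev_set !inE mem_rev_set tperm_rev. Qed.

Lemma succ_rev i j : j = i.+1 :> nat -> rev_ord i = (rev_ord j).+1 :> nat.
Proof. by move=> ji; rewrite /= ji -subSn // -ji. Qed.

Definition yfactor A : laurent (k + n) := \prod_(i in A) (yvar i)^-1.

Lemma ysubst_yfactor A i j :
  ysubst (tperm i j) (yfactor A) = yfactor (swap_set i j A).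
Proof.
rewrite rmorph_prod [RHS](reindex_inj (@perm_inj _ (tperm i j))) /=.
apply: eq_big => [l|l _]; first by rewrite inE tpermK.
by rewrite rmorphV ?lvar_unit //= ysubst_y.
Qed.

Lemma yfactor_swap A i j : j \in A -> i \notin A ->
  yfactor (swap_set i j A) = yvar j / yvar i * yfactor A.
Proof.
move=> jA iA; rewrite swap_setE // /yfactor big_setU1 ?(big_setD1 j jA) /=.
  by rewrite mulrA; congr (_ * _); rewrite mulrAC divrr ?lvar_unit ?mul1r.
by rewrite !inE negb_and iA orbT.
Qed.

(** Reversing the y turns the pair [i], [j] around, and the factor [yfactor] moves the diagonal
    coefficient [q] from the case where only [i] is in [A] to the case where only [j] is. So the
    matrix becomes the one of the crossings. *)
Lemma dual_groth_swap A i j : #|A| = k -> j = i.+1 :> nat ->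
  let q := yvar j / yvar i in
  ysubst (tperm i j) (dual_groth k A) =
  swap_diag q (i \in A) (j \in A) * dual_groth k A +
  swap_off q (i \in A) (j \in A) * dual_groth k (swap_set i j A).
Proof.
move=> cA ji q; rewrite /dual_groth -!/(rev_set _) -!/(yfactor _).
set X := \prod_(a < k) _; set g := ysubst _ (groth k _).
rewrite !rmorphM /= ysubst_yfactor.
have -> : ysubst (tperm i j) X = X.
  by rewrite rmorph_prod; apply: eq_bigr => a _; rewrite /= ysubst_x.
have -> : ysubst (tperm i j) g = ysubst (@rev_ord n)
    (ysubst (tperm (rev_ord j) (rev_ord i)) (groth k (rev_set A))).
  by rewrite !ysubst_comp; apply: eq_ysubst => l /=; rewrite tperm_rev.
rewrite rev_swap_set groth_swap ?card_rev_set //; last exact: succ_rev.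
rewrite !mem_rev_set !rev_ordK.
have uY : yfactor A \is a GRing.unit.
  by apply: rpred_prod => l _; rewrite unitrV lvar_unit.
have ui : yvar i \is a GRing.unit by apply: lvar_unit.
have uj : yvar j \is a GRing.unit by apply: lvar_unit.
rewrite /swap_diag /swap_off.
case: (boolP (i \in A)) => iA; case: (boolP (j \in A)) => jA /=.
- by rewrite mul1r mul0r addr0 swap_set_id // iA jA.
- have qE : ysubst (@rev_ord n) (yvar (rev_ord j) / yvar (rev_ord i)) = q.
    by rewrite rmorph_div ?lvar_unit //= !ysubst_y !rev_ordK.
  have iS : i \notin swap_set i j A by rewrite swap_setl.
  have jS : j \in swap_set i j A by rewrite swap_setr.
  have := yfactor_swap jS iS; rewrite swap_setK -/q => ->.
  rewrite mul1r rmorphD rmorphM [X in _ + X]rmorphM rmorphB rmorph1 /= qE.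
  exact: dual_swap_eq.
- by rewrite mul0r addr0 yfactor_swap // -/q -/g mulrCA -!mulrA.
- by rewrite mul1r mul0r addr0 swap_set_id // (negPf iA) (negPf jA).
Qed.

(** [t] is arbitrary, since composition with a transposition does not preserve increasing maps. *)
Definition restr A (t : 'I_k -> 'I_n) : laurent n :=
  specialize t (dual_groth k A).

(** Exchanging y_i and y_j after the specialization at [t] amounts to exchanging them first and
    specializing at [tperm i j \o t]. *)
Lemma restr_swap A i j (t : 'I_k -> 'I_n) : #|A| = k -> j = i.+1 :> nat ->
  let q := lvar j / lvar i in
  rename (tperm i j) (restr A t) =
  swap_diag q (i \in A) (j \in A) * restr A (tperm i j \o t) +
  swap_off q (i \in A) (j \in A) * restr (swap_set i j A) (tperm i j \o t).
Proof.
move=> cA ji q; have := congr1 (specialize (tperm i j \o t)) (dual_groth_swap cA ji).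
have spy (l : 'I_n) s : specialize s (yvar l) = lvar l.
  by rewrite /specialize rename_lvar -[rshift k l]/(unsplit (inr l)) unsplitK.
have qE s : specialize s (yvar j / yvar i) = q.
  by rewrite rmorph_div ?lvar_unit //= !spy.
have -> : specialize (tperm i j \o t) (ysubst (tperm i j) (dual_groth k A)) =
    rename (tperm i j) (restr A t).
  rewrite /restr /specialize /ysubst !rename_comp; apply: eq_rename => x /=.
  rewrite -[x]splitK; case: (split x) => a /=.
    by rewrite xy_index_l (unsplitK (inl a) : split (lshift n a) = _).
  by rewrite xy_index_r !(unsplitK (inr _) : split (rshift k _) = _).
have dE x y : specialize (tperm i j \o t) (swap_diag (yvar j / yvar i) x y) =
    swap_diag q x y.
  by rewrite /swap_diag; case: ifP => _; [exact: qE | exact: rmorph1].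
have oE x y : specialize (tperm i j \o t) (swap_off (yvar j / yvar i) x y) =
    swap_off q x y.
  rewrite /swap_off; case: ifP => _; last exact: rmorph0.
  by rewrite rmorphB rmorph1 /= qE.
move=> ->; rewrite rmorphD (rmorphM _ (swap_diag _ _ _)).
by rewrite (rmorphM _ (swap_off _ _ _)) /= dE oE.
Qed.

End DualGroth.

(** * Restriction to fixed points *)

Section Restriction.
Variables k n : nat.
Hypothesis kn : (k <= n)%N.
Implicit Types (i j : 'I_n) (A B C : {set 'I_n}) (t : 'I_k -> 'I_n).
Local Notation restr := (@restr k n).
Local Notation top := (top_frame k n).

Lemma lvar_inj m : injective (@lvar m).
Proof.
move=> i j /laurent_poly_inj /(congr1 (fun p => p@_U_(i)))/=.
by rewrite !mcoeffXU eqxx; case: eqP.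
Qed.

Lemma eq_restr A t t' : t =1 t' -> restr A t = restr A t'.
Proof.
move=> e; apply: eq_rename => x.
by case: (split x) => // a; apply: e.
Qed.

Lemma im_swap t i j :
  [set tperm i j (t a) | a in 'I_k] = swap_set i j [set t a | a in 'I_k].
Proof.
apply/setP => x; rewrite inE; apply/imsetP/imsetP => [[a _ ->]|[a _ e]].
  by exists a; rewrite ?tpermK.
by exists a; rewrite // -e tpermK.
Qed.

Lemma im_eq t A : injective t -> #|A| = k -> (forall a, t a \in A) ->
  [set t a | a in 'I_k] = A.
Proof.
move=> tI cA tA; apply/eqP; rewrite eqEcard; apply/andP; split.
  by apply/subsetP => x /imsetP [a _ ->].
by rewrite card_imset // cA card_ord.
Qed.

(** The value of G_A at its own fixed point, with one factor for each box of the rectangle outside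
    the diagram. *)
Definition diag_weight A : laurent n :=
  \prod_(p : 'I_n * 'I_n | [&& p.1 \in A, p.2 \notin A & (p.1 < p.2)%N])
    (1 - lvar p.1 / lvar p.2).

Lemma lvar_ratio_neq1 i j : i != j -> 1 - lvar i / lvar j != 0.
Proof.
move=> ij; rewrite subr_eq0 eq_sym; apply: contra ij => /eqP e; apply/eqP/lvar_inj.
by rewrite -[LHS](divrK (lvar_unit j)) e mul1r.
Qed.

Lemma diag_weight_neq0 A : diag_weight A != 0.
Proof.
apply/prodf_neq0 => -[i j] /= /and3P [_ _ ij]; apply: lvar_ratio_neq1.
by rewrite -val_eqE neq_ltn ij.
Qed.

Lemma diag_weight_top : diag_weight top = 1.
Proof.
by apply: big_pred0 => -[i j] /=; rewrite !inE; apply/negP => /and3P []; lia.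
Qed.

(** As [i] and [j] are neighbours, (i, j) is the only pair whose order is reversed; the other pairs
    of [A] go to the pairs of [swap_set i j A]. *)
Lemma diag_weight_swap A i j : j = i.+1 :> nat -> i \in A -> j \notin A ->
  rename (tperm i j) (diag_weight A) =
  (1 - lvar j / lvar i) * diag_weight (swap_set i j A).
Proof.
move=> ji iA jA; rewrite /diag_weight (bigD1 (i, j)) /=; last first.
  by rewrite iA jA ji ltnSn.
rewrite rmorphM rmorphB rmorph1 rmorph_div ?lvar_unit //= !rename_lvar tpermL tpermR.
congr (_ * _); rewrite rmorph_prod.
pose h (p : 'I_n * 'I_n) := (tperm i j p.1, tperm i j p.2).
have hK : involutive h by case=> x y; rewrite /h /= !tpermK.
rewrite [RHS](reindex_inj (inv_inj hK)) /=; apply: eq_big => [[x y]|[x y] _] /=.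
  rewrite !inE !tpermK xpair_eqE -!andbA.
  case: (boolP (x \in A)) => //= xA; case: (boolP (y \in A)) => //= yA.
  have xj : x != j by apply: contraNneq jA => <-.
  have yi : y != i by apply: contraNneq yA => ->.
  have [xi|xi] := eqVneq x i; have [yj|yj] := eqVneq y j.
  - by rewrite xi yj tpermL tpermR andbF ji ltnNge leqnSn.
  - rewrite xi tpermL tpermD 1?eq_sym // ji; move: yj yi.
    by rewrite -!val_eqE /= ji => *; apply/idP/idP; lia.
  - rewrite yj tpermR [tperm i j x]tpermD 1?eq_sym //; move: xi xj.
    by rewrite -!val_eqE /= ji => *; apply/idP/idP; lia.
  - by rewrite !tpermD 1?eq_sym // andbT.
by rewrite rmorphB rmorph1 rmorph_div ?lvar_unit //= !rename_lvar.
Qed.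

Lemma frame_sum_top A : #|A| = k -> (frame_sum A <= frame_sum top)%N.
Proof.
have [N] := ubnP (n * n - frame_sum A)%N; elim: N A => // N IH A AN cA.
have [->//|nA] := eqVneq A top.
have [i [j [ji iA jA]]] := raisable kn cA nA.
have e := frame_sum_raise ji iA jA; have := frame_sum_le (swap_set i j A).
rewrite e => le; apply: leq_trans (leqnSn _) _; rewrite -e.
by apply: IH; rewrite ?card_swap_set //; lia.
Qed.

(** Here [A] is the empty diagram, whose G_A is explicit because the reversed frame is the full
    rectangle. A value [t a] outside [A] produces the factor 1 - y_(t a)/y_(t a) = 0; at the fixed
    point of [A] the monomials in front cancel. *)
Lemma restr_bottom A t : #|A| = k -> injective t -> rev_set A = top ->
  (restr A t != 0 -> [set t a | a in 'I_k] = A) /\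
  ([set t a | a in 'I_k] = A -> restr A t = diag_weight A).
Proof.
move=> cA tI Atop.
have inA i : (i \in A) = (n - k <= rev_ord i)%N.
  by rewrite -[i]rev_ordK -mem_rev_set Atop inE rev_ordK.
have spx a : specialize t (xvar n a) = lvar (t a).
  by rewrite /specialize rename_lvar (unsplitK (inl a) : split (lshift n a) = _).
have spy l : specialize t (yvar k l) = lvar l.
  by rewrite /specialize rename_lvar (unsplitK (inr l) : split (rshift k l) = _).
have rE : restr A t = \prod_(a < k) lvar (t a) * \prod_(i in A) (lvar i)^-1 *
    \prod_(a < k) \prod_(j | j \notin A) (1 - lvar (t a) / lvar j).
  rewrite /restr /dual_groth -/(rev_set A) Atop groth_topE // !rmorphM /=.
  congr (_ * _ * _).
  - by rewrite rmorph_prod; apply: eq_bigr => a _; apply: spx.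
  - rewrite rmorph_prod; apply: eq_bigr => a _.
    by rewrite rmorphV ?lvar_unit //= spy.
  - rewrite !rmorph_prod; apply: eq_bigr => a _ /=; rewrite !rmorph_prod.
    rewrite [RHS](reindex_inj rev_ord_inj) /=; apply: eq_big => l.
      by rewrite inA rev_ordK -ltnNge.
    move=> _; rewrite !rmorphB !rmorph1 !rmorph_div ?lvar_unit //=.
      by rewrite ysubst_x ysubst_y spx spy.
    by rewrite ysubst_y lvar_unit.
split=> [|tA].
  rewrite rE mulf_eq0 negb_or => /andP [_ /prodf_neq0 nz].
  apply: im_eq => // a; apply: contraT => ta.
  have /prodf_neq0/(_ (t a) ta) := nz a isT.
  by rewrite divrr ?lvar_unit // subrr eqxx.
have prodA (F : 'I_n -> laurent n) : \prod_(a < k) F (t a) = \prod_(i in A) F i.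
  by rewrite -tA big_imset //= => x y _ _ /tI.
rewrite rE !prodA (prodA (fun i => \prod_(j | j \notin A) (1 - lvar i / lvar j))).
rewrite -big_split /= big1 ?mul1r => [|i _]; last by rewrite divrr ?lvar_unit.
rewrite pair_big_dep /diag_weight; apply: eq_bigl => -[i j] /=.
rewrite !inA /= -ltnNge; apply/andP/and3P => [[iA jA]|[iA jA _]]; split=> //.
by lia.
Qed.

(** [restr_swap] for the smaller diagram [swap_set i j A] at [tperm i j \o t], solved for the term
    of [A]: a recursion that adds one box. *)
Lemma restr_lower A i j t : #|A| = k -> j = i.+1 :> nat ->
  i \notin A -> j \in A ->
  (1 - lvar j / lvar i) * restr A t =
  rename (tperm i j) (restr (swap_set i j A) (tperm i j \o t)) -
  restr (swap_set i j A) t.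
Proof.
move=> cA ji iA jA; rewrite restr_swap ?card_swap_set //.
rewrite swap_setl swap_setr swap_setK /swap_diag /swap_off iA jA /= mul1r.
have e : tperm i j \o (tperm i j \o t) =1 t by move=> a /=; rewrite tpermK.
by rewrite !(eq_restr _ e) addrAC subrr add0r.
Qed.

Lemma restr_triangular A t : #|A| = k -> injective t ->
  (restr A t != 0 -> [set t a | a in 'I_k] = A \/
     (frame_sum [set t a | a in 'I_k] < frame_sum A)%N) /\
  ([set t a | a in 'I_k] = A -> restr A t = diag_weight A).
Proof.
have [N] := ubnP (frame_sum A); elim: N A t => // N IH A t AN cA tI.
have [Atop|nA] := eqVneq (rev_set A) top.
  by have [h1 h2] := restr_bottom cA tI Atop; split=> // /h1; left.
(* A box can be removed from [A] because one can be added to the reversed diagram. *)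
have [j' [i' [ij' jA' iA']]] : exists i j : 'I_n, [/\ j = i.+1 :> nat,
    i \in rev_set A & j \notin rev_set A].
  by apply: (raisable kn _ nA); rewrite card_rev_set.
pose i := rev_ord i'; pose j := rev_ord j'.
have ji : j = i.+1 :> nat by apply: succ_rev.
have iA : i \notin A by rewrite -mem_rev_set.
have jA : j \in A by rewrite -mem_rev_set.
pose B := swap_set i j A; pose s := tperm i j.
have cB : #|B| = k by rewrite card_swap_set.
have iB : i \in B by rewrite swap_setl.
have jB : j \notin B by rewrite swap_setr.
have AE : A = swap_set i j B by rewrite swap_setK.
have sumA : frame_sum A = (frame_sum B).+1 by rewrite AE frame_sum_raise.
have tsI : injective (s \o t) by apply: inj_comp => //; apply: perm_inj.
have low := restr_lower t cA ji iA jA; rewrite -/B -/s in low.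
have [|h1 h2] := IH B t _ cB tI; first by rewrite -ltnS -sumA.
have [|g1 g2] := IH B (s \o t) _ cB tsI; first by rewrite -ltnS -sumA.
have imE : [set (s \o t) a | a in 'I_k] = swap_set i j [set t a | a in 'I_k].
  exact: im_swap.
have q1 : 1 - lvar j / lvar i != 0.
  by apply: lvar_ratio_neq1; rewrite eq_sym succ_neq.
split=> [nz|tA].
  have [tz|/h1 [->|lt]] := eqVneq (restr B t) 0; last 2 first.
  - by right; rewrite sumA.
  - by right; rewrite sumA; apply: leqW.
  have nz' : restr B (s \o t) != 0.
    apply: contraNneq nz => sz; rewrite sz tz rmorph0 subr0 in low.
    by move/eqP: low; rewrite mulf_eq0 (negPf q1).
  move: nz' => /g1; rewrite imE => -[e|lt].
    by left; rewrite AE -e swap_setK.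
  by right; rewrite sumA ltnS; apply: leq_trans (frame_sum_swap_le _ ji) lt.
(* The fixed point of [A] is outside the support of G_B, as [B] has fewer boxes. *)
have tz : restr B t = 0.
  apply/eqP; apply/negPn/negP => /h1 [e|]; last by rewrite tA sumA ltnNge leqnSn.
  by move: jB; rewrite -e tA jA.
apply: (mulfI q1); rewrite low tz subr0 g2; last by rewrite imE tA.
by rewrite diag_weight_swap // -AE.
Qed.

End Restriction.

Lemma expand_eq (R : comNzRingType) (eA fA eB fB a b c d g : R) :
  (eA * (eB * a + fB * b) + fA * (eB * c + fB * d)) * g =
  eA * (eB * (a * g) + fB * (b * g)) + fA * (eB * (c * g) + fB * (d * g)).
Proof. by ring. Qed.

Lemma combine_eq (R : comNzRingType) (eA fA eB fB gA gA' gB gB' a b c d : R) :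
  (eA * gA + fA * gA') * (eB * gB + fB * gB') =
    eA * (eB * a + fB * b) + fA * (eB * c + fB * d) ->
  eA * (eB * (gA * gB - a) + fB * (gA * gB' - b)) +
  fA * (eB * (gA' * gB - c) + fB * (gA' * gB' - d)) = 0.
Proof.
move=> e; transitivity ((eA * gA + fA * gA') * (eB * gB + fB * gB') -
  (eA * (eB * a + fB * b) + fA * (eB * c + fB * d))); first by ring.
by rewrite e subrr.
Qed.

(** * The product rule *)

Section StructureConstants.
Variables k n : nat.
Hypothesis kn : (k <= n)%N.
Implicit Types (i j : 'I_n) (A B C : {set 'I_n}) (t : 'I_k -> 'I_n).
Local Notation restr := (@restr k n).
Local Notation top := (top_frame k n).
Local Notation P := (frame_fun (@lvar n)).

(** The matrix of the transposition is triangular: an off-diagonal entry leads from a frame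
    containing only [i] to one containing only [j], where the row is diagonal. The diagonal entries
    1 and [q] are non-zero. *)
Lemma swap_action_inj (X : {set 'I_n} -> laurent n) i j :
  let q := lvar j / lvar i in
  (forall A, #|A| = k ->
     swap_diag q (i \in A) (j \in A) * X A +
     swap_off q (i \in A) (j \in A) * X (swap_set i j A) = 0) ->
  forall A, #|A| = k -> X A = 0.
Proof.
move=> q X0.
have uq : q \is a GRing.unit by rewrite unitrM lvar_unit unitrV lvar_unit.
have e_neq0 x y : swap_diag q x y != 0.
  rewrite /swap_diag; case: ifP => _; last exact: oner_neq0.
  by apply: contraTneq uq => ->; rewrite unitr0.
have off0 A : #|A| = k -> swap_off q (i \in A) (j \in A) = 0 -> X A = 0.
  move=> cA f0; have /eqP := X0 A cA; rewrite f0 mul0r addr0 mulf_eq0.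
  by rewrite (negPf (e_neq0 _ _)) => /eqP.
move=> A cA; case: (boolP ((i \in A) && (j \notin A))) => [/andP [iA jA]|ijA].
  have sz : X (swap_set i j A) = 0.
    apply: off0; rewrite ?card_swap_set // swap_setl swap_setr /swap_off.
    by rewrite (negPf jA).
  have /eqP := X0 A cA; rewrite sz mulr0 addr0 mulf_eq0.
  by rewrite (negPf (e_neq0 _ _)) => /eqP.
by apply: off0 => //; rewrite /swap_off (negPf ijA).
Qed.

Definition product_rule t : Prop := forall A B, #|A| = k -> #|B| = k ->
  restr A t * restr B t = \sum_(C : {set 'I_n} | #|C| == k) P A B C * restr C t.

Lemma product_rule_top t : injective t -> [set t a | a in 'I_k] = top ->
  product_rule t.
Proof.
move=> tI tt A B cA cB.
have rE C : #|C| = k -> restr C t = (C == top)%:R.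
  move=> cC; have [tri diag] := restr_triangular kn cC tI.
  have [Ct|nC] := eqVneq C top; first by rewrite diag ?Ct // diag_weight_top.
  apply/eqP; apply: contraNT nC => /tri [<-|]; first by rewrite tt.
  by rewrite tt ltnNge frame_sum_top.
rewrite (bigD1 top) /=; last by rewrite card_top_frame.
rewrite [X in _ + X]big1 => [|C /andP [/eqP cC nC]]; last first.
  by rewrite (rE C cC) (negPf nC) mulr0.
rewrite frame_fun_top !rE ?card_top_frame // eqxx mulr1 addr0.
by rewrite -natrM mulnb.
Qed.

(** Exchanging y_i and y_j in the rule at [t] expresses both sides by values at [tperm i j \o t];
    the difference is the matrix of the transposition, applied in [A] and in [B], to the defect
    [D]. *)
Lemma product_rule_swap t i j : j = i.+1 :> nat ->
  product_rule t -> product_rule (tperm i j \o t).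
Proof.
move=> ji rule; set s := swap_set i j; pose q : laurent n := lvar j / lvar i.
pose e A : laurent n := swap_diag q (i \in A) (j \in A).
pose f A : laurent n := swap_off q (i \in A) (j \in A).
pose g A := restr A (tperm i j \o t).
pose D A B := g A * g B - \sum_(C : {set 'I_n} | #|C| == k) P A B C * g C.
have sK : involutive s by apply: swap_setK.
have cs A : #|s A| = #|A| by apply: card_swap_set.
have exch A B C : e C * rename (tperm i j) (P A B C) +
    f (s C) * rename (tperm i j) (P A B (s C)) =
    e A * (e B * P A B C + f B * P A (s B) C) +
    f A * (e B * P (s A) B C + f B * P (s A) (s B) C).
  rewrite -(frame_fun_exchange A B C ji (@lvar_unit n)).
  rewrite !rmorph_frame_fun; try exact: lvar_unit.
  have -> // : rename (tperm i j) \o @lvar n = @lvar n \o tperm i j.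
  by apply: funext => l /=; rewrite rename_lvar.
have key A B : #|A| = k -> #|B| = k ->
    e A * (e B * D A B + f B * D A (s B)) +
    f A * (e B * D (s A) B + f B * D (s A) (s B)) = 0.
  move=> cA cB.
  have lhs : rename (tperm i j) (restr A t * restr B t) =
      (e A * g A + f A * g (s A)) * (e B * g B + f B * g (s B)).
    by rewrite rmorphM /= !restr_swap.
  have rhs : rename (tperm i j) (restr A t * restr B t) =
      \sum_(C : {set 'I_n} | #|C| == k)
        (e A * (e B * P A B C + f B * P A (s B) C) +
         f A * (e B * P (s A) B C + f B * P (s A) (s B) C)) * g C.
    rewrite rule // rmorph_sum /=.
    transitivity (\sum_(C : {set 'I_n} | #|C| == k)
        e C * rename (tperm i j) (P A B C) * g C +
      \sum_(C : {set 'I_n} | #|C| == k)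
        f C * rename (tperm i j) (P A B C) * g (s C)).
      rewrite -big_split; apply: eq_bigr => C /eqP cC /=.
      rewrite rmorphM /= restr_swap // -/q -/(e C) -/(f C) -/(g _) -/(g _).
      by rewrite mulrDr ![rename _ _ * _]mulrCA !mulrA.
    (* After this reindexing the coefficient of [g C] is the left side of [exch]. *)
    rewrite [X in _ + X](reindex_inj (inv_inj sK)) /=.
    under [X in _ + X]eq_bigl do rewrite cs.
    rewrite -big_split; apply: eq_bigr => C _ /=.
    by rewrite sK -mulrDl exch.
  have sumE a b c d : \sum_(C : {set 'I_n} | #|C| == k)
      (e A * (e B * a C + f B * b C) + f A * (e B * c C + f B * d C)) * g C =
      e A * (e B * (\sum_(C : {set 'I_n} | #|C| == k) a C * g C) +
             f B * \sum_(C : {set 'I_n} | #|C| == k) b C * g C) +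
      f A * (e B * (\sum_(C : {set 'I_n} | #|C| == k) c C * g C) +
             f B * \sum_(C : {set 'I_n} | #|C| == k) d C * g C).
    rewrite !big_distrr -!big_split /= !big_distrr -!big_split /=.
    by apply: eq_bigr => C _; apply: expand_eq.
  rewrite sumE in rhs; move: rhs; rewrite lhs; rewrite /D.
  exact: combine_eq.
move=> A B cA cB; apply/eqP; rewrite -subr_eq0; apply/eqP.
(* The matrix is cancelled in the index [B] here, and in the index [A] below. *)
apply: (swap_action_inj (X := D A) (i := i) (j := j)) => // {}B {}cB.
pose X A' := e B * D A' B + f B * D A' (s B).
apply: (swap_action_inj (X := X) (i := i) (j := j)) => // {}A {}cA.
exact: key.
Qed.

(** Transpositions raise the image of [t] up to the full rectangle; the rule found there is carried
    back by the same transpositions, which are involutions. *)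
Lemma product_ruleP t : injective t -> product_rule t.
Proof.
have [N] := ubnP (n * n - frame_sum [set t a | a in 'I_k])%N.
elim: N t => // N IH t tN tI; set T := [set t a | a in 'I_k] in tN.
have cT : #|T| = k by rewrite card_imset // card_ord.
have [tt|nT] := eqVneq T top; first exact: product_rule_top.
have [i [j [ji iT jT]]] := raisable kn cT nT.
have stI : injective (tperm i j \o t) by apply: inj_comp => //; apply: perm_inj.
have rule : product_rule (tperm i j \o t).
  apply: IH => //; rewrite (_ : [set _ | _ in _] = swap_set i j T).
    by have := frame_sum_raise ji iT jT; have := frame_sum_le (swap_set i j T); lia.
  exact: im_swap.
have e : tperm i j \o (tperm i j \o t) =1 t by move=> a /=; rewrite tpermK.
move=> A B cA cB; have := product_rule_swap ji rule cA cB.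
by rewrite !(eq_restr _ e) => ->; apply: eq_bigr => C _; rewrite (eq_restr _ e).
Qed.

End StructureConstants.

(** * From fixed points back to the quotient ring *)

Section KTheory.
Variables k n : nat.
Hypothesis kn : (k <= n)%N.
Implicit Types (A : {set 'I_n}) (t : {ffun 'I_k -> 'I_n}).
Implicit Types (c d : diagram k n -> laurent n).
Local Notation restr := (@restr k n).

Lemma specialize_yconst t (c : laurent n) :
  specialize t (rename (@rshift k n) c) = c.
Proof.
rewrite /specialize rename_comp; apply: (laurent_rmorph_ext (psi := idfun)) => i /=.
by rewrite rename_lvar /= (unsplitK (inr i) : split (rshift k i) = _).
Qed.

Lemma KT_eqP (lam mu : diagram k n) c :
  KT_groth kn lam * KT_groth kn mu =
    \sum_(nu : diagram k n) KT_const kn (c nu) * KT_groth kn nu <->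
  forall t, strictly_increasing t ->
    restr (val lam) t * restr (val mu) t =
    \sum_(nu : diagram k n) c nu * restr (val nu) t.
Proof.
pose x := dual_groth_sym kn lam * dual_groth_sym kn mu.
pose y := \sum_(nu : diagram k n) yconst k (c nu) * dual_groth_sym kn nu.
have -> : KT_groth kn lam * KT_groth kn mu = \pi_(KT kn)%qT x.
  by rewrite rmorphM.
have -> : \sum_(nu : diagram k n) KT_const kn (c nu) * KT_groth kn nu =
    \pi_(KT kn)%qT y.
  by rewrite rmorph_sum; apply: eq_bigr => nu _; rewrite rmorphM.
have xy t : specialize t (val (x - y)) = restr (val lam) t * restr (val mu) t -
    \sum_(nu : diagram k n) c nu * restr (val nu) t.
  have -> : val (x - y) = val x - \sum_(nu : diagram k n)
      val (yconst k (c nu)) * val (dual_groth_sym kn nu).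
    by rewrite rmorphB rmorph_sum; congr (_ - _);
      apply: eq_bigr => nu _; apply: rmorphM.
  rewrite rmorphB rmorph_sum; congr (_ - _).
    by rewrite [val x]rmorphM [LHS]rmorphM.
  by apply: eq_bigr => nu _; rewrite [LHS]rmorphM /= specialize_yconst.
split=> [/eqP|e].
  rewrite -Quotient.idealrBE => /vanishingP v t /v /eqP.
  by rewrite xy subr_eq0 => /eqP.
apply/eqP; rewrite -Quotient.idealrBE; apply/vanishingP => t ti.
by rewrite xy e // subrr.
Qed.

Lemma big_diagram (V : nmodType) (F : {set 'I_n} -> V) :
  \sum_(A : {set 'I_n} | #|A| == k) F A = \sum_(nu : diagram k n) F (val nu).
Proof.
rewrite (reindex_omap (val : diagram k n -> {set 'I_n}) insub) => [|A cA];
  last by rewrite insubT.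
by apply: eq_bigl => nu; rewrite valK eqxx (valP nu).
Qed.

Lemma increasing_inj t : strictly_increasing t -> injective t.
Proof.
move=> /forallP ti a b tab; apply: val_inj; case: (ltngtP a b) => // ab.
  by have /forallP/(_ b)/implyP/(_ ab) := ti a; rewrite tab ltnn.
by have /forallP/(_ a)/implyP/(_ ab) := ti b; rewrite tab ltnn.
Qed.

Lemma increasing_enum A : #|A| = k ->
  exists2 t, strictly_increasing t & [set t a | a in 'I_k] = A.
Proof.
move=> cA; pose t := [ffun a : 'I_k => enum_val (cast_ord (esym cA) a)].
have tI : injective t.
  by move=> a b; rewrite !ffunE => /enum_val_inj /cast_ord_inj.
exists t; last by apply: im_eq => // a; rewrite ffunE; apply: enum_valP.
apply/forallP => a; apply/forallP => b; apply/implyP => ab; rewrite !ffunE.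
set x := enum_val _; rewrite (enum_val_nth x) -!(nth_map x 0%N val) -?cardE ?cA //.
rewrite {1}/x (enum_val_nth x) -(nth_map x 0%N val) -?cardE ?cA ?ltn_ord //=.
have srt : sorted ltn (map val (enum A)).
  rewrite sorted_map; apply: (@sorted_filter _ (relpre val ltn)).
    by move=> u v w; apply: ltn_trans.
  by rewrite -enumT -sorted_map val_enum_ord iota_ltn_sorted.
by apply: (sorted_ltn_nth ltn_trans 0%N srt) => //; rewrite inE size_map -cardE cA.
Qed.

(** Take a largest diagram with [d nu != 0] and evaluate at its fixed point: every other term
    vanishes by triangularity, and [diag_weight] is non-zero. *)
Lemma restr_free d :
  (forall t, strictly_increasing t ->
     \sum_(nu : diagram k n) d nu * restr (val nu) t = 0) ->
  forall nu, d nu = 0.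
Proof.
move=> d0 nu0; apply/eqP; apply: contraT => nz.
have [nu dnu max_nu] :=
  @arg_maxnP _ nu0 (fun nu => d nu != 0) (fun nu => frame_sum (val nu)) nz.
have cnu (xi : diagram k n) : #|val xi| = k by apply/eqP/(valP xi).
have [t ti tnu] := increasing_enum (cnu nu).
have tI := increasing_inj ti.
have := d0 t ti; rewrite (bigD1 nu) //= big1 ?addr0 => [|xi xinu].
  move/eqP; rewrite mulf_eq0 (negPf dnu) /=.
  have [_ ->] := restr_triangular kn (cnu nu) tI; last exact: tnu.
  by rewrite (negPf (diag_weight_neq0 _)).
have [->|/max_nu le] := eqVneq (d xi) 0; first by rewrite mul0r.
have [tri _] := restr_triangular kn (cnu xi) tI.
apply/eqP; rewrite mulf_eq0; apply/orP; right.
apply: contraT => /tri [e|]; last by rewrite tnu ltnNge (le : is_true (_ <= _)%N).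
by move: xinu; rewrite -val_eqE /= -e tnu eqxx.
Qed.

Lemma KT_product (lam mu : diagram k n) t : strictly_increasing t -> (0 < n)%N ->
  restr (val lam) t * restr (val mu) t =
  \sum_(nu : diagram k n)
    puzzle_sum (val lam) (val mu) (val nu) * restr (val nu) t.
Proof.
move=> /increasing_inj tI n0.
rewrite (product_ruleP kn tI); [|exact/eqP/(valP lam)|exact/eqP/(valP mu)].
rewrite (big_diagram (fun C => _ * restr C t)).
by apply: eq_bigr => nu _; rewrite puzzle_sumE.
Qed.

End KTheory.

(** The equivalence contains both the existence of the expansion, from [KT_product], and the
    uniqueness of its coefficients, from [restr_free], so the basis property is not presupposed. *)
Theorem theorem2 (k n : nat) (kn : (k <= n)%N) (n_gt0 : (0 < n)%N)
    (lam mu : diagram k n) (c : diagram k n -> laurent n) :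
  KT_groth kn lam * KT_groth kn mu =
    \sum_(nu : diagram k n) KT_const kn (c nu) * KT_groth kn nu
  <->
  forall nu : diagram k n,
    c nu = puzzle_sum (val lam) (val mu) (val nu).
Proof.
rewrite KT_eqP; split=> [e nu | e t ti]; last first.
  by rewrite KT_product //; apply: eq_bigr => nu _; rewrite e.
apply/eqP; rewrite -subr_eq0; apply/eqP.
pose d nu := c nu - puzzle_sum (val lam) (val mu) (val nu).
apply: (restr_free kn (d := d)) => t ti.
transitivity (\sum_(nu : diagram k n) c nu * restr (val nu) t -
    \sum_(nu : diagram k n)
      puzzle_sum (val lam) (val mu) (val nu) * restr (val nu) t).
  by rewrite -sumrB; apply: eq_bigr => xi _; rewrite mulrBl.
by rewrite -e // -KT_product // subrr.
Qed.
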